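(* Let $\Omega\subset\mathbf{R}^2$ be an admissible periodicity cell in the sense of the context (in particular, for all local moduli $K,G>0$ the effective elasticity tensor is square symmetric and positive definite, with effective moduli $K^*,G^*,G^*_{45}>0$, which depend on $\Omega$, $K$ and $G$). Then there exist nonnegative real numbers $A_1,A_2,A_3$ depending only on $\Omega$ (in particular, independent of $K$ and $G$) such that for all $K,G>0$ $$\frac{1}{K^*}=\frac1K+A_1\left(\frac1K+\frac1G\right),\qquad \frac{1}{G^*}=\frac1G+A_2\left(\frac1K+\frac1G\right),\qquad \frac{1}{G^*_{45}}=\frac1G+A_3\left(\frac1K+\frac1G\right).$$
   Context: Strain and stress. For a displacement field $u=(u_1,u_2)$ with values in $\mathbf{R}^2$, the strain is $\varepsilon_{ij}(u)=\frac12\left(\frac{\partial u_i}{\partial x_j}+\frac{\partial u_j}{\partial x_i}\right)$. For constants $K>0$ (planar bulk modulus) and $G>0$ (shear modulus), the stress $\sigma=\sigma(u)$ is the symmetric matrix field given by Hooke's law $$\sigma_{11}=(K+G)\varepsilon_{11}+(K-G)\varepsilon_{22},\quad \sigma_{22}=(K-G)\varepsilon_{11}+(K+G)\varepsilon_{22},\quad \sigma_{12}=2G\varepsilon_{12}.$$ The product $\varepsilon(u)\cdot\sigma(u)$ is the Frobenius inner product $\varepsilon_{11}\sigma_{11}+\varepsilon_{22}\sigma_{22}+2\varepsilon_{12}\sigma_{12}$. Geometry. $\Omega\subset\mathbf{R}^2$ is a bounded connected open set with Lipschitz continuous boundary. There are periods $l_1,l_2>0$ such that $\Omega$ is contained in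 a translate $Y$ of $(0,l_1)\times(0,l_2)$ and the periodic extension $\Lambda=\operatorname{Int}\operatorname{Cl}\bigcup_{k\in\mathbf{Z}^2}\big((l_1k_1,l_2k_2)+\Omega\big)$ is also connected and open with Lipschitz continuous boundary. There are a horizontal open segment $\gamma_1\subset\Omega$ and a vertical open segment $\gamma_2\subset\Omega$, of lengths $l_1$ and $l_2$ respectively, each joining opposite faces of $Y$ (so $\gamma_1$ is a translate of $(0,l_1)\times\{\alpha\}$ and $\gamma_2$ a translate of $\{\beta\}\times(0,l_2)$ for some $\alpha,\beta$), and not touching the boundary of any hole in the periodic extension $\Lambda$ (the closed segments $\overline{\gamma_1},\overline{\gamma_2}$ are contained in $\Lambda$). Function spaces. $H^1_{\mathrm{per}}(\Omega)$ is the closed subspace of $H^1(\Omega)$ of elements with equal traces on the opposite faces of $\partial\Omega\cap\partial Y$. $S$ is the set of real symmetric $2\times2$ matrices. For a function $g$ on $\Omega$, the average over $Y$ is $|Y|^{-1}\int_\Omega g\,dx$ (that is, $g$ is extended by zero to $Y\setminus\Omega$). Effective tensor. For $\xi\in S$ let $u$ be a minimizer of the elastic energy $\int_\Omega\varepsilon(u)\cdot\sigma(u)\,dx$ among all $u\in H^1(\Omega)^2$ with $u-\xi x\in H^1_{\mathrm{per}}(\Omega)^2$; it exists and is unique up to translation, so $\sigma=\sigma(u)$ is uniquely determined by $\xi$. The effective elasticity tensor is the linear map sending $\xi$ to the average stress over $Y$. It is assumed (as a restriction on $\Omega$, for all $K,G>0$) to be square symmetric and positive definite, i.e. there are numbers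 $K^*,G^*,G^*_{45}>0$ such that for all $\xi\in S$ $$\begin{pmatrix} |Y|^{-1}\int_\Omega\sigma_{11}\,dx \\ |Y|^{-1}\int_\Omega\sigma_{22}\,dx \\ |Y|^{-1}\int_\Omega\sigma_{12}\,dx \end{pmatrix}=\begin{pmatrix} K^*+G^* & K^*-G^* & 0 \\ K^*-G^* & K^*+G^* & 0 \\ 0 & 0 & G^*_{45} \end{pmatrix}\begin{pmatrix} \xi_{11} \\ \xi_{22} \\ 2\xi_{12} \end{pmatrix}.$$ An admissible periodicity cell is a bounded connected open set $\Omega\subset\mathbf{R}^2$ with Lipschitz continuous boundary, contained in a translate $Y$ of $(0,l_1)\times(0,l_2)$ for some $l_1,l_2>0$, such that its periodic extension $\Lambda$ is connected and open with Lipschitz continuous boundary, such that $\Omega$ contains a horizontal open segment $\gamma_1$ of length $l_1$ and a vertical open segment $\gamma_2$ of length $l_2$, each joining opposite faces of $Y$ and with closure contained in $\Lambda$, and such that for all $K,G>0$ the effective elasticity tensor of $\Omega$ is square symmetric and positive definite. *)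

(* Defs.v *)
From HB Require Import structures.
From mathcomp Require Import all_boot all_order all_algebra.
From mathcomp Require Import all_classical all_reals all_analysis.

Set Implicit Arguments.
Unset Strict Implicit.
Unset Printing Implicit Defensive.
Import Order.TTheory GRing.Theory Num.Theory.
Import numFieldNormedType.Exports.

Local Open Scope classical_set_scope.
Local Open Scope ring_scope.

Section Defs.
Variable R : realType.

Local Notation plane := (R * R)%type.
Local Notation mu1 := (@lebesgue_measure R).
Local Notation mu2 := ((@lebesgue_measure R) \x (@lebesgue_measure R))%E.

Implicit Types (i j : 'I_2) (x p c l : plane) (Omega : set plane).

(** The indices 1, 2 of the mathematical text are [0, 1 : 'I_2]. *)
Definition coord i x : R := if i == 0 then x.1 else x.2.
Definition dir i : plane := ((i == 0)%:R, (i == 1)%:R).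

(** The point of the line [coord i x = s] whose other coordinate is [t]. *)
Definition on_line i (s t : R) : plane := if i == 0 then (s, t) else (t, s).

Definition frontier (A : set plane) : set plane := closure A `\` A°.

(** Near each of its boundary points, [A] is, in suitable Cartesian
    coordinates (axes [(a, b)] and [(- b, a)], origin [p]), the set of points
    lying strictly above the graph of a Lipschitz function. *)
Definition Lipschitz_boundary (A : set plane) : Prop :=
  forall p, frontier A p ->
  exists (a b r h : R) (g : R -> R),
    [/\ a ^+ 2 + b ^+ 2 = 1, 0 < r, 0 < h, lipschitz g &
      g 0 = 0 /\
      forall s t : R, `|s| < r -> `|t| < h ->
        `|g s| < h /\
        (A (p.1 + s * a - t * b, p.2 + s * b + t * a) <-> g s < t)].

Section FunctionSpaces.

Definition L2 d (T : measurableType d) (mu : {measure set T -> \bar R})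
    (A : set T) (f : T -> R) : Prop :=
  measurable_fun A f /\ (\int[mu]_(x in A) ((f x) ^+ 2)%:E < +oo)%E.

(** The square of the distance of [f] and [g] in [L^2(A)]. *)
Definition L2_sqdist d (T : measurableType d)
    (mu : {measure set T -> \bar R}) (A : set T) (f g : T -> R) : \bar R :=
  (\int[mu]_(x in A) ((f x - g x) ^+ 2)%:E)%E.

Fixpoint Ck (k : nat) (f : plane -> R) : Prop :=
  if k is k'.+1 then
    continuous f /\
    forall i, (forall x, derivable f x (dir i)) /\ Ck k' ('D_(dir i) f)
  else continuous f.

Definition smooth (f : plane -> R) : Prop := forall k, Ck k f.

Definition test_function Omega (phi : plane -> R) : Prop :=
  let supp := closure [set x | phi x != 0] in
  [/\ smooth phi, compact supp & supp `<=` Omega].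

Definition is_weak_partial Omega i (u g : plane -> R) : Prop :=
  L2 mu2 Omega g /\
  forall phi, test_function Omega phi ->
    \int[mu2]_(x in Omega) (u x * 'D_(dir i) phi x)
    = - \int[mu2]_(x in Omega) (g x * phi x).

Definition H1 Omega (u : plane -> R) : Prop :=
  L2 mu2 Omega u /\ forall i, exists g, is_weak_partial Omega i u g.

(** A representative of the weak partial derivative, which is unique up to a
    negligible set. *)
Definition weak_partial Omega i (u : plane -> R) : plane -> R :=
  get [set g | is_weak_partial Omega i u g].

(** The part of the boundary of [Omega] on the line [coord i x = s],
    parametrized by the other coordinate. *)
Definition face Omega i (s : R) : set R :=
  [set t | frontier Omega (on_line i s t)].

(** [g] is the trace of [u] on [face Omega i s]: since the functions smooth up
    to the boundary are dense in [H^1] of a bounded Lipschitz domain, the trace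
    operator is the extension by continuity of the restriction of such
    functions. The faces being flat, the arc length on them is the Lebesgue
    measure of the parameter. *)
Definition is_trace Omega i (s : R) (u : plane -> R) (g : R -> R) : Prop :=
  L2 mu1 (face Omega i s) g /\
  exists phi : nat -> plane -> R,
    [/\ forall n, smooth (phi n),
        (fun n => L2_sqdist mu2 Omega (phi n) u) @ \oo --> 0%E,
        forall j, (fun n => L2_sqdist mu2 Omega ('D_(dir j) (phi n))
                              (weak_partial Omega j u)) @ \oo --> 0%E &
        (fun n => L2_sqdist mu1 (face Omega i s)
                    (fun t => phi n (on_line i s t)) g) @ \oo --> 0%E].

(** [c] is the lower left corner and [l] the pair of periods of the cell. The
    traces on two opposite faces are compared where both are defined, i.e., on
    the part along which [Omega] meets its translate by one period. *)
Definition H1per c l Omega (u : plane -> R) : Prop :=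
  H1 Omega u /\
  forall i, exists g h : R -> R,
    [/\ is_trace Omega i (coord i c) u g,
        is_trace Omega i (coord i c + coord i l) u h &
        {ae mu1, forall t, face Omega i (coord i c) t ->
                           face Omega i (coord i c + coord i l) t ->
                           g t = h t}].

End FunctionSpaces.

Section Elasticity.
Variable Omega : set plane.
Implicit Types (K G : R) (xi : 'M[R]_2) (u v : 'I_2 -> plane -> R).

Definition strain u (x : plane) : 'M[R]_2 :=
  \matrix_(i, j) ((weak_partial Omega j (u i) x
                   + weak_partial Omega i (u j) x) / 2).

Definition hooke K G (e : 'M[R]_2) : 'M[R]_2 :=
  \matrix_(i, j)
    if i == j then (K + G) * e i i + (K - G) * e (rev_ord i) (rev_ord i)
    else 2 * G * e i j.

Definition stress K G u (x : plane) : 'M[R]_2 := hooke K G (strain u x).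

Definition frobenius (a b : 'M[R]_2) : R := \sum_i \sum_j a i j * b i j.

Definition energy K G u : R :=
  \int[mu2]_(x in Omega) frobenius (strain u x) (stress K G u x).

Definition linear_field xi i (x : plane) : R := \sum_j xi i j * coord j x.

Definition kinematically_admissible c l xi u : Prop :=
  forall i, H1 Omega (u i) /\ H1per c l Omega (u i \- linear_field xi i).

Definition energy_minimizer c l K G xi u : Prop :=
  kinematically_admissible c l xi u /\
  forall v, kinematically_admissible c l xi v -> energy K G u <= energy K G v.

(** The average over the cell of the extension by zero of the stress. *)
Definition average_stress l K G u : 'M[R]_2 :=
  \matrix_(i, j)
    ((l.1 * l.2)^-1 * \int[mu2]_(x in Omega) stress K G u x i j).

(** The graph of the effective elasticity tensor: [tau] is the average stress
    of an energy minimizer with average strain [xi]. The minimizer being unique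
    up to translation, [tau] is determined by [xi]. *)
Definition effective_tensor c l K G xi (tau : 'M[R]_2) : Prop :=
  exists u, energy_minimizer c l K G xi u /\ tau = average_stress l K G u.

(** The effective elasticity tensor is square symmetric and positive definite,
    with the moduli [Ks], [Gs] and [G45]. *)
Definition effective_moduli c l K G (Ks Gs G45 : R) : Prop :=
  [/\ 0 < Ks, 0 < Gs, 0 < G45 &
   forall xi, xi^T = xi ->
   exists2 tau, effective_tensor c l K G xi tau &
    [/\ tau 0 0 = (Ks + Gs) * xi 0 0 + (Ks - Gs) * xi 1 1,
        tau 1 1 = (Ks - Gs) * xi 0 0 + (Ks + Gs) * xi 1 1 &
        tau 0 1 = G45 * (2 * xi 0 1)]].

End Elasticity.

Definition periodic_extension l Omega : set plane :=
  (closure [set x | exists (k1 k2 : int) (y : plane),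
     Omega y /\ x = (l.1 * k1%:~R + y.1, l.2 * k2%:~R + y.2)])°.

(** The inclusion of [Omega] in the rectangle and of the two segments in [Omega]
    determine [c] and [l] from [Omega]. *)
Definition periodicity_cell c l Omega : Prop :=
  let Lambda := periodic_extension l Omega in
  [/\ 0 < l.1 /\ 0 < l.2,
      [/\ bounded_set Omega, connected Omega, open Omega
        & Lipschitz_boundary Omega]
      /\ Omega `<=` `]c.1, c.1 + l.1[ `*` `]c.2, c.2 + l.2[,
      [/\ connected Lambda, open Lambda & Lipschitz_boundary Lambda],
      (exists alpha : R,
         let gamma1 : set plane := `]c.1, c.1 + l.1[ `*` [set alpha] in
         gamma1 `<=` Omega /\ closure gamma1 `<=` Lambda) &
      (exists beta : R,
         let gamma2 : set plane := [set beta] `*` (`]c.2, c.2 + l.2[) in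
         gamma2 `<=` Omega /\ closure gamma2 `<=` Lambda)].

Definition admissible_cell Omega : Prop :=
  exists c l, periodicity_cell c l Omega /\
    forall K G : R, 0 < K -> 0 < G ->
      exists Ks Gs G45, effective_moduli Omega c l K G Ks Gs G45.

End Defs.

(* Main.v *)
(** The energy density of a stress [s] is [(1/K + 1/G) (tr s)^2 / 4 - det s / G].
    The stress of a minimizer, extended by zero across the holes, is a periodic
    divergence-free symmetric field on the torus, and [det] is a null Lagrangian
    for such fields: the Fourier coefficients at a nonzero frequency have rank
    at most one, so that the average of [det s] is the determinant of the average
    of [s]; by polarization, the same holds for two fields with the same average.
    Testing the Euler-Lagrange equations of two minimizers, for different moduli
    but with the same average stress [t], against each other then shows that the
    average [M] of [(tr s)^2 / 4] is the same for both, so the effective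
    compliance is [(1/K + 1/G) M(t) - det t / G], with [M(t)] independent of [K]
    and [G]. The average stresses [I], [diag(1, -1)] and the unit shear give
    [A1 = M(I) - 1], [A2 = M(diag(1, -1))] and [A3 = M(shear)]; [M(I) >= 1] by
    Cauchy-Schwarz. *)

Require Import Defs.
From mathcomp Require Import all_boot all_order all_algebra.
From mathcomp Require Import all_classical all_reals all_analysis.
From mathcomp Require Import measurable_realfun ring lra.
Import Order.TTheory GRing.Theory Num.Theory.
Import numFieldNormedType.Exports.
Import HBNNSimple.
Local Open Scope classical_set_scope.
Local Open Scope ring_scope.
Set Implicit Arguments.
Unset Strict Implicit.
Unset Printing Implicit Defensive.

(** The divergence equation is used in weak form, tested against trigonometric polynomials.
    Restricted to [Omega] these are smooth periodic functions, hence admissible variations, and the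
    Euler-Lagrange equation over [Omega] is already the weak equation of the zero extension over the
    cell, traction-free holes included. The null Lagrangian identity rests on Parseval's formula,
    hence on completeness of the trigonometric system, derived from a density criterion for a
    pi-system of quadrants.

    The chosen weak derivatives are arbitrary representatives, so the strain is linear in the
    displacement only almost everywhere. Uniqueness of weak derivatives supplies this; it comes from
    the same density criterion, applied to smooth bumps.

    Write [M_ab] for the mixed trace term of the stresses [a] and [b] with common average [t]. Both
    [M_10] and [M_11] solve one scalar equation, the work of either stress against the strain of
    minimizer 1 being its average strain times [t]; and [M_01 = M_10] by symmetry. One reference
    material therefore determines the constants. *)

Local Notation coord := Defs.coord.

(** * The inner product of L^2 *)

Section L2_theory.
Context d (T : measurableType d) (R : realType).
Variables (mu : {measure set T -> \bar R}) (D : set T).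
Hypothesis mD : measurable D.
Implicit Types f g h : T -> R.

Lemma L2_meas f : L2 mu D f -> measurable_fun D f.
Proof. by case. Qed.

Lemma L2_integrable_sqr f : L2 mu D f ->
  mu.-integrable D (EFin \o (fun x => f x ^+ 2)).
Proof.
case=> mf fi; apply/integrableP; split.
  by apply/measurable_EFinP; exact: measurable_funX.
rewrite (eq_integral (fun x => (f x ^+ 2)%:E)) // => x _ /=.
by rewrite ger0_norm // sqr_ge0.
Qed.

Lemma integrable_sqr_L2 f : measurable_fun D f ->
  mu.-integrable D (EFin \o (fun x => f x ^+ 2)) -> L2 mu D f.
Proof.
move=> mf /integrableP[_ fi]; split=> //.
move: fi; rewrite (eq_integral (fun x => (f x ^+ 2)%:E)) // => x _ /=.
by rewrite ger0_norm // sqr_ge0.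
Qed.

Lemma L2_integrableM f g : L2 mu D f -> L2 mu D g ->
  mu.-integrable D (EFin \o (fun x => f x * g x)).
Proof.
move=> Lf Lg.
have If := L2_integrable_sqr Lf; have Ig := L2_integrable_sqr Lg.
apply: (le_integrable mD _ _ (integrableD mD If Ig)).
  by apply/measurable_EFinP/measurable_funM; apply: L2_meas.
move=> x _ /=; rewrite lee_fin normrM.
rewrite [leRHS]ger0_norm ?addr_ge0 ?sqr_ge0 //.
rewrite -(real_normK (num_real (f x))) -(real_normK (num_real (g x))).
have := sqr_ge0 (`|f x| - `|g x|); have := normr_ge0 (f x); have := normr_ge0 (g x).
nra.
Qed.

Lemma L2D f g : L2 mu D f -> L2 mu D g -> L2 mu D (fun x => f x + g x).
Proof.
move=> Lf Lg; apply: integrable_sqr_L2.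
  by apply: measurable_funD; apply: L2_meas.
have If := L2_integrable_sqr Lf; have Ig := L2_integrable_sqr Lg.
have Ifg := integrableZl mD 2 (L2_integrableM Lf Lg).
apply: eq_integrable (integrableD mD (integrableD mD If Ig) Ifg) => //.
by move=> x _ /=; congr EFin; ring.
Qed.

Lemma L2Z (a : R) f : L2 mu D f -> L2 mu D (fun x => a * f x).
Proof.
move=> Lf; apply: integrable_sqr_L2.
  by apply: measurable_funM; [exact: measurable_cst|apply: L2_meas].
apply: eq_integrable (integrableZl mD (a ^+ 2) (L2_integrable_sqr Lf)) => //.
by move=> x _ /=; congr EFin; ring.
Qed.

Lemma L2B f g : L2 mu D f -> L2 mu D g -> L2 mu D (fun x => f x - g x).
Proof.
move=> Lf Lg; have -> : (fun x => f x - g x) = (fun x => f x + (-1) * g x).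
  by apply/funext => x; ring.
by apply: L2D => //; exact: L2Z.
Qed.

Lemma L2_lin (a : R) f g : L2 mu D f -> L2 mu D g ->
  L2 mu D (fun x => a * f x + g x).
Proof. by move=> Lf Lg; apply: L2D => //; exact: L2Z. Qed.

Lemma L2_0 : L2 mu D (fun=> 0).
Proof.
split; first exact: measurable_cst.
by rewrite expr0n /= integral0.
Qed.

Lemma L2_sum I (r : seq I) (F : I -> T -> R) : (forall i, L2 mu D (F i)) ->
  L2 mu D (fun x => \sum_(i <- r) F i x).
Proof.
move=> LF; elim: r => [|i r IHr].
  by under eq_fun do rewrite big_nil; exact: L2_0.
by under eq_fun do rewrite big_cons; exact: L2D.
Qed.

Lemma L2_bounded f (M : R) : (mu D < +oo)%E -> measurable_fun D f ->
  (forall x, D x -> `|f x| <= M) -> L2 mu D f.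
Proof.
move=> muD mf fM; apply: integrable_sqr_L2 => //.
apply: measurable_bounded_integrable => //; first exact: measurable_funX.
exists (M ^+ 2); split; first exact: num_real.
move=> y My x Dx; apply: le_trans (ltW My).
by rewrite normrX lerXn2r ?nnegrE ?(le_trans _ (fM _ Dx)) // fM.
Qed.

Lemma L2_cst (a : R) : (mu D < +oo)%E -> L2 mu D (fun=> a).
Proof. by move=> muD; apply: (@L2_bounded _ `|a|). Qed.

Lemma eq_L2 f g : (forall x, D x -> f x = g x) -> L2 mu D f -> L2 mu D g.
Proof.
move=> fg [mf fi]; split.
  by apply: eq_measurable_fun mf => x /set_mem /fg.
by rewrite (eq_integral (fun x => (f x ^+ 2)%:E)) // => x /set_mem /fg ->.
Qed.

Definition ip f g : R := \int[mu]_(x in D) (f x * g x).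

Lemma ipC f g : ip f g = ip g f.
Proof. by apply: eq_Rintegral => x _; rewrite mulrC. Qed.

Lemma eq_ip f f' g g' : (forall x, D x -> f x = f' x) ->
  (forall x, D x -> g x = g' x) -> ip f g = ip f' g'.
Proof.
by move=> ff gg; apply: eq_Rintegral => x /set_mem Dx; rewrite ff ?gg.
Qed.

Lemma ip_linl (a : R) f g h : L2 mu D f -> L2 mu D g -> L2 mu D h ->
  ip (fun x => a * f x + g x) h = a * ip f h + ip g h.
Proof.
move=> Lf Lg Lh; rewrite /ip.
under eq_Rintegral do rewrite mulrDl -mulrA.
rewrite RintegralD ?RintegralZl //; last exact: L2_integrableM.
- exact: L2_integrableM.
- by apply: (integrableZl mD a (L2_integrableM Lf Lh)).
Qed.

Lemma ipDl f g h : L2 mu D f -> L2 mu D g -> L2 mu D h ->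
  ip (fun x => f x + g x) h = ip f h + ip g h.
Proof.
move=> Lf Lg Lh; rewrite -[ip f h]mul1r -ip_linl //.
by apply: eq_ip => // x _; rewrite mul1r.
Qed.

Lemma ip0l h : ip (fun=> 0) h = 0.
Proof.
rewrite /ip; under eq_Rintegral do rewrite mul0r.
by rewrite Rintegral_cst // mul0r.
Qed.

Lemma ipZl (a : R) f h : L2 mu D f -> L2 mu D h ->
  ip (fun x => a * f x) h = a * ip f h.
Proof.
move=> Lf Lh; rewrite -[RHS]addr0 -[in RHS](ip0l h) -ip_linl //; last exact: L2_0.
by apply: eq_ip => // x _; rewrite addr0.
Qed.

Lemma ipBl f g h : L2 mu D f -> L2 mu D g -> L2 mu D h ->
  ip (fun x => f x - g x) h = ip f h - ip g h.
Proof.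
move=> Lf Lg Lh; rewrite addrC -mulN1r -ip_linl //.
by apply: eq_ip => // x _; rewrite mulN1r addrC.
Qed.

Lemma ip_linr (a : R) f g h : L2 mu D f -> L2 mu D g -> L2 mu D h ->
  ip h (fun x => a * f x + g x) = a * ip h f + ip h g.
Proof. by move=> *; rewrite ipC ip_linl // (ipC f) (ipC g). Qed.

Lemma ipDr f g h : L2 mu D f -> L2 mu D g -> L2 mu D h ->
  ip h (fun x => f x + g x) = ip h f + ip h g.
Proof. by move=> *; rewrite ipC ipDl // (ipC f) (ipC g). Qed.

Lemma ipBr f g h : L2 mu D f -> L2 mu D g -> L2 mu D h ->
  ip h (fun x => f x - g x) = ip h f - ip h g.
Proof. by move=> *; rewrite ipC ipBl // (ipC f) (ipC g). Qed.

Lemma ipZr (a : R) f h : L2 mu D f -> L2 mu D h ->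
  ip h (fun x => a * f x) = a * ip h f.
Proof. by move=> *; rewrite ipC ipZl // (ipC f). Qed.

Lemma ip0r h : ip h (fun=> 0) = 0.
Proof. by rewrite ipC ip0l. Qed.

Lemma ip_suml I (r : seq I) (F : I -> T -> R) h :
  (forall i, L2 mu D (F i)) -> L2 mu D h ->
  ip (fun x => \sum_(i <- r) F i x) h = \sum_(i <- r) ip (F i) h.
Proof.
move=> LF Lh; elim: r => [|i r IHr].
  by rewrite big_nil -[RHS](ip0l h); congr ip; apply/funext => x; rewrite big_nil.
rewrite big_cons -IHr -ipDl //; last exact: L2_sum.
by apply: eq_ip => // x _; rewrite big_cons.
Qed.

Lemma ip_ge0 f : 0 <= ip f f.
Proof. by apply: Rintegral_ge0 => x _; rewrite -expr2 sqr_ge0. Qed.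

Lemma ip_cst1 f : \int[mu]_(x in D) f x = ip f (fun=> 1).
Proof. by apply: eq_Rintegral => x _; rewrite mulr1. Qed.

Lemma L2_sqdistE f g : L2 mu D f -> L2 mu D g ->
  L2_sqdist mu D f g =
  (ip (fun x => f x - g x) (fun x => f x - g x))%:E.
Proof.
move=> Lf Lg; rewrite /L2_sqdist /ip /Rintegral fineK; last first.
  by apply: integrable_fin_num => //; exact: (L2_integrableM (L2B Lf Lg) (L2B Lf Lg)).
by congr (integral _ _ _); apply/funext => x; rewrite expr2.
Qed.

Lemma ip_eq0 f : L2 mu D f -> ip f f = 0 ->
  {ae mu, forall x, D x -> f x = 0}.
Proof.
move=> Lf f0.
have mf2 : measurable_fun D (fun x => (f x ^+ 2)%:E).
  by apply/measurable_EFinP/measurable_funX; apply: L2_meas.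
suff /(ae_eq_integral_abs mu mD mf2) : (\int[mu]_(x in D) (`|(f x ^+ 2)%:E|) = 0)%E.
  apply: filterS => x fx Dx; have [/eqP] := fx Dx.
  by rewrite sqrf_eq0 => /eqP.
move: f0; rewrite /ip /Rintegral => f0.
rewrite -[RHS]/(0%:E) -[in RHS]f0 fineK; last first.
  by apply: integrable_fin_num => //; exact: (L2_integrableM Lf Lf).
by apply: eq_integral => x _; rewrite -expr2 /= ger0_norm // sqr_ge0.
Qed.

Lemma ae_eq_ip f f' g g' : L2 mu D f -> L2 mu D f' ->
  L2 mu D g -> L2 mu D g' ->
  {ae mu, forall x, D x -> f x = f' x} ->
  {ae mu, forall x, D x -> g x = g' x} -> ip f g = ip f' g'.
Proof.
move=> Lf Lf' Lg Lg' ff gg; congr fine; apply: ae_eq_integral => //.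
- by apply/measurable_EFinP/measurable_funM; apply: L2_meas.
- by apply/measurable_EFinP/measurable_funM; apply: L2_meas.
by apply: filterS2 ff gg => x fx gx Dx; rewrite fx // gx.
Qed.

(** The limit inherits the bound [g], so the squared error is at most [4 * g ^+ 2] and dominated
    convergence applies. *)
Lemma dominated_L2_cvg (f_ : nat -> T -> R) f g :
  (forall n, measurable_fun D (f_ n)) -> measurable_fun D f -> L2 mu D g ->
  (forall x, D x -> f_ ^~ x @ \oo --> f x) ->
  (forall n x, D x -> `|f_ n x| <= g x) ->
  forall e, 0 < e ->
  exists n, ip (fun x => f x - f_ n x) (fun x => f x - f_ n x) < e.
Proof.
move=> mf_ mf Lg ff fg e e0.
have fg' x : D x -> `|f x| <= g x.
  move=> Dx; have cf : `|f_ n x| @[n --> \oo] --> `|f x| by apply: cvg_norm; exact: ff.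
  by apply: (cvgr_to_le cf); apply: nearW => n; exact: fg.
have Lfn n : L2 mu D (fun x => f x - f_ n x).
  apply: integrable_sqr_L2; first exact: measurable_funB.
  apply: (le_integrable mD _ _ (integrableZl mD 4 (L2_integrable_sqr Lg))).
    by apply/measurable_EFinP/measurable_funX/measurable_funB.
  move=> x Dx /=; rewrite lee_fin ger0_norm ?sqr_ge0 // [leRHS]ger0_norm; last first.
    by rewrite mulr_ge0 // sqr_ge0.
  have := fg' _ Dx; have := fg n _ Dx; rewrite !ler_norml => /andP[? ?] /andP[? ?].
  nra.
have := @dominated_cvg _ _ _ mu D mD
  (fun n x => ((f x - f_ n x) ^+ 2)%:E) (fun=> 0%E) (fun x => (4 * g x ^+ 2)%:E).
rewrite integral0 => /(_ _ _ _ _ _)/fine_cvgP[].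
- by move=> n; apply/measurable_EFinP/measurable_funX/measurable_funB.
- move=> x Dx; apply/fine_cvgP; split; first exact: nearW.
  have : f x - f_ n x @[n --> \oo] --> f x - f x by apply: cvgB; [exact: cvg_cst|exact: ff].
  rewrite subrr => h; have := cvgM h h; rewrite mulr0; exact.
- by [].
- exact: (integrableZl mD 4 (L2_integrable_sqr Lg)).
- move=> n x Dx /=; rewrite lee_fin ger0_norm ?sqr_ge0 //.
  have := fg' _ Dx; have := fg n _ Dx; rewrite !ler_norml => /andP[? ?] /andP[? ?].
  nra.
move=> _ /cvgr_lt /(_ _ e0) [N _ /(_ N (leqnn N))] /= h; exists N.
by move: h; congr (_ < _); apply: eq_Rintegral => x _; rewrite expr2.
Qed.

End L2_theory.

(** * Density in L^2 *)

Section L2_density.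
Context d (T : measurableType d) (R : realType).
Variables (mu : {measure set T -> \bar R}) (D : set T).
Hypothesis mD : measurable D.
Hypothesis muD : (mu D < +oo)%E.
Variable S : set (T -> R).
Hypothesis S_L2 : forall f, S f -> L2 mu D f.
Hypothesis S0 : S (fun=> 0).
Hypothesis S_lin : forall a f g, S f -> S g -> S (fun x => a * f x + g x).
Implicit Types f g h : T -> R.

Definition L2_closure f : Prop :=
  L2 mu D f /\ forall e, 0 < e ->
  exists2 g, S g & ip mu D (fun x => f x - g x) (fun x => f x - g x) < e.

Lemma sub_L2_closure f : S f -> L2_closure f.
Proof.
move=> Sf; split; first exact: S_L2.
move=> e e0; exists f => //; rewrite (@eq_ip _ _ _ _ _ _ (cst 0) _ (cst 0)).
- by rewrite ip0l.
- by move=> x _; rewrite subrr.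
- by move=> x _; rewrite subrr.
Qed.

(** The parallelogram law with the norm of the difference dropped. It stands in for the triangle
    inequality, since all distances here are squared. *)
Lemma ip_sqrD f g : L2 mu D f -> L2 mu D g ->
  ip mu D (fun x => f x + g x) (fun x => f x + g x) <=
  2 * ip mu D f f + 2 * ip mu D g g.
Proof.
move=> Lf Lg; have := ip_ge0 mu D (fun x => f x - g x).
rewrite ipBl ?ipBr //; try exact: L2B.
rewrite (ipDl mD Lf Lg) ?ipDr //; try exact: L2D.
rewrite (ipC _ _ g f); lra.
Qed.

Lemma L2_closure_lin a f g :
  L2_closure f -> L2_closure g -> L2_closure (fun x => a * f x + g x).
Proof.
move=> [Lf cf] [Lg cg]; split; first exact: L2_lin.
move=> e e0.
(* Each of the two terms of [ip_sqrD] is to stay below [e / 2]; [1 + a ^+ 2] in place of [a ^+ 2]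
   allows [a = 0]. *)
have e1 : 0 < e / (4 * (1 + a ^+ 2)).
  by rewrite divr_gt0 // mulr_gt0 // ltr_pwDl // sqr_ge0.
have [f' Sf' hf] := cf _ e1; have [g' Sg' hg] := cg _ (divr_gt0 e0 (ltr0n _ 4)).
have Lf' := S_L2 Sf'; have Lg' := S_L2 Sg'.
exists (fun x => a * f' x + g' x); first exact: S_lin.
rewrite (@eq_ip _ _ _ _ _ _ (fun x => a * (f x - f' x) + (g x - g' x)) _
   (fun x => a * (f x - f' x) + (g x - g' x))); last 2 first.
- by move=> x _; ring.
- by move=> x _; ring.
apply: le_lt_trans (ip_sqrD _ _) _.
- by apply: L2Z => //; exact: L2B.
- exact: L2B.
rewrite ipZl ?ipZr //; try exact: L2B; last by apply: L2Z => //; exact: L2B.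
have := ip_ge0 mu D (fun x => f x - f' x).
move: hf hg; set p := ip _ _ _ _; set q := ip _ _ _ _.
rewrite ltr_pdivlMr; last by rewrite mulr_gt0 // ltr_pwDl // sqr_ge0.
rewrite ltr_pdivlMr //.
have -> : a * (a * p) = a ^+ 2 * p by ring.
have := sqr_ge0 a; move: (a ^+ 2) => b *; nra.
Qed.

Lemma L2_closureZ a f : L2_closure f -> L2_closure (fun x => a * f x).
Proof.
move=> cf; have := L2_closure_lin a cf (sub_L2_closure S0).
by congr L2_closure; apply/funext => x; rewrite addr0.
Qed.

Lemma L2_closureD f g :
  L2_closure f -> L2_closure g -> L2_closure (fun x => f x + g x).
Proof.
move=> cf cg; have := L2_closure_lin 1 cf cg.
by congr L2_closure; apply/funext => x; rewrite mul1r.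
Qed.

Lemma L2_closureB f g :
  L2_closure f -> L2_closure g -> L2_closure (fun x => f x - g x).
Proof.
move=> cf cg; have := L2_closure_lin (-1) cg cf.
by congr L2_closure; apply/funext => x; rewrite mulN1r addrC.
Qed.

Lemma L2_closure_sum I (r : seq I) (F : I -> T -> R) :
  (forall i, L2_closure (F i)) -> L2_closure (fun x => \sum_(i <- r) F i x).
Proof.
move=> cF; elim: r => [|i r IHr].
  under eq_fun do rewrite big_nil; exact: sub_L2_closure.
by under eq_fun do rewrite big_cons; exact: L2_closureD.
Qed.

Lemma L2_closure_lim f : L2 mu D f ->
  (forall e, 0 < e -> exists2 g, L2_closure g &
    ip mu D (fun x => f x - g x) (fun x => f x - g x) < e) -> L2_closure f.
Proof.
move=> Lf cf; split=> // e e0; have e4 : 0 < e / 4 by rewrite divr_gt0.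
have [g [Lg cg] fg] := cf _ e4; have [h Sh gh] := cg _ e4.
have Lh := S_L2 Sh.
exists h => //; rewrite (@eq_ip _ _ _ _ _ _ (fun x => (f x - g x) + (g x - h x)) _
   (fun x => (f x - g x) + (g x - h x))); last 2 first.
- by move=> x _; ring.
- by move=> x _; ring.
apply: le_lt_trans (ip_sqrD _ _) _; [exact: L2B|exact: L2B|].
by move: fg gh; move: (ip _ _ _ _) (ip _ _ _ _) => p q; lra.
Qed.

Lemma L2_closure_dominated (f_ : nat -> T -> R) f g :
  (forall n, L2_closure (f_ n)) -> L2 mu D f -> L2 mu D g ->
  (forall x, D x -> f_ ^~ x @ \oo --> f x) ->
  (forall n x, D x -> `|f_ n x| <= g x) -> L2_closure f.
Proof.
move=> cf_ Lf Lg ff fg; apply: L2_closure_lim => // e e0.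
have [n hn] := dominated_L2_cvg mD (fun n => L2_meas (cf_ n).1) (L2_meas Lf) Lg
  ff fg e0.
by exists (f_ n).
Qed.

Lemma L2_indic (A : set T) : measurable A -> L2 mu D (\1_A : T -> R).
Proof.
move=> mA; apply: (@L2_bounded _ _ _ _ _ mD _ 1) => //.
by move=> x _; rewrite indicE; case: (_ \in _); rewrite ?normr1 ?normr0.
Qed.

Variable G : set (set T).
Hypothesis G_gen : @measurable _ T = <<s G >>.
Hypothesis GI : setI_closed G.
Hypothesis cT : L2_closure (fun=> 1).
Hypothesis cG : forall A, G A -> L2_closure (\1_A : T -> R).

(** The sets whose indicator lies in the closure form a Dynkin system: complements by linearity,
    disjoint unions by dominated convergence. It contains the pi-system [G] of generators. *)
Lemma L2_closure_indic (A : set T) : measurable A -> L2_closure (\1_A : T -> R).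
Proof.
move=> mA; have : <<s G >> A by rewrite -G_gen.
move: A {mA}; apply: (dynkin_induction G_gen GI); first by rewrite indicT.
- exact: cG.
- move=> A mA cA; have := L2_closureB cT cA; congr L2_closure.
  apply/funext => x; rewrite !indicE in_setC.
  by case: (x \in A); rewrite /= ?subrr ?subr0.
move=> F mF tF cF.
pose f n := \1_(\bigcup_(k < n) F k) : T -> R.
have cf n : L2_closure (f n).
  elim: n => [|n IHn].
    have := sub_L2_closure S0; congr L2_closure; apply/funext => x.
    by rewrite /f bigcup_mkord big_ord0 indic0.
  have := L2_closureD IHn (cF n); congr L2_closure; apply/funext => x.
  rewrite /f (bigcup_mkord n.+1) big_ord_recr /= -bigcup_mkord !indicE in_setU.
  have [xn|] := boolP (x \in F n); last by rewrite orbF addr0.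
  have -> : (x \in \bigcup_(k < n) F k) = false.
    apply/negbTE/negP => /set_mem[k /= kn Fk].
    have kn' : k = n by apply: tF => //; exists x; split => //; exact: set_mem.
    by rewrite kn' ltnn in kn.
  by rewrite /= add0r.
apply: (L2_closure_dominated cf _ (L2_cst mD 1 muD)).
- by apply: L2_indic; exact: bigcup_measurable.
- move=> x _; rewrite /f indicE; have [/set_mem[k _ Fk]|xF] := boolP (x \in _).
    apply: cvg_near_cst; exists k.+1 => // n /= kn; rewrite indicE mem_set //.
    by exists k.
  apply: cvg_near_cst; apply: nearW => n; rewrite indicE; apply/eqP.
  rewrite (_ : (x \in _) = false) //; apply/negbTE; apply: contra xF.
  by move=> /set_mem[k _ Fk]; apply/mem_set; exists k.
- by move=> n x _; rewrite /f indicE; case: (_ \in _); rewrite ?normr1 ?normr0.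
Qed.

(** Simple functions increase to [f], and [f] itself dominates them. *)
Lemma L2_closure_nneg f : L2 mu D f -> (forall x, D x -> 0 <= f x) ->
  L2_closure f.
Proof.
move=> Lf f0.
have mf : measurable_fun D (EFin \o f) by apply/measurable_EFinP; case: Lf.
pose f_ n := fun x => nnsfun_approx mD mf n x : R.
have f_f x : D x -> f_ ^~ x @ \oo --> f x.
  move=> Dx; have := @cvg_nnsfun_approx _ _ _ _ mD _ mf f0 x Dx.
  by move=> /fine_cvgP[].
apply: (@L2_closure_dominated f_ _ f) => //.
  move=> n; pose g := nnsfun_approx mD mf n.
  have -> : f_ n = _ := funext (fimfunEord g).
  apply: L2_closure_sum => i; apply: L2_closureZ; apply: L2_closure_indic.
  exact: measurable_sfunP.
move=> n x Dx; rewrite ger0_norm; last exact: fun_ge0.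
apply: (cvgr_to_ge (f_f x Dx)).
exists n => // m /= nm; rewrite /f_.
by have /lefP := nd_nnsfun_approx mD mf nm; apply.
Qed.

Theorem L2_closureT f : L2 mu D f -> L2_closure f.
Proof.
move=> Lf.
have Lm g : L2 mu D g -> L2 mu D (fun x => Num.max (g x) 0).
  case=> mg ig; apply: integrable_sqr_L2 => //; first exact: measurable_maxr.
  apply: (le_integrable mD _ _ (L2_integrable_sqr (conj mg ig))).
    by apply/measurable_EFinP/measurable_funX; exact: measurable_maxr.
  move=> x _ /=; rewrite lee_fin !ger0_norm ?sqr_ge0 //.
  by case: (leP (g x) 0) => _ //; rewrite expr0n sqr_ge0.
have := L2_closureB (L2_closure_nneg (Lm _ Lf) _) (L2_closure_nneg (Lm _ (L2Z mD (-1) Lf)) _).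
have -> : (fun x => Num.max (f x) 0 - Num.max (-1 * f x) 0) = f.
  apply/funext => x; rewrite mulN1r; case: (leP (f x) 0); case: (leP (- f x) 0); lra.
by apply; move=> x _; rewrite le_max lexx orbT.
Qed.

End L2_density.

(** * Lebesgue measure on the plane *)

Section plane_measure.
Context {R : realType}.
Local Notation plane := (R * R)%type.
Local Notation mu1 := (@lebesgue_measure R).
Local Notation mu2 := ((@lebesgue_measure R) \x (@lebesgue_measure R))%E.
Implicit Types (a b c d : R).

(** A pi-system generating the measurable sets of the plane. The indicator of a quadrant is a
    product of indicators of rays, which reduces density questions to one variable. *)
Definition quadrants : set (set plane) :=
  [set A | exists x y : R, A = `]x, +oo[%classic `*` `]y, +oo[%classic].

Lemma quadrants_setI : setI_closed quadrants.
Proof.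
move=> _ _ [x [y ->]] [x' [y' ->]]; exists (Num.max x x'), (Num.max y y').
apply/seteqP; split=> -[u v] /=; rewrite !in_itv /= !andbT !gt_max.
  by move=> [[-> ->] [-> ->]].
by move=> [/andP[-> ->] /andP[-> ->]].
Qed.

Lemma ray_bigcup (x : R) : exists n : nat, - n%:R < x.
Proof.
exists (Num.truncn `|x|).+1; rewrite ltrNl.
by rewrite (le_lt_trans _ (truncnS_gt _)) // -normrN ler_norm.
Qed.

Lemma measurable_plane : @measurable _ plane = <<s quadrants >>.
Proof.
rewrite eqEsubset; split; last first.
  apply: smallest_sub; first exact: sigma_algebra_measurable.
  by move=> _ [x [y ->]]; apply: measurableX; exact: measurable_itv.
have mR : @measurable _ R = <<s @RGenOInfty.G R >> := RGenOInfty.measurableE R.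
have sQ := smallest_sigma_algebra [set: plane] quadrants.
apply: smallest_sub => //; rewrite subUset; split=> _ [X mX <-].
rewrite setTI; move: mX; rewrite mR.
  have := sigma_algebra_image (@fst R R) sQ.
  move=> /(@smallest_sub _ _ (@RGenOInfty.G R)) h /h; rewrite /image_set_system /=.
  rewrite setTI; apply => _ [x ->] /=; rewrite setTI.
  rewrite (_ : _ @^-1` _ = \bigcup_n (`]x, +oo[%classic `*` `](- n%:R), +oo[%classic)).
    by apply: sigma_algebra_bigcup => n; apply: sub_sigma_algebra; exists x, (- n%:R).
  apply/seteqP; split=> -[u v] /=; last by move=> [n _ []].
  by move=> ux; have [n nv] := ray_bigcup v; exists n => //; split; rewrite //= in_itv /= nv.
rewrite setTI; move: mX; rewrite mR.
have := sigma_algebra_image (@snd R R) sQ.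
move=> /(@smallest_sub _ _ (@RGenOInfty.G R)) h /h; rewrite /image_set_system /=.
rewrite setTI; apply => _ [x ->] /=; rewrite setTI.
rewrite (_ : _ @^-1` _ = \bigcup_n (`](- n%:R), +oo[%classic `*` `]x, +oo[%classic)).
  by apply: sigma_algebra_bigcup => n; apply: sub_sigma_algebra; exists (- n%:R), x.
apply/seteqP; split=> -[u v] /=; last by move=> [n _ []].
by move=> ux; have [n nv] := ray_bigcup u; exists n => //; split; rewrite //= in_itv /= nv.
Qed.

Definition obox a b c d : set plane := `]a, b[%classic `*` `]c, d[%classic.
Definition cbox a b c d : set plane := `[a, b]%classic `*` `[c, d]%classic.

Lemma sub_obox_cbox a b c d : obox a b c d `<=` cbox a b c d.
Proof. by move=> [x y] [] /= /subset_itv_oo_cc ? /subset_itv_oo_cc ?. Qed.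

Lemma measurable_obox a b c d : measurable (obox a b c d).
Proof. by apply: measurableX; exact: measurable_itv. Qed.

Lemma measurable_cbox a b c d : measurable (cbox a b c d).
Proof. by apply: measurableX; exact: measurable_itv. Qed.

Lemma cbox_finite a b c d : (mu2 (cbox a b c d) < +oo)%E.
Proof.
rewrite product_measure1E; [|exact: measurable_itv|exact: measurable_itv].
by rewrite /= !lebesgue_measure_itv /=; do 2 case: ifP => _;
  rewrite ?mule0 ?mul0e ?ltry.
Qed.

Lemma obox_finite a b c d : (mu2 (obox a b c d) < +oo)%E.
Proof.
apply: le_lt_trans (cbox_finite a b c d); apply: le_measure.
- by rewrite inE; exact: measurable_obox.
- by rewrite inE; exact: measurable_cbox.
- exact: sub_obox_cbox.
Qed.

(** The boxes with rational centre and radius [k.+1%:R^-1] are countably many, and those whose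
    closure lies in [U] cover it. The closed boxes stay inside [U] so that bumps supported on them
    are test functions. *)
Lemma open_bigcup_obox (U : set plane) : open U ->
  exists a b c d : nat -> R,
    (forall n, cbox (a n) (b n) (c n) (d n) `<=` U) /\
    U = \bigcup_n obox (a n) (b n) (c n) (d n).
Proof.
move=> oU.
pose r (k : nat) : R := k.+1%:R^-1.
pose B (z : rat * rat * nat) := cbox (ratr z.1.1 - r z.2) (ratr z.1.1 + r z.2)
  (ratr z.1.2 - r z.2) (ratr z.1.2 + r z.2).
pose E n := if unpickle n is Some z then
  if `[< B z `<=` U >] then Some (z : rat * rat * nat) else None else None.
(* Codes that name no box inside [U] receive the empty box, with lower bounds 1 and upper bounds
   0. *)
exists (fun n => if E n is Some z then ratr z.1.1 - r z.2 else 1),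
  (fun n => if E n is Some z then ratr z.1.1 + r z.2 else 0),
  (fun n => if E n is Some z then ratr z.1.2 - r z.2 else 1),
  (fun n => if E n is Some z then ratr z.1.2 + r z.2 else 0).
have sub n : cbox
  (if E n is Some z then ratr z.1.1 - r z.2 else 1)
  (if E n is Some z then ratr z.1.1 + r z.2 else 0)
  (if E n is Some z then ratr z.1.2 - r z.2 else 1)
  (if E n is Some z then ratr z.1.2 + r z.2 else 0) `<=` U.
  rewrite /E; case: unpickle => [z|]; last first.
    by move=> [x y] [/=]; rewrite in_itv /= => /andP[]; lra.
  case: asboolP => // _.
  by move=> [x y] [/=]; rewrite in_itv /= => /andP[]; lra.
split=> //; apply/seteqP; split; last first.
  by move=> x [n _ /sub_obox_cbox]; exact: sub.
move=> [x y] Uxy.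
have /nbhs_ballP[e /= e0 eU] : nbhs (x, y) U by exact: open_nbhs_nbhs.
(* A box of radius [r k] whose centre is within [r k] of [(x, y)] stays within [2 * r k < e] of that
   point. *)
have [k ke] : exists k, r k < e / 2.
  have e20 : 0 < e / 2 by rewrite divr_gt0.
  by have [k _ /(_ k (leqnn k))] := near_infty_natSinv_lt (PosNum e20); exists k.
have rk0 : 0 < r k by rewrite invr_gt0.
have rx : x - r k < x + r k by lra.
have ry : y - r k < y + r k by lra.
have [p] := rat_in_itvoo rx; rewrite in_itv /= => /andP[p1 p2].
have [q] := rat_in_itvoo ry; rewrite in_itv /= => /andP[q1 q2].
exists (pickle (p, q, k)) => //; rewrite /E pickleK.
case: asboolP => [_|nsub]; last first.
  exfalso; apply: nsub => -[u v] [] /=; rewrite !in_itv /= => /andP[u1 u2] /andP[v1 v2].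
  apply: eU; split; rewrite /ball /= ltr_norml; apply/andP; split; lra.
by split => /=; rewrite in_itv /=; apply/andP; split; lra.
Qed.

Lemma open_measurable_plane (U : set plane) : open U -> measurable U.
Proof.
move=> /open_bigcup_obox[a [b [c [d [_ ->]]]]].
by apply: bigcupT_measurable => n; exact: measurable_obox.
Qed.

Lemma continuous_measurable_plane (f : plane -> R) : continuous f ->
  measurable_fun setT f.
Proof.
move=> /continuousP cf; apply: (measurability _ (RGenOpens.measurableE R)).
move=> _ [_ [a [b ->] <-]]; rewrite setTI; apply: open_measurable_plane.
exact/cf/interval_open.
Qed.

Lemma obox_sub_bounded (A : set plane) : bounded_set A ->
  exists M : R, 0 < M /\ A `<=` cbox (- M) M (- M) M.
Proof.
move=> [M [_ AM]]; exists (`|M| + 1).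
have M0 := normr_ge0 M; split; first by lra.
have MM : M < `|M| + 1 by rewrite (le_lt_trans (ler_norm M)) // ltrDl.
move=> [x y] /(AM _ MM) h; have : Num.max `|x| `|y| <= `|M| + 1 by exact: h.
by rewrite ge_max !ler_norml => /andP[xM yM]; split; rewrite /= in_itv.
Qed.

Lemma bounded_obox_integrable a b c d (f : plane -> R) (M : R) :
  measurable_fun setT f -> (forall z, `|f z| <= M) ->
  mu2.-integrable (obox a b c d) (EFin \o f).
Proof.
move=> mf fM; apply: measurable_bounded_integrable.
- exact: measurable_obox.
- exact: obox_finite.
- exact: measurable_funS mf.
exists M; split; first exact: num_real.
by move=> y My z _; exact: le_trans (fM z) (ltW My).
Qed.

Lemma Rintegral_obox_tensor a b c d (f g : R -> R) (M N : R) :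
  measurable_fun setT f -> measurable_fun setT g ->
  (forall x, `|f x| <= M) -> (forall x, `|g x| <= N) ->
  \int[mu2]_(z in obox a b c d) (f z.1 * g z.2) =
  \int[mu1]_(x in `]a, b[) f x * \int[mu1]_(y in `]c, d[) g y.
Proof.
move=> mf mg fM gN.
have mfg : measurable_fun setT (fun z : plane => f z.1 * g z.2).
  by apply: measurable_funM; apply: measurableT_comp.
have M0 : 0 <= M by apply: le_trans (fM 0).
have N0 : 0 <= N by apply: le_trans (gN 0).
have fgM z : `|f z.1 * g z.2| <= M * N by rewrite normrM ler_pM.
have ifg := bounded_obox_integrable a b c d mfg fgM.
have ig : mu1.-integrable `]c, d[ (EFin \o g).
  apply: measurable_bounded_integrable => //.
  - by rewrite /= lebesgue_measure_itv; case: ifP => _; rewrite ?ltry.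
  - exact: measurable_funS mg.
  exists N; split; first exact: num_real.
  by move=> y Ny z _; exact: le_trans (gN z) (ltW Ny).
have if_ : mu1.-integrable `]a, b[ (EFin \o f).
  apply: measurable_bounded_integrable => //.
  - by rewrite /= lebesgue_measure_itv; case: ifP => _; rewrite ?ltry.
  - exact: measurable_funS mf.
  exists M; split; first exact: num_real.
  by move=> y My z _; exact: le_trans (fM z) (ltW My).
rewrite /Rintegral integral_mkcond -integral12_prod_meas1; last first.
  by rewrite -integrable_mkcond; [exact: ifg|exact: measurable_obox].
set h := (X in (\int[mu1]_x X x)%E).
have -> : h = (fun x => (f x * \int[mu1]_(y in `]c, d[) g y)%:E) \_ `]a, b[.
  apply/funext => x; rewrite /h /fubini_F /= patchE.
  have [xI|xI] := ifPn.
    transitivity (\int[mu1]_y (((fun y => (f x * g y)%:E) \_ `]c, d[) y))%E.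
      congr (integral _ _ _); apply/funext => y.
      by rewrite !patchE /obox in_setX xI; case: ifP.
    rewrite -integral_mkcond.
    transitivity (\int[mu1]_(y in `]c, d[) ((f x)%:E * (EFin \o g) y))%E => //.
    rewrite integralZl // /Rintegral EFinM fineK //.
    exact: integrable_fin_num.
  rewrite integral0_eq // => y _; rewrite patchE /obox.
  by rewrite (_ : _ \in _ = false) // in_setX (negbTE xI).
rewrite -integral_mkcond -[RHS]RintegralZr //.
Qed.

End plane_measure.

(** * Smooth functions of one variable *)

Lemma is_derive_ext (R : numFieldType) (V W : normedModType R) (f g : V -> W)
    (x v : V) (d d' : W) : is_derive x v f d -> f =1 g -> d = d' ->
  is_derive x v g d'.
Proof. by move=> fd /funext <- <-. Qed.

Section calculus1.
Context {R : realType}.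
Implicit Types (f g : R -> R) (x : R).

(* [is_derive1_comp] with the inner function first, which lets unification find it. *)
Lemma is_derive1_compose f g x df dg : is_derive x 1 f df ->
  is_derive (f x) 1 g dg -> is_derive x 1 (g \o f) (dg * df).
Proof. by move=> df_ dg_; exact: (@is_derive1_comp R g f x dg df dg_ df_). Qed.

Lemma is_derive1_inv x : x != 0 -> is_derive x 1 (fun t : R => t^-1) (- x ^- 2).
Proof.
move=> x0; have dx := @derivable_id R R x 1.
have := @deriveV R R id x 1 x0 dx.
rewrite derive_id => e; apply: DeriveDef; first exact: derivableV.
by rewrite e /GRing.scale /= mulr1.
Qed.

(** The whole tower of derivatives is given at once, so that closed forms (phase shifts for the
    circular functions, the family [flat]) serve directly as witnesses. *)
Definition smooth1 f := exists F : nat -> R -> R,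
  F 0%N = f /\ forall n x, is_derive x 1 (F n) (F n.+1 x).

Lemma smooth1_affine f a b : smooth1 f -> smooth1 (fun x => f (a * x + b)).
Proof.
move=> [F [<- dF]]; exists (fun n x => a ^+ n * F n (a * x + b)).
split=> [|n x]; first by apply/funext => x; rewrite expr0 mul1r.
have h : is_derive x 1 (fun x : R => a * x + b) a.
  have := is_deriveD (is_deriveZ a (is_derive_id x 1)) (is_derive_cst b x 1).
  by rewrite addr0 /GRing.scale /= mulr1.
apply: (is_derive_ext (is_deriveZ (a ^+ n) (is_derive1_compose h (dF n (a * x + b))))) => //.
by rewrite /GRing.scale /= exprS; ring.
Qed.

Lemma smooth1_cos : smooth1 (@cos R).
Proof.
exists (fun n x => cos (x + n%:R * (pi / 2))); split.
  by apply/funext => x; rewrite mul0r addr0.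
move=> n x.
have h : is_derive x 1 (fun x : R => x + n%:R * (pi / 2)) 1.
  have := is_deriveD (is_derive_id x 1) (is_derive_cst (n%:R * (pi / 2)) x 1).
  by rewrite addr0.
apply: (is_derive_ext (is_derive1_compose h (is_derive_cos _))) => //.
rewrite mulr1 (_ : x + n.+1%:R * (pi / 2) = x + n%:R * (pi / 2) + pi / 2); last first.
  by rewrite -[n.+1%:R]natr1; ring.
by rewrite cosD cos_pihalf sin_pihalf mulr0 mulr1 sub0r.
Qed.

Lemma smooth1_sin : smooth1 (@sin R).
Proof.
exists (fun n x => sin (x + n%:R * (pi / 2))); split.
  by apply/funext => x; rewrite mul0r addr0.
move=> n x.
have h : is_derive x 1 (fun x : R => x + n%:R * (pi / 2)) 1.
  have := is_deriveD (is_derive_id x 1) (is_derive_cst (n%:R * (pi / 2)) x 1).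
  by rewrite addr0.
apply: (is_derive_ext (is_derive1_compose h (is_derive_sin _))) => //.
rewrite mulr1 (_ : x + n.+1%:R * (pi / 2) = x + n%:R * (pi / 2) + pi / 2); last first.
  by rewrite -[n.+1%:R]natr1; ring.
by rewrite sinD cos_pihalf sin_pihalf mulr0 mulr1 add0r.
Qed.

(** For [p = 1], the classical function flat at 0; the factor polynomial in [x^-1] makes the family
    closed under differentiation. *)
Definition flat (p : {poly R}) x : R :=
  if 0 < x then p.[x^-1] * expR (- x^-1) else 0.

(** With [y = x^-1 >= 1], the polynomial is at most a constant times [y ^+ size p], and the term of
    order [(size p).+2] of the exponential series bounds [expR y] from below; the two spare powers
    leave [x ^+ 2]. *)
Lemma flat_le_sqr p : exists2 C : R, 0 <= C &
  forall x, 0 < x -> x <= 1 -> `|flat p x| <= C * x ^+ 2.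
Proof.
exists ((\sum_(i < size p) `|p`_i|) * (size p).+2`!%:R).
  by rewrite mulr_ge0 // sumr_ge0.
move=> x x0 x1; rewrite /flat x0 normrM.
have y1 : 1 <= x^-1 by rewrite invr_ge1 // unitf_gt0.
set y := x^-1; have y0 : 0 < y by rewrite invr_gt0.
have -> : x = y^-1 by rewrite invrK.
have hp : `|p.[y]| <= (\sum_(i < size p) `|p`_i|) * y ^+ size p.
  rewrite horner_coef mulr_suml (le_trans (ler_norm_sum _ _ _)) // ler_sum // => i _.
  rewrite normrM ler_wpM2l // ger0_norm ?exprn_ge0 ?(ltW y0) //.
  by rewrite ler_weXn2l // ltnW.
have he : `|expR (- y)| <= (size p).+2`!%:R * y^-1 ^+ (size p).+2.
  rewrite ger0_norm ?expR_ge0 // expRN -[leRHS]invrK lef_pV2 ?posrE ?expR_gt0 //; last first.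
    by rewrite invr_gt0 mulr_gt0 ?ltr0n ?fact_gt0 // exprn_gt0 // invr_gt0.
  rewrite invfM exprVn invrK mulrC.
  by have := expR_ge1Dxn (size p).+1 (ltW y0); apply: le_trans; rewrite lerDr.
apply: le_trans (ler_pM _ _ hp he) _ => //.
rewrite -!mulrA ler_wpM2l ?sumr_ge0 // mulrCA ler_wpM2l //.
by rewrite -addn2 exprD mulrA -exprMn divff ?gt_eqF // expr1n mul1r.
Qed.

Lemma flat_derive p x : is_derive x 1 (flat p) (flat ('X^2 * (p - p^`())) x).
Proof.
have [x0|x0|->] := ltrgt0P x.
- have h : is_derive x 1 (fun t : R => p.[t^-1] * expR (- t^-1))
      (('X^2 * (p - p^`())).[x^-1] * expR (- x^-1)).
    have di := is_derive1_inv (lt0r_neq0 x0).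
    have dp : is_derive x^-1 1 (horner p) (p^`().[x^-1]).
      by apply: DeriveDef; [exact: derivable_horner|rewrite -derive1E -derivE].
    apply: (is_derive_ext (is_deriveM (is_derive1_compose di dp)
      (is_derive1_compose (is_deriveN di) (is_derive_expR _)))) => //.
    rewrite /GRing.scale /= opprK hornerM hornerXn hornerD hornerN.
    by rewrite exprVn; ring.
  rewrite /flat x0; apply: near_eq_is_derive h.
  by near=> t; rewrite ifT //; near: t; exact: lt_nbhsr.
- rewrite {2}/flat ltNge (ltW x0) /=.
  apply: near_eq_is_derive (is_derive_cst 0 x 1).
  near=> t; rewrite /flat ltNge ifF //; apply/negbF; apply: ltW.
  by near: t; exact: lt_nbhsl.
rewrite {2}/flat ltxx.
have [C C0 hC] := flat_le_sqr p.
have : (fun h : R => h^-1 *: ((flat p \o shift 0) (h *: 1) - flat p 0)) @ 0^' --> (0 : R).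
  apply/cvgr0Pnorm_le => e e0; near=> h.
  rewrite /flat ltxx subr0 /= addr0 [h%:A]mulr1 /GRing.scale /=.
  have [h0|h0] := ltP 0 h; last by rewrite mulr0 normr0 ltW.
  have h1 : h <= 1 by apply: le_trans (ler_norm h) _; near: h; exact: dnbhs0_le.
  (* [C] may be 0, hence the denominator [C + 1]. *)
  have he : h <= e / (C + 1).
    apply: le_trans (ler_norm h) _; near: h; apply: dnbhs0_le.
    by rewrite divr_gt0 // ltr_wpDl.
  have := hC _ h0 h1; rewrite {1}/flat h0 => hh.
  rewrite normrM ger0_norm ?invr_ge0 ?(ltW h0) // ler_pdivrMl //.
  apply: le_trans hh _; rewrite expr2 mulrA mulrC ler_pM2l //.
  move: he; rewrite ler_pdivlMr ?ltr_wpDl //.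
  by apply: le_trans; rewrite mulrC ler_pM2l // lerDl.
move=> h; apply: DeriveDef; first by apply/cvg_ex; exists 0.
exact: (cvg_lim _ h).
Unshelve. all: by end_near. Qed.

Lemma smooth1_flat p : smooth1 (flat p).
Proof.
exists (fun n => flat (iter n (fun q => 'X^2 * (q - q^`())) p)); split=> // n x.
exact: flat_derive.
Qed.

Lemma smooth1_derivable f : smooth1 f -> forall x, derivable f x 1.
Proof. by move=> [F [<- dF]] x; case: (dF 0%N x). Qed.

Lemma smooth1_derive f : smooth1 f -> smooth1 (f^`()%classic).
Proof.
move=> [F [<- dF]]; exists (fun n => F n.+1); split=> // .
by apply/funext => x; rewrite derive1E; case: (dF 0%N x).
Qed.

Lemma derivable1_continuous f x : derivable f x 1 -> {for x, continuous f}.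
Proof. by move=> /derivable1_diffP; exact: differentiable_continuous. Qed.

Lemma smooth1_continuous f : smooth1 f -> continuous f.
Proof. by move=> sf x; apply/derivable1_continuous/smooth1_derivable. Qed.

End calculus1.

(** * Partial derivatives of smooth functions *)

Section calculus2.
Context {R : realType}.
Local Notation plane := (R * R)%type.
Local Notation mu1 := (@lebesgue_measure R).
Local Notation mu2 := ((@lebesgue_measure R) \x (@lebesgue_measure R))%E.
Implicit Types (f g : plane -> R) (F : R -> R) (z : plane) (i j : 'I_2).

(** Reduces directional derivatives to one-variable calculus along the line through [x]. *)
Lemma is_derive_line (V W : normedModType R) (f : V -> W) (x v : V) (d : W) :
  is_derive x v f d <-> is_derive (0 : R) 1 (fun t => f (t *: v + x)) d.
Proof.
have E : (fun h : R => h^-1 *: ((f \o shift x) (h *: v) - f x)) =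
  (fun h : R => h^-1 *: (((fun t => f (t *: v + x)) \o shift 0) (h *: 1)
                       - f ((0 : R) *: v + x))).
  by apply/funext => h /=; rewrite addr0 [h%:A]mulr1 scale0r add0r.
by split=> -[d1 d2]; split; rewrite /derivable /derive ?E // -?E.
Qed.

Lemma coord_dir i j (t : R) z :
  coord j (t *: dir R i + z) = (if i == j then t else 0) + coord j z.
Proof.
rewrite /coord /dir /=; case: i j => -[|[|//]] ? [[|[|//]] ?] /=;
  by rewrite /GRing.scale /= ?mulr1 ?mulr0.
Qed.

Lemma line0 (x y : R) : x *: dir R 0 + (0, y) = (x, y).
Proof.
rewrite /dir /=; congr (_, _); last by rewrite /= scaler0 add0r.
by rewrite /= addr0 [_ *: _]mulr1.
Qed.

Lemma line1 (x y : R) : y *: dir R 1 + (x, 0) = (x, y).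
Proof.
rewrite /dir /=; congr (_, _); first by rewrite /= scaler0 add0r.
by rewrite /= addr0 [_ *: _]mulr1.
Qed.

Lemma is_derive_coord F i j z d : is_derive (coord j z) 1 F d ->
  is_derive z (dir R i) (fun z => F (coord j z)) (if i == j then d else 0).
Proof.
move=> dF; apply/is_derive_line; case: ifP => ij; last first.
  by apply: (is_derive_ext (is_derive_cst (F (coord j z)) _ _)) => // t;
    rewrite coord_dir ij add0r.
move/is_derive_line: dF => dF; apply: (is_derive_ext dF) => // t.
by rewrite coord_dir ij [t%:A]mulr1.
Qed.

Lemma continuous_coord j : continuous (@coord R j).
Proof.
by rewrite /coord; case: (j == 0) => z; [exact: cvg_fst|exact: cvg_snd].
Qed.

Lemma continuous_comp_coord F j : continuous F ->
  continuous (fun z => F (coord j z)).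
Proof.
by move=> cF z; apply: (continuous_comp (@continuous_coord j z)); exact: cF.
Qed.

Lemma Ck_continuous k f : Ck k f -> continuous f.
Proof. by case: k => [|k] //= []. Qed.

Lemma CkS k f : Ck k.+1 f -> Ck k f.
Proof.
elim: k f => [|k IHk] f [cf df] //.
by split=> // i; have [di ci] := df i; split=> //; exact: IHk.
Qed.

Lemma Ck_derivable k f i z : Ck k.+1 f -> derivable f z (dir R i).
Proof. by move=> [_ /(_ i)[]]. Qed.

Lemma Ck_derive k f i : Ck k.+1 f -> Ck k ('D_(dir R i) f).
Proof. by move=> [_ /(_ i)[]]. Qed.

Lemma CkD k f g : Ck k f -> Ck k g -> Ck k (fun z => f z + g z).
Proof.
elim: k f g => [|k IHk] f g.
  by move=> cf cg z; apply: continuousD; [exact: cf|exact: cg].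
move=> cf cg; split=> [z|i].
  by apply: continuousD; [exact: (Ck_continuous cf)|exact: (Ck_continuous cg)].
split=> [z|]; first by apply: derivableD; apply: Ck_derivable; eassumption.
rewrite (_ : 'D__ _ = fun z => 'D_(dir R i) f z + 'D_(dir R i) g z).
  by apply: IHk; exact: Ck_derive.
by apply/funext => z; apply: deriveD; apply: Ck_derivable; eassumption.
Qed.

Lemma derive_mul f g i z : derivable f z (dir R i) -> derivable g z (dir R i) ->
  'D_(dir R i) (fun z => f z * g z) z =
  f z * 'D_(dir R i) g z + 'D_(dir R i) f z * g z.
Proof. by move=> df dg; rewrite [LHS](deriveM df dg) [in RHS](mulrC _ (g z)). Qed.

Lemma CkM k f g : Ck k f -> Ck k g -> Ck k (fun z => f z * g z).
Proof.
elim: k f g => [|k IHk] f g.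
  by move=> cf cg z; apply: continuousM; [exact: cf|exact: cg].
move=> cf cg; split=> [z|i].
  by apply: continuousM; [exact: (Ck_continuous cf)|exact: (Ck_continuous cg)].
split=> [z|]; first by apply: derivableM; apply: Ck_derivable; eassumption.
rewrite (_ : 'D__ _ = fun z => f z * 'D_(dir R i) g z + 'D_(dir R i) f z * g z).
  by apply: CkD; apply: IHk => //; by [exact: Ck_derive|exact: CkS].
by apply/funext => z; apply: derive_mul; apply: Ck_derivable; eassumption.
Qed.

Lemma smooth1_cst (a : R) : smooth1 (fun=> a).
Proof.
exists (fun n _ => if n is 0%N then a else 0); split=> // n x.
by case: n => [|n]; exact: is_derive_cst.
Qed.

Lemma Ck_coord k F j : smooth1 F -> Ck k (fun z => F (coord j z)).
Proof.
elim: k F => [|k IHk] F sF.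
  by apply: continuous_comp_coord; exact: smooth1_continuous.
split; first by apply: continuous_comp_coord; exact: smooth1_continuous.
move=> i.
have h z := is_derive_coord i (derivableP (@smooth1_derivable _ _ sF (coord j z))).
split=> [z|]; first by have [] := h z.
have [ij|ij] := boolP (i == j); last first.
  rewrite (_ : 'D__ _ = fun z => (fun=> 0) (coord j z)).
    exact: (IHk (fun=> 0) (smooth1_cst 0)).
  by apply/funext => z; have [_ ->] := h z; rewrite (negbTE ij).
rewrite (_ : 'D__ _ = fun z => (F^`()%classic) (coord j z)).
  by apply: IHk; exact: smooth1_derive.
by apply/funext => z; have [_ ->] := h z; rewrite ij derive1E.
Qed.

Lemma smooth_coord F j : smooth1 F -> smooth (fun z => F (coord j z)).
Proof. by move=> sF k; exact: Ck_coord. Qed.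

Lemma smoothM f g : smooth f -> smooth g -> smooth (fun z => f z * g z).
Proof. by move=> sf sg k; exact: CkM. Qed.

Lemma derive_eq0_open f i z (U : set plane) : open U -> U z ->
  (forall w, U w -> f w = 0) -> 'D_(dir R i) f z = 0.
Proof.
move=> oU Uz fU; rewrite (@near_eq_derive _ _ _ f (cst 0)) ?derive_cst //.
have : nbhs z U by exact: open_nbhs_nbhs.
by apply: filterS => w /fU.
Qed.

Lemma closed_cbox (a b c d : R) : closed (cbox a b c d).
Proof.
apply: compact_closed; first exact: norm_hausdorff.
by apply: compact_setX; exact: segment_compact.
Qed.

Lemma continuous_bounded_cbox f (a b c d : R) : continuous f ->
  exists M, forall z, cbox a b c d z -> `|f z| <= M.
Proof.
move=> cf; have : compact (f @` cbox a b c d).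
  apply: continuous_compact; first exact: continuous_subspaceT.
  by apply: compact_setX; exact: segment_compact.
move=> /compact_bounded[M [_ hM]]; exists (M + 1) => z Dz.
by apply: (hM (M + 1)); [rewrite ltrDl|exists z].
Qed.

Lemma Rintegral_derive1_eq0 F (f' : R -> R) (M : R) : 0 < M ->
  (forall x : R, is_derive x 1 F (f' x)) -> continuous f' ->
  (forall x, ~ `[- M, M]%classic x -> F x = 0 /\ f' x = 0) ->
  (\int[mu1]_x (f' x)%:E = 0)%E.
Proof.
move=> M0 dF cf' F0.
(* [F] is known to vanish only outside the closed interval, so the fundamental theorem is applied on
   a larger one, with endpoints where [F] is 0. *)
pose N := M + 1; have MN : - N < N by rewrite /N; lra.
pose I : set R := `[- N, N]%classic.
have sI (x : R) : `[- M, M]%classic x -> I x.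
  rewrite /I /= !in_itv /= => /andP[h1 h2]; rewrite /N.
  by apply/andP; split; lra.
have -> : (\int[mu1]_x (f' x)%:E = \int[mu1]_(x in I) (f' x)%:E)%E.
  rewrite [RHS]integral_mkcond; apply: eq_integral => x _; rewrite patchE.
  by case: ifPn => // /negP xN; rewrite (F0 x _).2 // => /sI xM; apply/xN/mem_set.
have FN x : `|x| = N -> F x = 0.
  move=> xN; apply: (F0 x _).1; rewrite /= in_itv /= -ler_norml xN /N; lra.
have cF x : {for x, continuous F} by apply: derivable1_continuous; case: (dF x).
rewrite (continuous_FTC2 (F := F) MN).
- by rewrite !FN ?sube0 // ?normrN ger0_norm // /N; lra.
- exact: continuous_subspaceT.
- split.
  + by move=> x _; case: (dF x).
  + by apply: cvg_at_right_filter; exact: cF.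
  + by apply: cvg_at_left_filter; exact: cF.
by move=> x _; rewrite derive1E; case: (dF x).
Qed.

(** Fubini, with the inner integral taken along [dir i]: on every such line it is the integral of
    the derivative of a compactly supported function. *)
Lemma Rintegral_derive_eq0 f i (M : R) : 0 < M ->
  (forall z, derivable f z (dir R i)) -> continuous ('D_(dir R i) f) ->
  (forall z, ~ cbox (- M) M (- M) M z -> f z = 0) ->
  \int[mu2]_z 'D_(dir R i) f z = 0.
Proof.
move=> M0 df cDf f0.
have Df0 z : ~ cbox (- M) M (- M) M z -> 'D_(dir R i) f z = 0.
  move=> zM; apply: (@derive_eq0_open _ _ _ (~` cbox (- M) M (- M) M)) => //.
  by apply: closed_openC; exact: closed_cbox.
have mDf := continuous_measurable_plane cDf.
have [C hC] := @continuous_bounded_cbox _ (- M) M (- M) M cDf.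
have iDf : mu2.-integrable setT (EFin \o 'D_(dir R i) f).
  rewrite (_ : EFin \o _ = (EFin \o 'D_(dir R i) f) \_ (cbox (- M) M (- M) M)).
    rewrite -integrable_mkcond; last exact: measurable_cbox.
    apply: measurable_bounded_integrable.
    - exact: measurable_cbox.
    - exact: cbox_finite.
    - exact: measurable_funS mDf.
    exists C; split; first exact: num_real.
    by move=> y Cy z Dz; exact: le_trans (hC _ Dz) (ltW Cy).
  apply/funext => z; rewrite patchE; case: ifPn => // /negP zM /=.
  by rewrite Df0 // => zM'; apply: zM; exact/mem_set.
have dline z (t : R) : is_derive t 1 (fun t => f (t *: dir R i + z))
    ('D_(dir R i) f (t *: dir R i + z)).
  apply/is_derive_line.
  have /derivableP/is_derive_line h := df (t *: dir R i + z).
  apply: (is_derive_ext h) => // s.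
  by congr f; rewrite addrA -scalerDl [s%:A]mulr1.
have cline z : continuous (fun t : R => 'D_(dir R i) f (t *: dir R i + z)).
  move=> t; apply: (@continuous_comp _ _ _ (fun t : R => t *: dir R i + z)
    ('D_(dir R i) f)); last exact: cDf.
  apply: cvgD; last exact: cvg_cst.
  by apply: cvgZr_tmp; exact: cvg_id.
have key z : coord i z = 0 -> (\int[mu1]_x ('D_(dir R i) f (x *: dir R i + z))%:E = 0)%E.
  move=> zi; apply: (Rintegral_derive1_eq0 (F := fun t => f (t *: dir R i + z)) M0) => //.
  move=> t tM; have nM : ~ cbox (- M) M (- M) M (t *: dir R i + z).
    move=> zM; apply: tM; have := coord_dir i i t z.
    rewrite eqxx zi addr0 => <-; rewrite /coord.
    by case: zM; case: ifP.
  by rewrite f0 // Df0.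
have I2 : i = 0 \/ i = 1.
  by case: (i) => -[|[|//]] ?; [left|right]; apply/val_inj.
rewrite /Rintegral; case: I2 => iE.
  have k0 (y : R) : (\int[mu1]_x ('D_(dir R i) f (x, y))%:E = 0)%E.
    have z0 : coord i (0, y) = 0 by rewrite iE.
    rewrite -[RHS](key _ z0); congr integral; apply/funext => x.
    by rewrite iE line0.
  rewrite -integral21_prod_meas1; last exact: iDf.
  by rewrite integral0_eq // => y _; exact: k0.
have k1 (x : R) : (\int[mu1]_y ('D_(dir R i) f (x, y))%:E = 0)%E.
  have z0 : coord i (x, 0) = 0 by rewrite iE.
  rewrite -[RHS](key _ z0); congr integral; apply/funext => y.
  by rewrite iE line1.
rewrite -integral12_prod_meas1; last exact: iDf.
by rewrite integral0_eq // => x _; exact: k1.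
Qed.

End calculus2.

(** * Bump functions *)

Section weak_derivatives.
Context {R : realType}.
Local Notation plane := (R * R)%type.
Local Notation mu1 := (@lebesgue_measure R).
Local Notation mu2 := ((@lebesgue_measure R) \x (@lebesgue_measure R))%E.
Implicit Types (f g h u v phi : plane -> R) (z : plane) (i j : 'I_2).

(** A smooth function, positive exactly on []a, b[]; since [flat 1] tends to 1 at infinity, the
    growing factor [n.+1] makes it tend to the indicator of that interval. *)
Definition bump1 (a b : R) (n : nat) (x : R) : R :=
  flat 1 (n.+1%:R * x + - (n.+1%:R * a)) * flat 1 ((- n.+1%:R) * x + n.+1%:R * b).

Lemma flat1_bounds (x : R) : 0 <= flat 1 x <= 1.
Proof.
rewrite /flat; case: ifP => x0; last by rewrite lexx ler01.
rewrite hornerE mul1r expR_ge0 /= -[leRHS]expR0 ler_expR oppr_le0 invr_ge0.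
exact: ltW.
Qed.

Lemma flat1_cvg (x : R) : 0 < x -> flat 1 (n.+1%:R * x) @[n --> \oo] --> (1 : R).
Proof.
move=> x0.
have h : (- x^-1 * n.+1%:R^-1) @[n --> \oo] --> (- x^-1 * 0 : R).
  by apply: cvgM; [exact: cvg_cst|exact: cvg_harmonic].
have := continuous_cvg _ (@continuous_expR R _) h; rewrite mulr0 expR0.
move=> /(_ _); apply: cvg_trans; apply: near_eq_cvg; apply: nearW => n /=.
by rewrite /flat pmulr_rgt0 ?ltr0n // x0 hornerE mul1r invfM mulNr mulrC.
Qed.

Lemma bump1_bounds a b n x : 0 <= bump1 a b n x <= 1.
Proof.
rewrite /bump1; have /andP[? ?] := flat1_bounds (n.+1%:R * x + - (n.+1%:R * a)).
have /andP[? ?] := flat1_bounds (- n.+1%:R * x + n.+1%:R * b).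
by rewrite mulr_ge0 //= mulr_ile1.
Qed.

Lemma bump1_eq0 a b n x : ~~ (a < x < b) -> bump1 a b n x = 0.
Proof.
move=> h; rewrite /bump1 /flat -mulrBr mulNr [- _ + _]addrC -mulrBr.
rewrite !pmulr_rgt0 ?ltr0n // !subr_gt0.
by move: h; rewrite negb_and => /orP[] /negbTE ->; rewrite ?mul0r ?mulr0.
Qed.

Lemma bump1_cvg a b x : a < x < b -> bump1 a b n x @[n --> \oo] --> (1 : R).
Proof.
move=> /andP[ax xb]; rewrite -[1]mulr1; apply: cvgM.
  under eq_fun do rewrite -mulrBr.
  by apply: flat1_cvg; rewrite subr_gt0.
under eq_fun do rewrite mulNr [- _ + _]addrC -mulrBr.
by apply: flat1_cvg; rewrite subr_gt0.
Qed.

Definition bump2 (a b c d : R) n z : R := bump1 a b n z.1 * bump1 c d n z.2.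

Lemma smooth_bump2 a b c d n : smooth (bump2 a b c d n).
Proof.
have s1 (x y : R) j : smooth (fun z : plane => bump1 x y n (coord j z)).
  by apply: smoothM; apply: (smooth_coord (F := fun t => flat 1 (_ * t + _)));
    apply: smooth1_affine; exact: smooth1_flat.
by have := smoothM (s1 a b 0) (s1 c d 1).
Qed.

Lemma bump2_bounds a b c d n z : 0 <= bump2 a b c d n z <= 1.
Proof.
have /andP[? ?] := bump1_bounds a b n z.1.
by have /andP[? ?] := bump1_bounds c d n z.2; rewrite /bump2 mulr_ge0 //= mulr_ile1.
Qed.

Lemma bump2_eq0 a b c d n z : ~ obox a b c d z -> bump2 a b c d n z = 0.
Proof.
move=> h; rewrite /bump2; have [h1|h1] := boolP (a < z.1 < b); last first.
  by rewrite bump1_eq0 ?mul0r.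
have [h2|h2] := boolP (c < z.2 < d); last by rewrite (bump1_eq0 _ h2) mulr0.
by exfalso; apply: h; split; rewrite /= in_itv.
Qed.

Lemma bump2_cvg a b c d z : obox a b c d z ->
  bump2 a b c d n z @[n --> \oo] --> (1 : R).
Proof.
move=> [] /=; rewrite !in_itv /= => h1 h2.
by rewrite -[1]mulr1; apply: cvgM; exact: bump1_cvg.
Qed.

Lemma test_function_bump2 (Omega : set plane) a b c d n :
  cbox a b c d `<=` Omega -> test_function Omega (bump2 a b c d n).
Proof.
move=> sub.
have sc : closure [set z | bump2 a b c d n z != 0] `<=` cbox a b c d.
  apply: (subset_trans (@closureS _ _ (cbox a b c d) _)) => [z /=|].
    by apply: contraNP => nz; rewrite bump2_eq0 // => /sub_obox_cbox.
  by rewrite -(closure_id (cbox a b c d)).1 //; exact: closed_cbox.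
split; first exact: smooth_bump2.
  apply: (subclosed_compact (@closed_closure _ _) _ sc).
  by apply: compact_setX; exact: segment_compact.
exact: subset_trans sc sub.
Qed.

Lemma continuous_L2 (A : set plane) f : measurable A -> bounded_set A ->
  continuous f -> L2 mu2 A f.
Proof.
move=> mA /obox_sub_bounded[M [M0 AM]] cf.
have [C hC] := @continuous_bounded_cbox _ _ (- M) M (- M) M cf.
apply: (@L2_bounded _ _ R mu2 A mA f C).
- by apply: le_lt_trans (cbox_finite (- M) M (- M) M); apply: le_measure;
    rewrite ?inE //; exact: measurable_cbox.
- by apply: measurable_funS (continuous_measurable_plane cf).
- by move=> z /AM; exact: hC.
Qed.

(** * Functions orthogonal to all bumps in a rectangle *)

Section obox_zero.
Variables (a b c d : R) (g : plane -> R).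
Hypothesis Lg : L2 mu2 (obox a b c d) g.
Hypothesis g_bump : forall a' c' n, a <= a' -> c <= c' ->
  ip mu2 (obox a b c d) g (bump2 a' b c' d n) = 0.

(** The orthogonal complement of [g] contains the bumps, hence its closure contains the indicators
    of their boxes. A quadrant meets the rectangle in a box with the same upper right corner, which
    is why only the lower left corner varies in [g_bump]. By density [g] lies in the closure of its
    own complement. *)
Lemma obox_ae_zero : {ae mu2, forall z, obox a b c d z -> g z = 0}.
Proof.
have mB := measurable_obox a b c d; have fB := obox_finite a b c d.
pose S : set (plane -> R) :=
  [set h | L2 mu2 (obox a b c d) h /\ ip mu2 (obox a b c d) g h = 0].
have SL h : S h -> L2 mu2 (obox a b c d) h by case.
have S0 : S (fun=> 0) by split; [exact: L2_0|exact: ip0r].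
have Slin (k : R) f h : S f -> S h -> S (fun x => k * f x + h x).
  move=> [Lf f0] [Lh h0]; split; first exact: L2_lin.
  by rewrite ip_linr // f0 h0 mulr0 addr0.
have L1 : L2 mu2 (obox a b c d) (fun=> 1) by exact: L2_cst.
have Sb a' c' n : a <= a' -> c <= c' -> S (bump2 a' b c' d n).
  move=> aa cc; split; last exact: g_bump.
  apply: (@L2_bounded _ _ R mu2 _ mB (bump2 a' b c' d n) 1) => //.
    apply: measurable_funS (continuous_measurable_plane _) => //.
    exact: (Ck_continuous (@smooth_bump2 _ _ _ _ _ 0%N)).
  by move=> z _; have /andP[? ?] := bump2_bounds a' b c' d n z; rewrite ger0_norm.
have bc a' c' h : a <= a' -> c <= c' -> L2 mu2 (obox a b c d) h ->
    (forall z, obox a b c d z -> h z = (z \in obox a' b c' d)%:R) ->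
    L2_closure mu2 (obox a b c d) S h.
  move=> aa cc Lh hE.
  apply: (@L2_closure_dominated _ _ R mu2 _ mB S SL (bump2 a' b c' d) _ (fun=> 1)) => //.
  - by move=> n; apply: sub_L2_closure => //; exact: Sb.
  - move=> z Bz; rewrite hE //; have [/set_mem|nz] := boolP (z \in obox a' b c' d).
      exact: bump2_cvg.
    rewrite (_ : bump2 _ _ _ _ ^~ z = fun=> 0); first exact: cvg_cst.
    apply/funext => n; apply: bump2_eq0; by move: nz; rewrite notin_setE.
  - by move=> n z _; have /andP[? ?] := bump2_bounds a' b c' d n z; rewrite ger0_norm.
have cT : L2_closure mu2 (obox a b c d) S (fun=> 1).
  by apply: (bc a c) => // z Bz; rewrite mem_set.
have cG A : quadrants A -> L2_closure mu2 (obox a b c d) S (\1_A : plane -> R).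
  move=> [x [y ->]]; apply: (bc (Num.max a x) (Num.max c y)).
  - by rewrite le_max lexx.
  - by rewrite le_max lexx.
  - by apply: L2_indic => //; apply: measurableX; exact: measurable_itv.
  move=> [u v] [] /=; rewrite !in_itv /= => /andP[au ub] /andP[cv vd].
  rewrite indicE; congr (nat_of_bool _)%:R.
  apply/idP/idP => /set_mem[] /=; rewrite !in_itv /= ?andbT ?gt_max => h1 h2;
    apply/mem_set; split; rewrite /= in_itv /= ?andbT ?gt_max.
  - by rewrite au ub h1.
  - by rewrite cv vd h2.
  - by case/andP: h1 => /andP[].
  - by case/andP: h2 => /andP[].
have [_ cl] := @L2_closureT _ _ R mu2 _ mB fB S SL S0 Slin quadrants
  measurable_plane quadrants_setI cT cG g Lg.
apply: ip_eq0 => //; apply/eqP; rewrite eq_le ip_ge0 andbT.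
apply/ler_addgt0Pr => e e0; rewrite add0r.
(* As [h] is orthogonal to [g], the squared distance is the sum of the squared norms, hence at least
   that of [g]. *)
have [h [Lh gh]] := cl _ e0; move/ltW; apply: le_trans.
rewrite ipBl // ?ipBr //; try exact: L2B.
rewrite gh (ipC _ _ h g) gh !subr0 sub0r opprK.
by rewrite lerDl ip_ge0.
Qed.
End obox_zero.

End weak_derivatives.

(** * Weak derivatives *)

(* Unification only finds these filters for another, merely convertible,
   measurable structure on the product. *)
#[local] Instance ae_plane_filter (R : realType) :
  Filter (almost_everywhere (@lebesgue_measure R \x @lebesgue_measure R)%E) :=
  ae_filter_ringOfSetsType (@lebesgue_measure R \x @lebesgue_measure R)%E.
#[local] Instance nbhs_ae_plane_filter (R : realType) :
  Filter (nbhs (almost_everywhere (@lebesgue_measure R \x @lebesgue_measure R)%E)) :=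
  ae_filter_ringOfSetsType (@lebesgue_measure R \x @lebesgue_measure R)%E.

#[local] Instance ae_line_filter (R : realType) :
  Filter (almost_everywhere (@lebesgue_measure R)) :=
  ae_filter_ringOfSetsType (@lebesgue_measure R).
#[local] Instance nbhs_ae_line_filter (R : realType) :
  Filter (nbhs (almost_everywhere (@lebesgue_measure R))) :=
  ae_filter_ringOfSetsType (@lebesgue_measure R).

Section H1_spaces.
Context {R : realType}.
Local Notation plane := (R * R)%type.
Local Notation mu1 := (@lebesgue_measure R).
Local Notation mu2 := ((@lebesgue_measure R) \x (@lebesgue_measure R))%E.
Implicit Types (f g h u v phi psi : plane -> R) (z : plane) (i j : 'I_2).

Lemma smooth_cst (a : R) : smooth (fun _ : plane => a).
Proof. exact: (smooth_coord 0 (smooth1_cst a)). Qed.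

Lemma smoothD phi psi : smooth phi -> smooth psi ->
  smooth (fun z => phi z + psi z).
Proof. by move=> sf sg k; exact: CkD. Qed.

Lemma smooth_lin a phi psi : smooth phi -> smooth psi ->
  smooth (fun z => a * phi z + psi z).
Proof. by move=> sf sg; apply: smoothD => //; apply: smoothM => //; exact: smooth_cst. Qed.

Lemma smooth_continuous phi : smooth phi -> continuous phi.
Proof. by move=> /(_ 0%N). Qed.

Lemma smooth_derive i phi : smooth phi -> smooth ('D_(dir R i) phi).
Proof. by move=> sf k; apply: Ck_derive; exact: sf. Qed.

Lemma smooth_derivable i phi z : smooth phi -> derivable phi z (dir R i).
Proof. by move=> sf; apply: (@Ck_derivable _ 0%N); exact: sf. Qed.

Lemma derive_lin i a phi psi z : smooth phi -> smooth psi ->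
  'D_(dir R i) (fun z => a * phi z + psi z) z =
  a * 'D_(dir R i) phi z + 'D_(dir R i) psi z.
Proof.
move=> sf sg.
have df := derivableP (@smooth_derivable i phi z sf).
have dg := derivableP (@smooth_derivable i psi z sg).
by have [_ h] := is_deriveD (is_deriveZ a df) dg; exact: h.
Qed.

Variable Omega : set plane.
Hypothesis oO : open Omega.
Hypothesis bO : bounded_set Omega.

Let mO : measurable Omega := open_measurable_plane oO.

Lemma Omega_finite : (mu2 Omega < +oo)%E.
Proof.
have [M [_ OM]] := obox_sub_bounded bO.
by apply: le_lt_trans (cbox_finite (- M) M (- M) M); apply: le_measure;
  rewrite ?inE //; exact: measurable_cbox.
Qed.

Lemma smooth_L2 phi : smooth phi -> L2 mu2 Omega phi.
Proof. by move=> sf; apply: continuous_L2 => //; exact: smooth_continuous. Qed.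

Lemma test_function_L2 phi : test_function Omega phi -> L2 mu2 Omega phi.
Proof. by case=> sf _ _; exact: smooth_L2. Qed.

Lemma test_function_eq0 phi z : test_function Omega phi -> ~ Omega z -> phi z = 0.
Proof.
move=> [_ _ sO] nz; apply/eqP; apply: contra_notT nz => pz.
by apply: sO; exact: subset_closure.
Qed.

(** [Omega] is a countable union of open boxes whose closures it contains. On each of them the bumps
    are test functions and [obox_ae_zero] applies; countably many null sets are null. *)
Lemma weak_zero_ae g : L2 mu2 Omega g ->
  (forall phi, test_function Omega phi -> ip mu2 Omega g phi = 0) ->
  {ae mu2, forall z, Omega z -> g z = 0}.
Proof.
move=> Lg g0; have [a [b [c [d [cO OE]]]]] := open_bigcup_obox oO.
have boxO n : obox (a n) (b n) (c n) (d n) `<=` Omega.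
  by move=> z /sub_obox_cbox; exact: cO.
have ae n : {ae mu2, forall z, obox (a n) (b n) (c n) (d n) z -> g z = 0}.
  apply: obox_ae_zero.
    case: Lg => mg ig; split; first exact: measurable_funS mg.
    apply: le_lt_trans ig; apply: ge0_subset_integral => //.
    - exact: measurable_obox.
    - by apply/measurable_EFinP/measurable_funX.
    - by move=> z _; rewrite lee_fin sqr_ge0.
  move=> a' c' k aa cc.
  have sub : obox a' (b n) c' (d n) `<=` obox (a n) (b n) (c n) (d n).
    move=> [x y] [] /=; rewrite !in_itv /= => /andP[x1 x2] /andP[y1 y2].
    by split; rewrite /= in_itv /= ?x2 ?y2 andbT; [exact: le_lt_trans x1|exact: le_lt_trans y1].
  have subc : cbox a' (b n) c' (d n) `<=` Omega.
    apply: subset_trans (cO n) => -[x y] [] /=; rewrite !in_itv /= => /andP[x1 x2] /andP[y1 y2].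
    by split; rewrite /= in_itv /= ?x2 ?y2 andbT; [exact: le_trans x1|exact: le_trans y1].
  rewrite -[RHS](g0 _ (test_function_bump2 k subc)) /ip.
  rewrite Rintegral_mkcond [RHS]Rintegral_mkcond.
  apply: eq_Rintegral => z _; rewrite !patchE.
  have [zB|zB] := boolP (z \in obox (a n) (b n) (c n) (d n)).
    by rewrite ifT //; apply/mem_set/(boxO n)/set_mem.
  rewrite bump2_eq0 ?mulr0 ?if_same // => /sub zB'.
  by move/negP: zB; apply; exact/mem_set.
have : {ae mu2, forall z, forall n, obox (a n) (b n) (c n) (d n) z -> g z = 0}.
  by apply: ae_foralln.
by apply: filterS => z hz; rewrite OE => -[n _]; exact: hz.
Qed.

(** [weak_partial] is an arbitrary representative, so every identity about it passes through this
    uniqueness and holds almost everywhere only. *)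
Lemma weak_partial_unique i u g h :
  is_weak_partial Omega i u g -> is_weak_partial Omega i u h ->
  {ae mu2, forall z, Omega z -> g z = h z}.
Proof.
move=> [Lg Hg] [Lh Hh].
have : {ae mu2, forall z, Omega z -> g z - h z = 0}.
  apply: weak_zero_ae => [|phi tphi]; first exact: L2B.
  rewrite ipBl //; last exact: test_function_L2.
  by rewrite /ip -[X in X - _]opprK -Hg // Hh // opprK subrr.
by apply: filterS => z gh /gh /eqP; rewrite subr_eq0 => /eqP.
Qed.

Lemma weak_partial_lin i a u v g h : L2 mu2 Omega u -> L2 mu2 Omega v ->
  is_weak_partial Omega i u g -> is_weak_partial Omega i v h ->
  is_weak_partial Omega i (fun z => a * u z + v z) (fun z => a * g z + h z).
Proof.
move=> Lu Lv [Lg Hg] [Lh Hh]; split; first exact: L2_lin.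
move=> phi tphi; have Lphi := test_function_L2 tphi.
have LD : L2 mu2 Omega ('D_(dir R i) phi).
  by apply/smooth_L2/smooth_derive; case: tphi.
rewrite -!/(ip _ _ _ _) !ip_linl //.
by rewrite [X in a * X + _](Hg _ tphi) [X in _ + X](Hh _ tphi) opprD mulrN.
Qed.

(** Integration by parts: the product with a test function has compact support in [Omega], so its
    derivative, extended by zero, integrates to 0 over the plane. *)
Lemma weak_partial_smooth i phi : smooth phi ->
  is_weak_partial Omega i phi ('D_(dir R i) phi).
Proof.
move=> sf; split; first exact/smooth_L2/smooth_derive.
move=> psi tpsi; have [sp cp pO] := tpsi.
have Lphi := smooth_L2 sf; have Lpsi := smooth_L2 sp.
have LDphi := smooth_L2 (smooth_derive i sf); have LDpsi := smooth_L2 (smooth_derive i sp).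
apply/eqP; rewrite -addr_eq0; apply/eqP.
rewrite -!/(ip _ _ _ _).
have Dpsi0 z : ~ Omega z -> 'D_(dir R i) psi z = 0.
  move=> nz; apply: (@derive_eq0_open _ _ _ _ (~` closure [set x | psi x != 0])).
  - by apply: closed_openC; exact: closed_closure.
  - by move=> /pO.
  - move=> w nw; apply/eqP; apply: contra_notT nw => pw; exact: subset_closure.
have E z : 'D_(dir R i) (fun z => phi z * psi z) z =
    phi z * 'D_(dir R i) psi z + 'D_(dir R i) phi z * psi z.
  by apply: derive_mul; exact: smooth_derivable.
have [M [M0 OM]] := obox_sub_bounded bO.
rewrite -[RHS](@Rintegral_derive_eq0 _ (fun z => phi z * psi z) i M M0).
- rewrite /ip -(@RintegralD _ _ R mu2 Omega _ _ mO
    (@L2_integrableM _ _ R mu2 Omega mO _ _ Lphi LDpsi)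
    (@L2_integrableM _ _ R mu2 Omega mO _ _ LDphi Lpsi)).
  rewrite Rintegral_mkcond; apply: eq_Rintegral => z _; rewrite patchE E.
  case: ifPn => // /negP nz.
  have nz' : ~ Omega z by move=> zO; apply: nz; exact/mem_set.
  by rewrite Dpsi0 // (test_function_eq0 tpsi) // !mulr0 addr0.
- by move=> z; apply: smooth_derivable; exact: smoothM.
- by apply: smooth_continuous; apply: smooth_derive; exact: smoothM.
- move=> z nz; rewrite (test_function_eq0 tpsi) ?mulr0 // => /OM; exact: nz.
Qed.

Lemma weak_partialP i u : H1 Omega u ->
  is_weak_partial Omega i u (weak_partial Omega i u).
Proof. by move=> [_ /(_ i) /getPex]. Qed.

Lemma weak_partial_L2 i u : H1 Omega u -> L2 mu2 Omega (weak_partial Omega i u).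
Proof. by move=> /(weak_partialP i)[]. Qed.

Lemma H1_lin a u v : H1 Omega u -> H1 Omega v ->
  H1 Omega (fun z => a * u z + v z).
Proof.
move=> Hu Hv; have [Lu _] := Hu; have [Lv _] := Hv.
split=> [|i]; first exact: L2_lin.
exists (fun z => a * weak_partial Omega i u z + weak_partial Omega i v z).
by apply: weak_partial_lin => //; exact: weak_partialP.
Qed.

Lemma H1_smooth phi : smooth phi -> H1 Omega phi.
Proof.
move=> sf; split=> [|i]; first exact: smooth_L2.
by exists ('D_(dir R i) phi); exact: weak_partial_smooth.
Qed.

Lemma weak_partial_lin_ae i a u v : H1 Omega u -> H1 Omega v ->
  {ae mu2, forall z, Omega z -> weak_partial Omega i (fun z => a * u z + v z) z =
    a * weak_partial Omega i u z + weak_partial Omega i v z}.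
Proof.
move=> Hu Hv; have [Lu _] := Hu; have [Lv _] := Hv.
apply: (@weak_partial_unique i (fun z => a * u z + v z)).
  by apply: weak_partialP; exact: H1_lin.
by apply: weak_partial_lin => //; exact: weak_partialP.
Qed.

Lemma weak_partial_smooth_ae i phi : smooth phi ->
  {ae mu2, forall z, Omega z -> weak_partial Omega i phi z = 'D_(dir R i) phi z}.
Proof.
move=> sf; apply: (@weak_partial_unique i phi).
  by apply: weak_partialP; exact: H1_smooth.
exact: weak_partial_smooth.
Qed.

End H1_spaces.

Lemma L2_sqdist_lin_cvg d (T : measurableType d) (R : realType)
    (mu : {measure set T -> \bar R}) (A : set T) (a : R)
    (f_ g_ : nat -> T -> R) (f g : T -> R) : measurable A ->
  (forall n, L2 mu A (f_ n)) -> (forall n, L2 mu A (g_ n)) ->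
  L2 mu A f -> L2 mu A g ->
  (fun n => L2_sqdist mu A (f_ n) f) @ \oo --> 0%E ->
  (fun n => L2_sqdist mu A (g_ n) g) @ \oo --> 0%E ->
  (fun n => L2_sqdist mu A (fun x => a * f_ n x + g_ n x)
                           (fun x => a * f x + g x)) @ \oo --> 0%E.
Proof.
move=> mA Lf_ Lg_ Lf Lg.
under eq_fun do rewrite L2_sqdistE //.
move=> /fine_cvgP[_] /= cf.
under eq_fun do rewrite L2_sqdistE //.
move=> /fine_cvgP[_] /= cg.
have E n : L2_sqdist mu A (fun x => a * f_ n x + g_ n x) (fun x => a * f x + g x) =
    (ip mu A (fun x => a * f_ n x + g_ n x - (a * f x + g x))
             (fun x => a * f_ n x + g_ n x - (a * f x + g x)))%:E.
  by rewrite L2_sqdistE //; exact: L2_lin.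
under eq_fun do rewrite E.
apply/fine_cvgP; split; first exact: nearW.
(* The majorant given by [ip_sqrD]. *)
pose B n := 2 * (a ^+ 2 * ip mu A (fun x => f_ n x - f x) (fun x => f_ n x - f x)) +
  2 * ip mu A (fun x => g_ n x - g x) (fun x => g_ n x - g x).
have cB : B n @[n --> \oo] --> (0 : R).
  have : B n @[n --> \oo] --> 2 * (a ^+ 2 * (0 : R)) + 2 * 0.
    apply: cvgD; apply: cvgM; try exact: cvg_cst.
      by apply: cvgM => //; exact: cvg_cst.
    by [].
  by rewrite !mulr0 addr0.
apply: (@squeeze_cvgr _ _ _ _ (fun=> 0) B); [|exact: cvg_cst|exact: cB].
apply: nearW => n /=.
rewrite ip_ge0 /=.
have L1 : L2 mu A (fun x => f_ n x - f x) by exact: L2B.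
have L2' : L2 mu A (fun x => g_ n x - g x) by exact: L2B.
rewrite (@eq_ip _ _ _ _ _ _ (fun x => a * (f_ n x - f x) + (g_ n x - g x)) _
   (fun x => a * (f_ n x - f x) + (g_ n x - g x))); last 2 first.
- by move=> x _; ring.
- by move=> x _; ring.
apply: le_trans (ip_sqrD mA (L2Z mA a L1) L2') _.
by rewrite ipZl ?ipZr //; [rewrite /B expr2 !mulrA|exact: L2Z].
Qed.

(** * Traces and periodic functions *)

Section traces.
Context {R : realType}.
Local Notation plane := (R * R)%type.
Local Notation mu1 := (@lebesgue_measure R).
Local Notation mu2 := ((@lebesgue_measure R) \x (@lebesgue_measure R))%E.
Implicit Types (f g h u v phi psi : plane -> R) (z : plane) (i j : 'I_2).

Variable Omega : set plane.
Hypothesis oO : open Omega.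
Hypothesis bO : bounded_set Omega.

Let mO : measurable Omega := open_measurable_plane oO.

Lemma continuous_on_line i (s : R) : continuous (on_line i s).
Proof.
move=> t; rewrite /on_line; case: (i == 0).
  exact: (cvg_pair (cvg_cst s) cvg_id).
exact: (cvg_pair cvg_id (cvg_cst s)).
Qed.

Lemma closed_face i s : closed (face Omega i s).
Proof.
have -> : face Omega i s = on_line i s @^-1` (frontier Omega) by [].
apply: closed_comp; first by move=> t _; exact: continuous_on_line.
rewrite /frontier setDE; apply: closedI; first exact: closed_closure.
by apply: open_closedC; exact: open_interior.
Qed.

Lemma measurable_face i s : measurable (face Omega i s).
Proof. by apply: closed_measurable; exact: closed_face. Qed.

Lemma face_bounded i s : exists M : R, face Omega i s `<=` `[- M, M]%classic.
Proof.
have [M [M0 OM]] := obox_sub_bounded bO; exists M => t [+ _] => ct.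
have : cbox (- M) M (- M) M (on_line i s t).
  rewrite (closure_id (cbox (- M) M (- M) M)).1; last exact: closed_cbox.
  exact: closureS OM _ ct.
by rewrite /on_line; case: (i == 0) => -[].
Qed.

Lemma smooth_face_L2 i s phi : smooth phi ->
  L2 mu1 (face Omega i s) (fun t => phi (on_line i s t)).
Proof.
move=> sf; have mF := measurable_face i s.
have cphi : continuous (fun t => phi (on_line i s t)).
  move=> t; apply: (@continuous_comp _ _ _ (on_line i s) phi).
    exact: continuous_on_line.
  exact: smooth_continuous.
have [M FM] := face_bounded i s.
have : compact ((fun t => phi (on_line i s t)) @` `[- M, M]%classic).
  apply: continuous_compact; first exact: continuous_subspaceT.
  exact: segment_compact.
move=> /compact_bounded[C [_ hC]].
apply: (@L2_bounded _ _ R mu1 _ mF _ (C + 1)).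
- apply: (@le_lt_trans _ _ (mu1 `[- M, M]%classic)).
    by apply: le_measure => //; rewrite inE //; exact: measurable_itv.
  by rewrite lebesgue_measure_itv /=; case: ifP => _; rewrite ?ltry.
- by apply: measurable_funS (continuous_measurable_fun cphi).
- by move=> t /FM tM; apply: (hC (C + 1)); [rewrite ltrDl|exists t].
Qed.

(** The approximating sequences combine. Their derivatives tend to the combination of the chosen
    weak derivatives, which agrees with the chosen derivative of the combination almost everywhere;
    the L^2 distance does not see the difference. *)
Lemma is_trace_lin i (s a : R) u v (g h : R -> R) : H1 Omega u -> H1 Omega v ->
  is_trace Omega i s u g -> is_trace Omega i s v h ->
  is_trace Omega i s (fun z => a * u z + v z) (fun t => a * g t + h t).
Proof.
move=> Hu Hv [Lg [phi [sphi phiu Dphi phig]]] [Lh [psi [spsi psiv Dpsi psih]]].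
have mF := measurable_face i s.
have [Lu _] := Hu; have [Lv _] := Hv.
split; first exact: L2_lin.
exists (fun n z => a * phi n z + psi n z); split.
- by move=> n; exact: smooth_lin.
- by apply: L2_sqdist_lin_cvg => // n; exact: smooth_L2.
- move=> j.
  have := @L2_sqdist_lin_cvg _ _ R mu2 Omega a _ _ _ _ mO
    (fun n => smooth_L2 oO bO (smooth_derive j (sphi n)))
    (fun n => smooth_L2 oO bO (smooth_derive j (spsi n)))
    (weak_partial_L2 j Hu) (weak_partial_L2 j Hv) (Dphi j) (Dpsi j).
  apply: cvg_trans; apply: near_eq_cvg; apply: nearW => n /=.
  have L1 := weak_partial_L2 j (H1_lin oO bO a Hu Hv).
  have L2w : L2 mu2 Omega (fun z => a * weak_partial Omega j u z + weak_partial Omega j v z).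
    exact: (@L2_lin _ _ R mu2 Omega mO a _ _ (weak_partial_L2 j Hu) (weak_partial_L2 j Hv)).
  have L3 := smooth_L2 oO bO (smooth_derive j (smooth_lin a (sphi n) (spsi n))).
  have E : 'D_(dir R j) (fun z => a * phi n z + psi n z) =
      fun z => a * 'D_(dir R j) (phi n) z + 'D_(dir R j) (psi n) z.
    by apply/funext => z; exact: derive_lin.
  rewrite -E (@L2_sqdistE _ _ R mu2 Omega mO _ _ L3 L2w).
  rewrite (@L2_sqdistE _ _ R mu2 Omega mO _ _ L3 L1); congr EFin.
  have D1 := @L2B _ _ R mu2 Omega mO _ _ L3 L1.
  have D2 := @L2B _ _ R mu2 Omega mO _ _ L3 L2w.
  have hae : {ae mu2, forall z, Omega z ->
     'D_(dir R j) (fun z => a * phi n z + psi n z) z -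
       (a * weak_partial Omega j u z + weak_partial Omega j v z) =
     'D_(dir R j) (fun z => a * phi n z + psi n z) z -
       weak_partial Omega j (fun z => a * u z + v z) z}.
    by apply: filterS (weak_partial_lin_ae oO bO j a Hu Hv) => z hz Oz; rewrite hz.
  exact: (@ae_eq_ip _ _ R mu2 Omega mO _ _ _ _ D2 D1 D2 D1 hae hae).
- apply: L2_sqdist_lin_cvg => //.
  + by move=> n; exact: smooth_face_L2.
  + by move=> n; exact: smooth_face_L2.
Qed.

Lemma L2_sqdist_refl d (T : measurableType d)
    (mu : {measure set T -> \bar R}) (A : set T) (f : T -> R) : L2_sqdist mu A f f = 0%E.
Proof.
rewrite /L2_sqdist; apply: integral0_eq => x _.
by rewrite subrr expr0n.
Qed.

Lemma is_trace_smooth i s phi : smooth phi ->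
  is_trace Omega i s phi (fun t => phi (on_line i s t)).
Proof.
move=> sphi; split; first exact: smooth_face_L2.
exists (fun=> phi); split => //.
- by under eq_fun do rewrite L2_sqdist_refl; exact: cvg_cst.
- move=> j; rewrite (_ : (fun _ => _) = fun=> 0%E); first exact: cvg_cst.
  apply/funext => n.
  have LD := smooth_L2 oO bO (smooth_derive j sphi).
  have Lw := weak_partial_L2 j (H1_smooth oO bO sphi).
  rewrite -[RHS](L2_sqdist_refl mu2 Omega ('D_(dir R j) phi)) !L2_sqdistE //.
  congr EFin; apply: ae_eq_ip => //; try exact: L2B;
  by apply: filterS (weak_partial_smooth_ae oO bO j sphi) => z hz Oz; rewrite hz.
- by under eq_fun do rewrite L2_sqdist_refl; exact: cvg_cst.
Qed.

Variables (c l : plane).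

Lemma H1per_lin a u v : H1per c l Omega u -> H1per c l Omega v ->
  H1per c l Omega (fun z => a * u z + v z).
Proof.
move=> [Hu Pu] [Hv Pv]; split=> [|i]; first exact: H1_lin.
have [g [h [tg th gh]]] := Pu i; have [g' [h' [tg' th' gh']]] := Pv i.
exists (fun t => a * g t + g' t), (fun t => a * h t + h' t); split.
- exact: is_trace_lin.
- exact: is_trace_lin.
- by apply: filterS2 gh gh' => t e e' f1 f2; rewrite e // e'.
Qed.

Definition plane_periodic phi := forall i s t,
  phi (on_line i (s + coord i l) t) = phi (on_line i s t).

(** Makes the trigonometric functions of the cell available as variations: the restriction of a
    smooth function to a face is its trace, with a constant approximating sequence. *)
Lemma H1per_smooth phi : smooth phi -> plane_periodic phi -> H1per c l Omega phi.
Proof.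
move=> sphi pphi; split=> [|i]; first exact: H1_smooth.
exists (fun t => phi (on_line i (coord i c) t)),
  (fun t => phi (on_line i (coord i c + coord i l) t)); split.
- exact: is_trace_smooth.
- exact: is_trace_smooth.
- by apply: aeW => t _ _; rewrite pphi.
Qed.

End traces.

(** * Bessel's inequality for finite orthogonal families *)

Section lspan.
Context (T : Type) (R : realType).
Variable S : set (T -> R).

Inductive lspan : set (T -> R) :=
| lspan0 : lspan (fun=> 0)
| lspan_lin a f g : S f -> lspan g -> lspan (fun x => a * f x + g x).

Lemma lspanE f g : f =1 g -> lspan f -> lspan g.
Proof. by move=> /funext ->. Qed.

Lemma lspan_gen f : S f -> lspan f.
Proof.
move=> Sf; apply: lspanE (lspan_lin 1 Sf lspan0) => x.
by rewrite mul1r addr0.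
Qed.

Lemma lspanD f g : lspan f -> lspan g -> lspan (fun x => f x + g x).
Proof.
move=> sf sg; elim: sf => [|a h k Sh _ IH].
  by apply: lspanE sg => x; rewrite add0r.
by apply: lspanE (lspan_lin a Sh IH) => x; rewrite addrA.
Qed.

Lemma lspanZ a f : lspan f -> lspan (fun x => a * f x).
Proof.
elim=> [|b h k Sh _ IH]; first by apply: lspanE lspan0 => x; rewrite mulr0.
by apply: lspanE (lspan_lin (a * b) Sh IH) => x; rewrite mulrDr mulrA.
Qed.

Lemma lspan_comb a f g : lspan f -> lspan g -> lspan (fun x => a * f x + g x).
Proof. by move=> sf sg; apply: lspanD => //; exact: lspanZ. Qed.

End lspan.

Lemma lspan_mul (T : Type) (R : realType) (S : set (T -> R)) (s : T -> R) :
  (forall f, S f -> lspan S (fun x => s x * f x)) ->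
  forall f, lspan S f -> lspan S (fun x => s x * f x).
Proof.
move=> Ss f; elim=> [|a h k Sh _ IH].
  by apply: lspanE (lspan0 S) => x; rewrite mulr0.
by apply: lspanE (lspan_comb a (Ss _ Sh) IH) => x; ring.
Qed.

Section Bessel.
Context d (T : measurableType d) (R : realType).
Variables (mu : {measure set T -> \bar R}) (D : set T).
Hypothesis mD : measurable D.
Variables (I : eqType) (E : I -> T -> R) (w : I -> R).
Hypothesis LE : forall i, L2 mu D (E i).
Hypothesis w0 : forall i, 0 <= w i.
Hypothesis E_orth : forall i j, i != j -> ip mu D (E i) (E j) = 0.
(* [E i] may vanish, in which case [w i] is arbitrary. *)
Hypothesis E_norm : forall i x, w i * ip mu D (E i) (E i) * E i x = E i x.
Variable r : seq I.
Hypothesis ur : uniq r.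

(** The orthogonal projection onto the span of the family: by [E_norm], [w i] is the inverse of the
    squared norm of [E i] whenever [E i] is not identically zero. *)
Definition proj f x := \sum_(i <- r) w i * ip mu D f (E i) * E i x.

Lemma proj_L2 f : L2 mu D (proj f).
Proof. by apply: L2_sum => // i; exact: L2Z. Qed.

Lemma ip_projr f g : L2 mu D g ->
  ip mu D g (proj f) = \sum_(i <- r) w i * ip mu D f (E i) * ip mu D g (E i).
Proof.
move=> Lg; rewrite ipC ip_suml //; last by move=> i; exact: L2Z.
by apply: eq_bigr => i _; rewrite ipZl // (ipC _ _ (E i) g).
Qed.

Lemma ip_proj_gen f j : L2 mu D f -> j \in r ->
  ip mu D (proj f) (E j) = ip mu D f (E j).
Proof.
move=> Lf jr; rewrite ipC ip_projr // (bigD1_seq j) //= big1 ?addr0; last first.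
  by move=> i ij; rewrite [ip _ _ (E j) _]E_orth ?mulr0 // eq_sym.
rewrite mulrAC -ipZr //; apply: eq_ip => // x _; exact: E_norm.
Qed.

Lemma ip_proj f : L2 mu D f ->
  ip mu D (fun x => f x - proj f x) (fun x => f x - proj f x) =
  ip mu D f f - \sum_(i <- r) w i * ip mu D f (E i) ^+ 2.
Proof.
move=> Lf; have LP := proj_L2 f.
have e1 : ip mu D f (proj f) = \sum_(i <- r) w i * ip mu D f (E i) ^+ 2.
  by rewrite ip_projr //; apply: eq_bigr => i _; rewrite -mulrA -expr2.
have e2 : ip mu D (proj f) (proj f) = ip mu D f (proj f).
  rewrite !ip_projr //; apply: eq_big_seq => i ir.
  by rewrite ip_proj_gen.
rewrite ipBl ?ipBr //; last exact: L2B.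
by rewrite (ipC _ _ (proj f) f) e2 e1 subrr subr0.
Qed.

Lemma proj_span h : lspan [set E i | i in [set` r]] h -> proj h =1 h.
Proof.
elim=> [|a f g [i /= ir <-] sg IH] x.
  by rewrite /proj big1 // => i _; rewrite ip0l // mulr0 mul0r.
have Lg : L2 mu D g.
  by have := proj_L2 g; rewrite (_ : proj g = g) //; exact/funext.
rewrite -[in RHS]IH /proj.
under eq_bigr => j _ do rewrite ip_linl // mulrDr mulrDl.
rewrite big_split /=; congr (_ + _).
rewrite (bigD1_seq i) //= big1 ?addr0 => [|j ji]; last first.
  by rewrite E_orth 1?eq_sym // !mulr0 mul0r.
by rewrite -[in RHS](E_norm i); ring.
Qed.

(** The projection fixes [h], so [f] and [f - h] have the same residual, and by Pythagoras a
    residual is no longer than the function itself. *)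
Lemma Bessel_gap f h : L2 mu D f -> lspan [set E i | i in [set` r]] h ->
  0 <= ip mu D f f - \sum_(i <- r) w i * ip mu D f (E i) ^+ 2
    <= ip mu D (fun x => f x - h x) (fun x => f x - h x).
Proof.
move=> Lf sh; rewrite -ip_proj // ip_ge0 /=.
have Ph := proj_span sh.
have Lh : L2 mu D h.
  by have := proj_L2 h; rewrite (_ : proj h = h) //; exact/funext.
have Lfh : L2 mu D (fun x => f x - h x) by exact: L2B.
have E1 x : f x - proj f x = (f x - h x) - proj (fun x => f x - h x) x.
  have -> : proj (fun x => f x - h x) x = proj f x - proj h x.
    rewrite /proj -sumrB; apply: eq_bigr => i _.
    by rewrite ipBl // mulrBr mulrBl.
  by rewrite Ph; ring.
rewrite (@eq_ip _ _ _ _ _ _ (fun x => (f x - h x) - proj (fun x => f x - h x) x) _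
   (fun x => (f x - h x) - proj (fun x => f x - h x) x)) //.
rewrite ip_proj // lerBlDr lerDl sumr_ge0 // => i _.
by rewrite mulr_ge0 // sqr_ge0.
Qed.

End Bessel.

(** * Polynomial approximation of a step *)

Section step.
Context {R : realType}.
Implicit Types (k s x : R) (n m : nat).

Lemma Bernoulli x n : -1 <= x -> 1 + n%:R * x <= (1 + x) ^+ n.
Proof.
move=> x1; elim: n => [|n IHn]; first by rewrite mul0r addr0 expr0.
rewrite exprS; apply: (@le_trans _ _ ((1 + x) * (1 + n%:R * x))); last first.
  by rewrite ler_wpM2l //; lra.
have := ler0n R n; have := sqr_ge0 x; rewrite -natr1; nra.
Qed.

(** The exponent [m] is chosen so that [m * s ^+ n], about [(s / k) ^+ n / n.+1], tends to 0 for
    [s <= k] and to infinity for [s > k]. This is the device of the elementary proof of the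
    Stone-Weierstrass theorem. *)
Definition step_exp k n : nat := Num.truncn (k ^- n / n.+1%:R).

(* Tends to the indicator of [k < s] on [0, 1]. *)
Definition step k n s : R := 1 - (1 - s ^+ n) ^+ step_exp k n.

Lemma step_bounds k n s : 0 <= s <= 1 -> 0 <= step k n s <= 1.
Proof.
move=> /andP[s0 s1]; have h : 0 <= s ^+ n <= 1 by rewrite exprn_ge0 //= exprn_ile1.
have h' : 0 <= 1 - s ^+ n <= 1 by lra.
have : 0 <= (1 - s ^+ n) ^+ step_exp k n <= 1.
  by case/andP: h' => ? ?; rewrite exprn_ge0 //= exprn_ile1.
rewrite /step; lra.
Qed.

Lemma step_exp_bounds k n : 0 < k ->
  (step_exp k n)%:R <= k ^- n / n.+1%:R < (step_exp k n).+1%:R.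
Proof. by move=> k0; apply: truncn_itv; rewrite divr_ge0 // invr_ge0 exprn_ge0 ?ltW. Qed.

(** Bernoulli's inequality bounds the step by [m * s ^+ n], with [m] the exponent [step_exp k n]. *)
Lemma step_le k n s : 0 < k -> 0 <= s -> s <= k -> s <= 1 ->
  step k n s <= n.+1%:R^-1.
Proof.
move=> k0 s0 sk s1; have /andP[h _] := step_exp_bounds n k0.
have hs : s ^+ n <= 1 by rewrite exprn_ile1.
have := @Bernoulli (- s ^+ n) (step_exp k n).
rewrite lerN2 => /(_ hs) B.
rewrite /step lerBlDr addrC -lerBlDr (le_trans _ B) // mulrN lerB //.
apply: le_trans (ler_wpM2r (exprn_ge0 n s0) h) _.
rewrite mulrAC ler_piMl ?invr_ge0 //.
by rewrite ler_pdivrMl ?exprn_gt0 // mulr1 lerXn2r ?nnegrE // ltW.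
Qed.

(** Quadratic growth, from the binomial expansion to second order. Divided by the [n.+1] of
    [step_exp], it still grows linearly, which gives the rate in [step_ge]. *)
Lemma expr1D_ge_sqr x n : 0 <= x <= 1 ->
  x ^+ 2 / 4 * n.+1%:R ^+ 2 <= (1 + x) ^+ n.
Proof.
move=> /andP[x0 x1].
have : 1 + n%:R * x + n%:R * (n%:R - 1) / 2 * x ^+ 2 <= (1 + x) ^+ n.
  elim: n => [|n IHn]; first by rewrite !mul0r !addr0 expr0.
  rewrite [in leRHS]exprS; have h : 0 <= 1 + x by lra.
  apply: le_trans _ (ler_wpM2l h IHn); rewrite -natr1.
  suff : 0 <= x * x ^+ 2 * (n%:R * (n%:R - 1)) / 2 by lra.
  apply: divr_ge0 => //; apply: mulr_ge0; first by rewrite mulr_ge0 ?sqr_ge0.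
  case: n {IHn} => [|n]; first by rewrite mul0r.
  by rewrite -natr1 addrK mulr_ge0 // addr_ge0.
apply: le_trans; rewrite -[n.+1%:R]natr1; have n0 := ler0n R n.
have h1 : x ^+ 2 <= 1 by rewrite exprn_ile1.
have h2 : x ^+ 2 <= x by rewrite expr2 ler_piMl.
have h3 : n%:R * x ^+ 2 <= n%:R * x by rewrite ler_wpM2l.
have h4 : 0 <= x ^+ 2 by rewrite sqr_ge0.
have h5 : 0 <= n%:R ^+ 2 * x ^+ 2 by rewrite mulr_ge0 // sqr_ge0.
lra.
Qed.

(** With [x = s ^+ n] and [m] the exponent, [(1 - x) ^+ m * (1 + m * x) <= (1 - x ^+ 2) ^+ m <= 1],
    so the gap is at most the inverse of [1 + m * x], which grows linearly in [n]. *)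
Lemma step_ge k s : 0 < k -> k < s -> s <= 1 ->
  exists2 C : R, 0 <= C & forall n, 1 - step k n s <= C * n.+1%:R^-1.
Proof.
move=> k0 ks s1; pose y := Num.min (s / k - 1) 1.
have y0 : 0 < y by rewrite lt_min ltr01 andbT subr_gt0 ltr_pdivlMr ?mul1r.
have y1 : y <= 1 by rewrite ge_min lexx orbT.
have ysk : 1 + y <= s / k by rewrite -lerBrDl ge_min lexx.
pose c := y ^+ 2 / 4; have c0 : 0 < c by rewrite divr_gt0 ?exprn_gt0.
exists c^-1 => [|n]; first by rewrite invr_ge0 ltW.
have s0 : 0 < s := lt_trans k0 ks.
have x0 : 0 <= s ^+ n by rewrite exprn_ge0 ?ltW.
have x1 : s ^+ n <= 1 by rewrite exprn_ile1 // ltW.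
have /andP[_ hm] := step_exp_bounds n k0.
rewrite /step subKr.
set x := s ^+ n in x0 x1 *; set m := step_exp k n in hm *.
have n0 : 0 < n.+1%:R :> R by [].
have B1 : c * n.+1%:R <= 1 + m%:R * x.
  have : (k ^- n / n.+1%:R - 1) * x <= m%:R * x.
    by rewrite ler_wpM2r // lerBlDr natr1 ltW.
  have : c * n.+1%:R <= k ^- n / n.+1%:R * x.
    rewrite [leRHS]mulrAC ler_pdivlMr // -mulrA -expr2.
    apply: le_trans (expr1D_ge_sqr n _) _; first by rewrite ltW.
    rewrite mulrC -exprVn -exprMn lerXn2r ?nnegrE //; first by lra.
    by rewrite divr_ge0 ?ltW.
  move: (k ^- n / _) (c * _) => q e; rewrite mulrBl mul1r; lra.
have B2 : (1 - x) ^+ m * (1 + m%:R * x) <= 1.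
  apply: (@le_trans _ _ ((1 - x) ^+ m * (1 + x) ^+ m)).
    by rewrite ler_wpM2l ?exprn_ge0 ?subr_ge0 // Bernoulli //; lra.
  by rewrite -exprMn exprn_ile1 //; nra.
rewrite -invfM -[_^-1]mul1r ler_pdivlMr ?mulr_gt0 //.
apply: le_trans B2; rewrite ler_wpM2l ?exprn_ge0 ?subr_ge0 //.
Qed.

Lemma step_cvg k s : 0 < k -> 0 <= s <= 1 ->
  (fun n => step k n s) @ \oo --> ((k < s)%R%:R : R).
Proof.
move=> k0 s01; have /andP[s0 s1] := s01.
have [sk|ks] := leP s k.
  apply: (@squeeze_cvgr _ _ _ _ (fun=> 0) (fun n => n.+1%:R^-1));
    [|exact: cvg_cst|exact: cvg_harmonic].
  apply: nearW => n; have /andP[-> _] := @step_bounds k n s s01.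
  exact: step_le.
have [C C0 hC] := step_ge k0 ks s1.
have cC : (1 - C * n.+1%:R^-1) @[n --> \oo] --> (1 : R).
  rewrite -[X in _ --> X]subr0 -(mulr0 C); apply: cvgB; first exact: cvg_cst.
  by apply: cvgM; [exact: cvg_cst|exact: cvg_harmonic].
apply: (@squeeze_cvgr _ _ _ _ (fun n => 1 - C * n.+1%:R^-1) (fun=> 1));
  [|exact: cC|exact: cvg_cst].
apply: nearW => n; have /andP[_ ->] := @step_bounds k n s s01.
by rewrite andbT lerBlDr addrC -lerBlDr; exact: hC.
Qed.

End step.

(** * Trigonometric polynomials *)

Section trig1.
Context {R : realType}.
Local Notation mu1 := (@lebesgue_measure R).
Variables (c l : R).
Hypothesis l0 : 0 < l.
Implicit Types (k m : nat) (b : bool) (x : R).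

Definition freq k : R := k%:R * (2 * pi / l).

(** Sine for [b = true], cosine for [b = false]. The index set is kept uniform: [trig 0 true] is the
    zero function. The argument is expanded into affine form to match [smooth1_affine]. *)
Definition trig (k : nat) (b : bool) (x : R) : R :=
  (if b then sin else cos) (freq k * x + - (freq k * c)).

Lemma trigE k b x : trig k b x = (if b then sin else cos) (freq k * (x - c)).
Proof. by rewrite /trig mulrBr. Qed.

Lemma smooth1_trig k b : smooth1 (trig k b).
Proof.
by case: b; apply: smooth1_affine; [exact: smooth1_sin|exact: smooth1_cos].
Qed.

Lemma trig_le1 k b x : `|trig k b x| <= 1.
Proof. by rewrite /trig; case: b; [exact: sin_max|exact: cos_max]. Qed.

Lemma is_derive_affine (a e x : R) : is_derive x 1 (fun t : R => a * t + e) a.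
Proof.
apply: (is_derive_ext (is_deriveD (is_deriveZ a (is_derive_id x 1)) (is_derive_cst e x 1))) => //.
by rewrite addr0 [LHS]mulr1.
Qed.

Lemma is_derive_trig k b x : is_derive x 1 (trig k b)
  ((if b then 1 else -1) * freq k * trig k (~~ b) x).
Proof.
have da := is_derive_affine (freq k) (- (freq k * c)) x.
case: b => /=.
  apply: (is_derive_ext (is_derive1_compose da (is_derive_sin _))) => //.
  by rewrite /trig mul1r mulrC.
apply: (is_derive_ext (is_derive1_compose da (is_derive_cos _))) => //.
by rewrite /trig mulN1r mulNr mulrC mulrN.
Qed.

Lemma freqM_l k : freq k * l = pi *+ 2 *+ k.
Proof.
rewrite /freq -mulrA divfK ?gt_eqF // -mulrnA -[RHS]mulr_natr natrM.
by ring.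
Qed.

Lemma trig_periodic k b x : trig k b (x + l) = trig k b x.
Proof.
rewrite !trigE addrAC mulrDr freqM_l.
by case: b; [exact: (periodicn (@sinD2pi R))|exact: (periodicn (@cosD2pi R))].
Qed.

Lemma freq0 : freq 0 = 0. Proof. by rewrite /freq mul0r. Qed.

Lemma freq_gt0 k : (0 < k)%N -> 0 < freq k.
Proof. by move=> k0; rewrite /freq mulr_gt0 ?ltr0n // divr_gt0 // mulr_gt0 // pi_gt0. Qed.

Lemma trig0 x : trig 0 false x = 1.
Proof. by rewrite trigE freq0 mul0r cos0. Qed.

Lemma trig0t x : trig 0 true x = 0.
Proof. by rewrite trigE freq0 mul0r sin0. Qed.

Lemma Rintegral_trig k b :
  \int[mu1]_(x in `]c, c + l[) trig k b x = ((k == 0%N) && ~~ b)%:R * l.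
Proof.
have cl : c < c + l by rewrite ltrDl.
have cT : continuous (trig k b) by exact: smooth1_continuous (smooth1_trig k b).
pose C : set R := `[c, c + l]%classic.
have E : \int[mu1]_(x in `]c, c + l[) trig k b x =
   fine (\int[mu1]_(x in C) (trig k b x)%:E)%E.
  rewrite /Rintegral -(@integral_itv_bndoo _ c (c + l) _ true false) //.
  by apply/measurable_EFinP; apply: measurable_funS (continuous_measurable_fun cT).
rewrite E; have [->|k0] := eqVneq k 0%N.
  case: b {cT E}.
    by rewrite integral0_eq ?mul0r // => x _; rewrite trig0t.
  under eq_integral do rewrite trig0.
  rewrite integral_cst /C; last exact: measurable_itv.
  rewrite /= lebesgue_measure_itv /= lte_fin cl /=.
  by rewrite !mul1r addrC addKr.
rewrite /= mul0r; have f0 : freq k != 0 by rewrite gt_eqF // freq_gt0 // lt0n.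
pose F x := (freq k)^-1 * (if b then -1 else 1) * trig k (~~ b) x.
have dF x : is_derive x 1 F (trig k b x).
  apply: (is_derive_ext (is_deriveZ _ (is_derive_trig k (~~ b) x))) => //.
  rewrite negbK /GRing.scale /=.
  by case: (b) => /=; field.
have cF x : {for x, continuous F} by apply: derivable1_continuous; case: (dF x).
rewrite (continuous_FTC2 (F := F) cl).
- by rewrite -EFinB /F trig_periodic subrr.
- exact: continuous_subspaceT.
- split.
  + by move=> x _; case: (dF x).
  + by apply: cvg_at_right_filter; exact: cF.
  + by apply: cvg_at_left_filter; exact: cF.
by move=> x _; rewrite derive1E; case: (dF x).
Qed.

Local Notation I := `]c, c + l[%classic.

Lemma trig_L2 k b : L2 mu1 I (trig k b).
Proof.
have mI : measurable I by exact: measurable_itv.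
apply: (@L2_bounded _ _ R mu1 I mI (trig k b) 1).
- by rewrite /= lebesgue_measure_itv /=; case: ifP => _; rewrite ?ltry.
- apply: measurable_funS (continuous_measurable_fun _) => //.
  exact: smooth1_continuous (smooth1_trig k b).
- by move=> x _; exact: trig_le1.
Qed.

(** The product-to-sum formulas, ordered so that the difference of frequencies is a natural
    number. *)
Lemma trigM k b m b' x : (m <= k)%N ->
  trig k b x * trig m b' x =
  2^-1 * trig (k + m) (b (+) b') x * (if b && b' then -1 else 1) +
  2^-1 * trig (k - m) (b (+) b') x * (if ~~ b && b' then -1 else 1).
Proof.
move=> mk; rewrite !trigE.
have -> : freq (k + m) * (x - c) = freq k * (x - c) + freq m * (x - c).
  by rewrite /freq natrD; ring.
have -> : freq (k - m) * (x - c) = freq k * (x - c) - freq m * (x - c).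
  by rewrite /freq natrB //; ring.
by case: b b' => -[] /=; rewrite ?sinB ?cosB ?sinD ?cosD; field.
Qed.

Lemma ip_trig k b m b' : (m <= k)%N ->
  ip mu1 I (trig k b) (trig m b') =
  if (k == m) && (b == b') then
    if k == 0%N then (~~ b)%:R * l else l / 2
  else 0.
Proof.
move=> mk; have mI : measurable I by exact: measurable_itv.
have muI : (mu1 I < +oo)%E.
  by rewrite /= lebesgue_measure_itv /=; case: ifP => _; rewrite ?ltry.
pose u : R := if b && b' then -1 else 1; pose v : R := if ~~ b && b' then -1 else 1.
have -> : ip mu1 I (trig k b) (trig m b') =
    ip mu1 I (fun x => (2^-1 * u) * trig (k + m) (b (+) b') x +
      (2^-1 * v) * trig (k - m) (b (+) b') x) (fun=> 1).
  by apply: eq_Rintegral => x _; rewrite trigM // mulr1 -/u -/v; ring.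
have L1 := @L2_cst _ _ R mu1 I mI 1 muI.
have La := trig_L2 (k + m) (b (+) b'); have Lb := trig_L2 (k - m) (b (+) b').
rewrite (@ip_linl _ _ R mu1 I mI _ _ _ _ La (@L2Z _ _ R mu1 I mI _ _ Lb) L1).
rewrite (@ipZl _ _ R mu1 I mI _ _ _ Lb L1).
rewrite -!ip_cst1 !Rintegral_trig /u /v.
have [->|km] := eqVneq k m.
  rewrite subnn addn_eq0 andbb eqxx /=.
  by case: b b' {u v La Lb} => -[] /=; case: (m == 0%N) => /=; field.
have km1 : (k <= m)%N = false by apply/negbTE; rewrite -ltnNge ltn_neqAle eq_sym km.
have km2 : (k == 0%N) = false by apply/negbTE; apply: contraFneq km1 => ->.
by rewrite addn_eq0 subn_eq0 km1 km2 /= !mul0r !mulr0 addr0.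
Qed.

(** The inverse squared norm of [trig k b]: the constant function has squared norm [l], the others
    [l / 2]. *)
Definition weight k : R := (if k == 0%N then 1 else 2) / l.

Lemma trig_orth k b m b' : (k, b) != (m, b') ->
  ip mu1 I (trig k b) (trig m b') = 0.
Proof.
move=> kbm; have [mk|/ltnW km] := leqP m k.
  by rewrite ip_trig // -xpair_eqE (negbTE kbm).
by rewrite ipC ip_trig // -xpair_eqE eq_sym (negbTE kbm).
Qed.

Lemma trig_norm k b x :
  weight k * ip mu1 I (trig k b) (trig k b) * trig k b x = trig k b x.
Proof.
have l_neq0 : l != 0 by rewrite gt_eqF.
rewrite ip_trig // !eqxx /= /weight.
have [->|_] := eqVneq k 0%N; last by field.
case: b; first by rewrite trig0t mulr0.
by rewrite trig0 /= !mul1r mulr1 mulVf.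
Qed.

Definition trigs : set (R -> R) := [set f | exists k b, f = trig k b].

Lemma lspan_trig k b : lspan trigs (trig k b).
Proof. by apply: lspan_gen; exists k, b. Qed.

Lemma lspan_trig_cst (a : R) : lspan trigs (fun=> a).
Proof. by apply: lspanE (lspanZ a (lspan_trig 0 false)) => x; rewrite trig0 mulr1. Qed.

Lemma lspan_trig1M b f : lspan trigs f -> lspan trigs (fun x => trig 1 b x * f x).
Proof.
move: f; apply: lspan_mul => _ [k [b' ->]].
case: k => [|k].
  case: b'; first by apply: lspanE (lspan0 _) => x; rewrite trig0t mulr0.
  by apply: lspanE (lspan_trig 1 b) => x; rewrite trig0 mulr1.
pose u : R := if b' && b then -1 else 1; pose v : R := if ~~ b' && b then -1 else 1.
apply: (@lspanE _ _ _ (fun x => (2^-1 * u) * trig (k.+1 + 1) (b' (+) b) x +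
      ((2^-1 * v) * trig (k.+1 - 1) (b' (+) b) x))).
  by move=> x; rewrite [RHS]mulrC trigM // -/u -/v; ring.
by apply: lspanD; apply: lspanZ; exact: lspan_trig.
Qed.

(* A trigonometric polynomial of degree 1, with values in [0, 1], which is
   large exactly on an arc centered at [mid]. *)
Definition hump (mid x : R) : R := (1 + cos (freq 1 * (x - mid))) / 2.

Lemma humpE (m x : R) : hump m x =
  2^-1 + (2^-1 * cos (freq 1 * (m - c))) * trig 1 false x +
  (2^-1 * sin (freq 1 * (m - c))) * trig 1 true x.
Proof.
rewrite /hump !trigE.
have -> : freq 1 * (x - m) = freq 1 * (x - c) - freq 1 * (m - c) by ring.
by rewrite cosB; field.
Qed.

Lemma lspan_humpM (m : R) f : lspan trigs f -> lspan trigs (fun x => hump m x * f x).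
Proof.
move=> sf; have h := lspanD (lspanZ 2^-1 sf) (lspanD
  (lspanZ (2^-1 * cos (freq 1 * (m - c))) (lspan_trig1M false sf))
  (lspanZ (2^-1 * sin (freq 1 * (m - c))) (lspan_trig1M true sf))).
by apply: lspanE h => x; rewrite humpE; ring.
Qed.

Lemma lspan_step (k m : R) n : lspan trigs (fun x => step k n (hump m x)).
Proof.
have sX f j : lspan trigs f -> lspan trigs (fun x => hump m x ^+ j * f x).
  move=> sf; elim: j => [|j IHj]; first by apply: lspanE sf => x; rewrite expr0 mul1r.
  by apply: lspanE (lspan_humpM m IHj) => x; rewrite exprS mulrA.
have sY j : lspan trigs (fun x => (1 - hump m x ^+ n) ^+ j).
  elim: j => [|j IHj]; first by apply: lspanE (lspan_trig_cst 1) => x; rewrite expr0.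
  apply: lspanE (lspan_comb (-1) (sX _ n IHj) IHj) => x; rewrite exprS; ring.
by apply: lspanE (lspan_comb (-1) (sY (step_exp k n)) (lspan_trig_cst 1)) => x; rewrite /step; ring.
Qed.

Lemma hump_bounds (m x : R) : 0 <= hump m x <= 1.
Proof.
have := cos_max (freq 1 * (x - m)); rewrite ler_norml /hump => /andP[? ?].
by apply/andP; split; lra.
Qed.

(** The difference of the two values is [sin (w * (t - a)) * sin (w * (c + l - t))] with
    [w = pi / l]. The second factor is positive inside the period and the first has the sign of
    [t - a]. *)
Lemma hump_lt (a t : R) : c < a < c + l -> c < t < c + l ->
  let m := (a + (c + l)) / 2 in (hump m (c + l) < hump m t) = (a < t).
Proof.
move=> /andP[ca al] /andP[ct tl] /=; set m := _ / 2.
pose w : R := pi / l.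
have w0 : 0 < w by rewrite divr_gt0 ?pi_gt0.
have wl : w * l = pi by rewrite /w divfK // gt_eqF.
have f1 : freq 1 = 2 * w by rewrite /freq /w mul1r mulrA.
have E : hump m t - hump m (c + l) = sin (w * (t - a)) * sin (w * (c + l - t)).
  have e1 : freq 1 * (t - m) = w * (t - a) - w * (c + l - t) by rewrite f1 /m; field.
  have e2 : freq 1 * (c + l - m) = w * (t - a) + w * (c + l - t) by rewrite f1 /m; field.
  by rewrite /hump e1 e2 cosB cosD; field.
have s2 : 0 < sin (w * (c + l - t)).
  apply: sin_gt0_pi; rewrite mulr_gt0 ?subr_gt0 //= -[ltRHS]wl ltr_pM2l //; lra.
rewrite -subr_gt0 E pmulr_lgt0 //.
have [at_|ta] := ltP a t.
  apply: sin_gt0_pi; rewrite mulr_gt0 ?subr_gt0 //= -[ltRHS]wl ltr_pM2l //; lra.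
apply/negbTE; rewrite -leNgt -oppr_ge0 -sinN -mulrN opprB.
apply: sin_ge0_pi; rewrite mulr_ge0 ?subr_ge0 ?(ltW w0) //= -[leRHS]wl ler_pM2l //; lra.
Qed.

(** The hump centred at the middle of []a, c + l[] takes the same value at both ends of this arc.
    Composed with [step] at that threshold, it gives trigonometric polynomials tending to the
    indicator of the ray. *)
Lemma ray_approx (a : R) : exists f_ : nat -> R -> R,
  [/\ forall n, lspan trigs (f_ n), forall n x, 0 <= f_ n x <= 1 &
      forall x, c < x < c + l -> f_ ^~ x @ \oo --> ((a < x)%R%:R : R)].
Proof.
have [ac|ca] := leP a c.
  exists (fun _ _ => 1); split=> [n|n x|x /andP[cx _]].
  - exact: lspan_trig_cst.
  - by rewrite ler01 lexx.
  - by rewrite (le_lt_trans ac cx); exact: cvg_cst.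
have [la|al] := leP (c + l) a.
  exists (fun _ _ => 0); split=> [n|n x|x /andP[_ xl]].
  - exact: lspan_trig_cst.
  - by rewrite ler01 lexx.
  - by rewrite ltNge (le_trans (ltW xl) la); exact: cvg_cst.
pose m := (a + (c + l)) / 2.
(* [step] needs a positive threshold; by the half-angle formula this one is a squared cosine of an
   angle strictly between 0 and [pi / 2]. *)
have k0 : 0 < hump m (c + l).
  have -> : hump m (c + l) = cos (freq 1 * (c + l - m) / 2) ^+ 2.
    rewrite /hump.
    have {1}-> : freq 1 * (c + l - m) = freq 1 * (c + l - m) / 2 + freq 1 * (c + l - m) / 2.
      by field.
    rewrite cosD; have := cos2Dsin2 (freq 1 * (c + l - m) / 2).
    move: (cos _) (sin _) => p q; rewrite !expr2; lra.
  rewrite exprn_gt0 // cos_gt0_pihalf //.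
  have -> : freq 1 * (c + l - m) / 2 = pi / 2 * ((c + l - a) / l).
    by rewrite /freq /m; field; rewrite gt_eqF.
  have p0 : 0 < pi / 2 :> R by rewrite divr_gt0 ?pi_gt0.
  have h0 : 0 < (c + l - a) / l by rewrite divr_gt0 //; lra.
  have h1 : (c + l - a) / l < 1 by rewrite ltr_pdivrMr // mul1r; lra.
  apply/andP; split.
    by apply: (@lt_trans _ _ 0); [rewrite oppr_lt0|exact: mulr_gt0].
  by rewrite gtr_pMr.
exists (fun n x => step (hump m (c + l)) n (hump m x)); split=> [n|n x|x xI].
- exact: lspan_step.
- by apply: step_bounds; exact: hump_bounds.
- rewrite -(@hump_lt a x) ?ca ?al //; apply: step_cvg => //; exact: hump_bounds.
Qed.

End trig1.

(** * Fourier series on the cell and the null Lagrangian *)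

Section trig2.
Context {R : realType}.
Local Notation plane := (R * R)%type.
Local Notation mu1 := (@lebesgue_measure R).
Local Notation mu2 := ((@lebesgue_measure R) \x (@lebesgue_measure R))%E.
Variables (c l : plane).
Hypothesis l1 : 0 < l.1.
Hypothesis l2 : 0 < l.2.

Let I : eqType := ((nat * nat) * (bool * bool))%type.
Implicit Types (i j : I) (z : plane).

Definition cell : set plane := obox c.1 (c.1 + l.1) c.2 (c.2 + l.2).

Definition trig2 i z : R :=
  trig c.1 l.1 i.1.1 i.2.1 z.1 * trig c.2 l.2 i.1.2 i.2.2 z.2.

Definition weight2 i : R := weight l.1 i.1.1 * weight l.2 i.1.2.

Lemma smooth_trig2 i : smooth (trig2 i).
Proof.
by apply: smoothM; [exact: (smooth_coord 0 (smooth1_trig _ _ _ _))|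
  exact: (smooth_coord 1 (smooth1_trig _ _ _ _))].
Qed.

Lemma measurable_cell : measurable cell.
Proof. exact: measurable_obox. Qed.
Hint Resolve measurable_cell : core.

Lemma cell_finite : (mu2 cell < +oo)%E.
Proof. exact: obox_finite. Qed.

Lemma trig2_le1 i z : `|trig2 i z| <= 1.
Proof. by rewrite normrM mulr_ile1 // trig_le1. Qed.

Lemma trig2_L2 i : L2 mu2 cell (trig2 i).
Proof.
apply: (@L2_bounded _ _ R mu2 cell measurable_cell (trig2 i) 1).
- exact: cell_finite.
- by apply: measurable_funS (continuous_measurable_plane _) => //;
    exact: (smooth_continuous (smooth_trig2 i)).
- by move=> z _; exact: trig2_le1.
Qed.

Lemma ip_trig2 i j : ip mu2 cell (trig2 i) (trig2 j) =
  ip mu1 `]c.1, c.1 + l.1[%classic (trig c.1 l.1 i.1.1 i.2.1) (trig c.1 l.1 j.1.1 j.2.1) *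
  ip mu1 `]c.2, c.2 + l.2[%classic (trig c.2 l.2 i.1.2 i.2.2) (trig c.2 l.2 j.1.2 j.2.2).
Proof.
have mt (c' l' : R) k b : measurable_fun setT (trig c' l' k b).
  by apply: continuous_measurable_fun; exact: smooth1_continuous (smooth1_trig _ _ _ _).
have bt (c' l' : R) k b k' b' x : `|trig c' l' k b x * trig c' l' k' b' x| <= 1.
  by rewrite normrM mulr_ile1 // trig_le1.
rewrite /ip -(@Rintegral_obox_tensor _ _ _ _ _ _ _ 1 1) //; last 2 first.
- by apply: measurable_funM.
- by apply: measurable_funM.
by apply: eq_Rintegral => z _; rewrite /trig2 mulrACA.
Qed.

Lemma trig2_orth i j : i != j -> ip mu2 cell (trig2 i) (trig2 j) = 0.
Proof.
move=> ij; rewrite ip_trig2.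
have [h1|h1] := eqVneq (i.1.1, i.2.1) (j.1.1, j.2.1); last by rewrite trig_orth ?mul0r.
have [h2|h2] := eqVneq (i.1.2, i.2.2) (j.1.2, j.2.2).
  suff ij' : i = j by rewrite ij' eqxx in ij.
  move: h1 h2; case: (i) => [[? ?] [? ?]]; case: (j) => [[? ?] [? ?]] /=.
  by move=> [-> ->] [-> ->].
by rewrite [X in _ * X]trig_orth ?mulr0.
Qed.

Lemma trig2_norm i z :
  weight2 i * ip mu2 cell (trig2 i) (trig2 i) * trig2 i z = trig2 i z.
Proof.
rewrite ip_trig2 /trig2 /weight2.
rewrite -[X in _ = X * _](@trig_norm _ c.1 l.1 l1) -[X in _ = _ * X](@trig_norm _ c.2 l.2 l2).
by ring.
Qed.

Lemma weight2_ge0 i : 0 <= weight2 i.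
Proof.
by rewrite /weight2 /weight mulr_ge0 // divr_ge0 ?(ltW l1) ?(ltW l2) //; case: ifP.
Qed.

Definition trig2s : set (plane -> R) := [set f | exists i, f = trig2 i].

Lemma lspan_tensor (f g : R -> R) : lspan (trigs c.1 l.1) f -> lspan (trigs c.2 l.2) g ->
  lspan trig2s (fun z => f z.1 * g z.2).
Proof.
move=> sf sg; elim: sf => [|a h k [k1 [b1 ->]] _ IH].
  by apply: lspanE (lspan0 _) => z; rewrite mul0r.
apply: (@lspanE _ _ _ (fun z => a * (trig c.1 l.1 k1 b1 z.1 * g z.2) + k z.1 * g z.2)).
  by move=> z; ring.
apply: lspan_comb => //; elim: sg => [|b h' k' [k2 [b2 ->]] _ IH'].
  by apply: lspanE (lspan0 _) => z; rewrite mulr0.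
apply: lspanE (lspan_comb b (lspan_gen (_ : trig2s (trig2 ((k1, k2), (b1, b2))))) IH').
  by move=> z; rewrite /trig2 /=; ring.
by exists ((k1, k2), (b1, b2)).
Qed.

Lemma lspan_trig2_L2 f : lspan trig2s f -> L2 mu2 cell f.
Proof.
elim=> [|a h k [i ->] _ Lk]; first exact: L2_0.
by apply: L2_lin => //; exact: trig2_L2.
Qed.

Lemma lspan_trig2_cst (a : R) : lspan trig2s (fun=> a).
Proof.
by apply: lspanE (lspan_tensor (lspan_trig_cst _ _ a) (lspan_trig_cst _ _ 1)) => z; rewrite mulr1.
Qed.

(** It suffices to reach indicators of quadrants, which are bounded pointwise limits of tensor
    products of the one-variable approximations of rays. *)
Lemma trig2_dense f : L2 mu2 cell f -> L2_closure mu2 cell (lspan trig2s) f.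
Proof.
have mC := measurable_cell; have fC := cell_finite.
have slin := @lspan_comb _ _ trig2s.
apply: (@L2_closureT _ _ R mu2 cell mC fC _ lspan_trig2_L2 (lspan0 _) slin quadrants
  measurable_plane quadrants_setI).
  exact: (@sub_L2_closure _ _ R mu2 cell mC _ lspan_trig2_L2 _ (lspan_trig2_cst 1)).
move=> _ [x [y ->]].
have [f1 [s1 b1 c1]] := ray_approx c.1 l1 x; have [f2 [s2 b2 c2]] := ray_approx c.2 l2 y.
have L1 : L2 mu2 cell (fun=> 1) by exact: L2_cst.
apply: (@L2_closure_dominated _ _ R mu2 cell mC _ lspan_trig2_L2
  (fun n z => f1 n z.1 * f2 n z.2) _ (fun=> 1)) => //.
- move=> n; exact: (@sub_L2_closure _ _ R mu2 cell mC _ lspan_trig2_L2 _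
    (lspan_tensor (s1 n) (s2 n))).
- by apply: L2_indic => //; apply: measurableX; exact: measurable_itv.
- move=> z [] /=; rewrite !in_itv /= => z1 z2.
  have -> : \1_(`]x, +oo[ `*` `]y, +oo[) z = (x < z.1)%R%:R * (y < z.2)%R%:R :> R.
    rewrite indicE in_setX /= -natrM mulnb; congr (nat_of_bool (_ && _))%:R;
      by apply/idP/idP => [/set_mem|h]; [|apply/mem_set]; rewrite /= in_itv /= andbT.
  by apply: cvgM; [exact: c1|exact: c2].
- move=> n z _; have /andP[p1 q1] := b1 n z.1; have /andP[p2 q2] := b2 n z.2.
  by rewrite ger0_norm ?mulr_ge0 // mulr_ile1.
Qed.

Definition freqs (N : nat) : seq (nat * nat) :=
  [seq (k1, k2) | k1 <- iota 0 N, k2 <- iota 0 N].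

Definition phases : seq (bool * bool) :=
  [:: (false, false); (false, true); (true, false); (true, true)].

Definition modes N : seq I := [seq (k, b) | k <- freqs N, b <- phases].

Lemma mem_modes N i : (i.1.1 < N)%N -> (i.1.2 < N)%N -> i \in modes N.
Proof.
move=> k1 k2; apply/allpairsP; exists (i.1, i.2); split=> /=.
- by apply/allpairsP; exists i.1; rewrite !mem_iota !add0n k1 k2; split=> //; case: (i.1).
- by case: (i.2) => -[] [].
- by case: (i).
Qed.

Lemma uniq_modes N : uniq (modes N).
Proof.
apply: allpairs_uniq => //; last by move=> [? ?] [? ?].
by apply: allpairs_uniq; rewrite ?iota_uniq // => -[? ?] [? ?].
Qed.

Lemma lspan_modes f : lspan trig2s f -> exists N0, forall N, (N0 <= N)%N ->
  lspan [set trig2 i | i in [set` modes N]] f.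
Proof.
elim=> [|a h k [i ->] _ [N0 IH]]; first by exists 0%N => N _; exact: lspan0.
exists (maxn N0 (maxn i.1.1 i.1.2).+1) => N; rewrite geq_max gtn_max.
move=> /and3P[N0N i1 i2]; apply: lspan_lin; last exact: IH.
by exists i => //=; exact: mem_modes.
Qed.

(** Parseval's formula in a form that lets several functions share one truncation [N]: density gives
    an approximant in the span of the modes, and [Bessel_gap] compares with it. *)
Lemma trig2_Parseval f (e : R) : L2 mu2 cell f -> 0 < e -> exists N0, forall N, (N0 <= N)%N ->
  `|ip mu2 cell f f - \sum_(i <- modes N) weight2 i * ip mu2 cell f (trig2 i) ^+ 2| < e.
Proof.
move=> Lf e0; have [_ /(_ e e0)[h sh he]] := trig2_dense Lf.
have [N0 hN] := lspan_modes sh; exists N0 => N /hN sN.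
have /andP[g0 gh] := @Bessel_gap _ _ R mu2 cell measurable_cell I
  trig2 weight2 trig2_L2 weight2_ge0 trig2_orth
  trig2_norm _ (uniq_modes N) _ _ Lf sN.
by rewrite ger0_norm // (le_lt_trans gh).
Qed.

Lemma trig2_derive1 i z : 'D_(dir R 0) (trig2 i) z =
  (if i.2.1 then 1 else -1) * freq l.1 i.1.1 * trig2 (i.1, (~~ i.2.1, i.2.2)) z.
Proof.
have d1 := is_derive_coord (j := 0) (z := z) 0 (is_derive_trig c.1 l.1 i.1.1 i.2.1 z.1).
have d2 := is_derive_coord (j := 1) (z := z) 0 (is_derive_trig c.2 l.2 i.1.2 i.2.2 z.2).
rewrite [LHS](@derive_mul _ _ _ _ _ (@ex_derive _ _ _ _ _ _ _ d1) (@ex_derive _ _ _ _ _ _ _ d2)).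
rewrite [X in _ * X + _](@derive_val _ _ _ _ _ _ _ d2).
rewrite [X in _ + X * _](@derive_val _ _ _ _ _ _ _ d1).
by rewrite /= mulr0 add0r /trig2 /= !mulrA.
Qed.

Lemma trig2_derive2 i z : 'D_(dir R 1) (trig2 i) z =
  (if i.2.2 then 1 else -1) * freq l.2 i.1.2 * trig2 (i.1, (i.2.1, ~~ i.2.2)) z.
Proof.
have d1 := is_derive_coord (j := 0) (z := z) 1 (is_derive_trig c.1 l.1 i.1.1 i.2.1 z.1).
have d2 := is_derive_coord (j := 1) (z := z) 1 (is_derive_trig c.2 l.2 i.1.2 i.2.2 z.2).
rewrite [LHS](@derive_mul _ _ _ _ _ (@ex_derive _ _ _ _ _ _ _ d1) (@ex_derive _ _ _ _ _ _ _ d2)).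
rewrite [X in _ * X + _](@derive_val _ _ _ _ _ _ _ d2).
rewrite [X in _ + X * _](@derive_val _ _ _ _ _ _ _ d1).
by rewrite /= mul0r addr0 /trig2 /=; ring.
Qed.

Lemma trig2_periodic i : plane_periodic l (trig2 i).
Proof.
move=> j s t; rewrite /on_line /coord /trig2.
by case: (j == 0) => /=; rewrite trig_periodic.
Qed.

(** * The determinant of periodic divergence-free symmetric fields *)

Section null_Lagrangian.
Variables (q p r : plane -> R).
Hypothesis Lq : L2 mu2 cell q.
Hypothesis Lp : L2 mu2 cell p.
Hypothesis Lr : L2 mu2 cell r.
(* The rows [(q, p)] and [(p, r)] are periodic and divergence-free. *)
Hypothesis div1 : forall i,
  ip mu2 cell q ('D_(dir R 0) (trig2 i)) + ip mu2 cell p ('D_(dir R 1) (trig2 i)) = 0.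
Hypothesis div2 : forall i,
  ip mu2 cell p ('D_(dir R 0) (trig2 i)) + ip mu2 cell r ('D_(dir R 1) (trig2 i)) = 0.

Let cf f (k : nat * nat) (b1 b2 : bool) := ip mu2 cell f (trig2 (k, (b1, b2))).
Let sg (b : bool) : R := if b then 1 else -1.

Lemma ip_derive1 f i : L2 mu2 cell f -> ip mu2 cell f ('D_(dir R 0) (trig2 i)) =
  sg i.2.1 * freq l.1 i.1.1 * cf f i.1 (~~ i.2.1) i.2.2.
Proof.
move=> Lf; rewrite -(@ipZr _ _ R mu2 cell measurable_cell _ _ _ (trig2_L2 _) Lf).
by apply: eq_ip => // z _; exact: trig2_derive1.
Qed.

Lemma ip_derive2 f i : L2 mu2 cell f -> ip mu2 cell f ('D_(dir R 1) (trig2 i)) =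
  sg i.2.2 * freq l.2 i.1.2 * cf f i.1 i.2.1 (~~ i.2.2).
Proof.
move=> Lf; rewrite -(@ipZr _ _ R mu2 cell measurable_cell _ _ _ (trig2_L2 _) Lf).
by apply: eq_ip => // z _; exact: trig2_derive2.
Qed.

(* The complex Fourier coefficients of a divergence-free field are multiples
   of [n *m n^T], with [n] orthogonal to the frequency, hence have determinant 0. *)
Lemma det_coef_eq0 k : k != (0%N, 0%N) ->
  \sum_(b <- phases) (cf q k b.1 b.2 * cf r k b.1 b.2 - cf p k b.1 b.2 ^+ 2) = 0.
Proof.
case: k => k1 k2 k0.
have e1 b1 b2 : sg b1 * freq l.1 k1 * cf q (k1, k2) (~~ b1) b2 +
    sg b2 * freq l.2 k2 * cf p (k1, k2) b1 (~~ b2) = 0.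
  by rewrite -(div1 ((k1, k2), (b1, b2))) ip_derive1 // ip_derive2.
have e2 b1 b2 : sg b1 * freq l.1 k1 * cf p (k1, k2) (~~ b1) b2 +
    sg b2 * freq l.2 k2 * cf r (k1, k2) b1 (~~ b2) = 0.
  by rewrite -(div2 ((k1, k2), (b1, b2))) ip_derive1 // ip_derive2.
rewrite /phases !big_cons big_nil /=.
move: e1 e2; move: (cf q _) (cf p _) (cf r _) => Q P S e1 e2.
have sgN b : sg (~~ b) = - sg b by rewrite /sg; case: b => /=; rewrite ?opprK.
have sg2 b : sg b * sg b = 1 by rewrite /sg; case: b; rewrite ?mulrNN mul1r.
(* A divergence equation links coefficients of opposite phases and can be solved for the entry whose
   frequency is nonzero; one of the two frequencies is. *)
have sol (x y : R) (F G : bool -> bool -> R) : y != 0 ->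
    (forall b1 b2, sg b1 * x * F (~~ b1) b2 + sg b2 * y * G b1 (~~ b2) = 0) ->
    forall b1 b2, G b1 b2 = sg b1 * sg b2 * (x / y) * F (~~ b1) (~~ b2).
  move=> y0 h b1 b2; have := h b1 (~~ b2); rewrite negbK sgN => /eqP.
  rewrite mulNr mulNr subr_eq0 => /eqP h'; apply: (mulfI y0).
  rewrite -[LHS]mul1r -(sg2 b2) -!mulrA [sg b2 * (y * _)]mulrA -h'; field.
  exact: y0.
have sol' (x y : R) (F G : bool -> bool -> R) : x != 0 ->
    (forall b1 b2, sg b1 * x * F (~~ b1) b2 + sg b2 * y * G b1 (~~ b2) = 0) ->
    forall b1 b2, F b1 b2 = sg b1 * sg b2 * (y / x) * G (~~ b1) (~~ b2).
  move=> x0 h b1 b2; have := h (~~ b1) b2; rewrite negbK sgN => /eqP.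
  rewrite mulNr mulNr addrC subr_eq0 => /eqP h'; apply: (mulfI x0).
  rewrite -[LHS]mul1r -(sg2 b1) -!mulrA [sg b1 * (x * _)]mulrA -h'; field.
  exact: x0.
have [k1z|k1n] := eqVneq k1 0%N.
  have k2n : (0 < k2)%N by rewrite lt0n; move: k0; rewrite k1z xpair_eqE eqxx.
  have f2 : freq l.2 k2 != 0 by rewrite gt_eqF // freq_gt0.
  have hP := sol _ _ _ _ f2 e1; have hS := sol _ _ _ _ f2 e2.
  (* Each term is now a multiple of the difference of the squares of [Q] at a phase and at the
     opposite one; the cancellation is between opposite phases. *)
  by rewrite !hS !hP /sg /=; ring.
have f1 : freq l.1 k1 != 0 by rewrite gt_eqF // freq_gt0 // lt0n.
have hQ := sol' _ _ _ _ f1 e1; have hP := sol' _ _ _ _ f1 e2.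
by rewrite !hQ !hP /sg /=; ring.
Qed.

Lemma trig2_00 b1 b2 z : trig2 ((0%N, 0%N), (b1, b2)) z = (~~ b1 && ~~ b2)%:R.
Proof.
rewrite /trig2 /=; case: b1; first by rewrite trig0t mul0r.
by case: b2; rewrite ?trig0t ?trig0 ?mulr0 ?mulr1.
Qed.

(** By [det_coef_eq0] only the zero frequency contributes, and there the only nonzero mode is the
    constant 1. *)
Lemma sum_modes_det N : (0 < N)%N ->
  \sum_(i <- modes N) weight2 i *
    (ip mu2 cell q (trig2 i) * ip mu2 cell r (trig2 i) - ip mu2 cell p (trig2 i) ^+ 2) =
  (l.1 * l.2)^-1 * (ip mu2 cell q (fun=> 1) * ip mu2 cell r (fun=> 1)
                    - ip mu2 cell p (fun=> 1) ^+ 2).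
Proof.
move=> N0; rewrite big_allpairs_dep /=.
have E k : \sum_(b <- phases) weight2 (k, b) *
    (ip mu2 cell q (trig2 (k, b)) * ip mu2 cell r (trig2 (k, b))
     - ip mu2 cell p (trig2 (k, b)) ^+ 2) =
  weight l.1 k.1 * weight l.2 k.2 *
    \sum_(b <- phases) (cf q k b.1 b.2 * cf r k b.1 b.2 - cf p k b.1 b.2 ^+ 2).
  by rewrite mulr_sumr; apply: eq_bigr => -[b1 b2] _.
under eq_bigr do rewrite E.
have k00 : (0%N, 0%N) \in freqs N.
  by apply/allpairsP; exists (0%N, 0%N); rewrite !mem_iota N0.
rewrite (bigD1_seq (0%N, 0%N)) //; last first.
  by apply: allpairs_uniq; rewrite ?iota_uniq // => -[? ?] [? ?].
rewrite [X in _ + X = _]big1 ?addr0 => [|k k0]; last first.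
  by rewrite [X in _ * X](det_coef_eq0 k0) mulr0.
have cf0 f b1 b2 : cf f (0%N, 0%N) b1 b2 =
    ip mu2 cell f (fun=> (~~ b1 && ~~ b2)%:R).
  by apply: eq_ip => // z _; exact: trig2_00.
rewrite /phases !big_cons big_nil /= !cf0 /=.
rewrite !(@ip0r _ _ R mu2 cell measurable_cell) /weight eqxx !div1r invfM; ring.
Qed.

(** Parseval's formula is available for squares, so the product [q * r] is polarized through
    [u = q + r] and [v = q - r]. *)
Lemma null_Lagrangian :
  ip mu2 cell q r - ip mu2 cell p p =
  (l.1 * l.2)^-1 * (ip mu2 cell q (fun=> 1) * ip mu2 cell r (fun=> 1)
                    - ip mu2 cell p (fun=> 1) ^+ 2).
Proof.
have mC := measurable_cell.
set rhs := RHS; apply/eqP; rewrite -subr_eq0 -normr_le0; apply/ler_addgt0Pr => e e0.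
rewrite add0r.
pose u z := q z + r z; pose v z := q z - r z.
have Lu : L2 mu2 cell u by exact: (@L2D _ _ R mu2 cell mC _ _ Lq Lr).
have Lv : L2 mu2 cell v by exact: (@L2B _ _ R mu2 cell mC _ _ Lq Lr).
have [N1 h1] := trig2_Parseval Lu e0; have [N2 h2] := trig2_Parseval Lv e0.
(* The errors for [u] and [v] enter divided by 4, and together they use the other half of [e]. *)
have e2 : 0 < e / 2 by rewrite divr_gt0.
have [N3 h3] := trig2_Parseval Lp e2.
pose N := (maxn N1 (maxn N2 N3)).+1.
have N1N : (N1 <= N)%N by rewrite ltnW // ltnS leq_max leqnn.
have N2N : (N2 <= N)%N by rewrite ltnW // ltnS !leq_max leqnn orbT.
have N3N : (N3 <= N)%N by rewrite ltnW // ltnS !leq_max leqnn !orbT.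
have {h1} h1 := h1 _ N1N; have {h2} h2 := h2 _ N2N; have {h3} h3 := h3 _ N3N.
have N0 : (0 < N)%N by [].
have := sum_modes_det N0; rewrite -/rhs => hrhs.
have cu i : ip mu2 cell u (trig2 i) = ip mu2 cell q (trig2 i) + ip mu2 cell r (trig2 i).
  exact: (@ipDl _ _ R mu2 cell mC _ _ _ Lq Lr (trig2_L2 i)).
have cv i : ip mu2 cell v (trig2 i) = ip mu2 cell q (trig2 i) - ip mu2 cell r (trig2 i).
  exact: (@ipBl _ _ R mu2 cell mC _ _ _ Lq Lr (trig2_L2 i)).
have pol : ip mu2 cell q r = (ip mu2 cell u u - ip mu2 cell v v) / 4.
  rewrite (@ipDl _ _ R mu2 cell mC _ _ _ Lq Lr Lu) (@ipBl _ _ R mu2 cell mC _ _ _ Lq Lr Lv).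
  rewrite (@ipDr _ _ R mu2 cell mC _ _ _ Lq Lr Lq) (@ipDr _ _ R mu2 cell mC _ _ _ Lq Lr Lr).
  rewrite (@ipBr _ _ R mu2 cell mC _ _ _ Lq Lr Lq) (@ipBr _ _ R mu2 cell mC _ _ _ Lq Lr Lr).
  by rewrite (@ipC _ _ R mu2 cell r q); field.
have : rhs = (\sum_(i <- modes N) weight2 i * ip mu2 cell u (trig2 i) ^+ 2
    - \sum_(i <- modes N) weight2 i * ip mu2 cell v (trig2 i) ^+ 2) / 4
    - \sum_(i <- modes N) weight2 i * ip mu2 cell p (trig2 i) ^+ 2.
  rewrite -hrhs -sumrB mulr_suml -sumrB; apply: eq_bigr => i _.
  by rewrite cu cv; field.
move=> ->; rewrite pol; move: h1 h2 h3; rewrite !ltr_norml ler_norml.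
move: (ip mu2 cell u u) (ip mu2 cell v v) (ip mu2 cell p p) => U V P.
move: (\sum_(i <- _) _) (\sum_(i <- _) _) (\sum_(i <- _) _) => A B C.
by move=> /andP[? ?] /andP[? ?] /andP[? ?]; apply/andP; split; lra.
Qed.

End null_Lagrangian.
End trig2.

(** * Elastic energy *)

Section bilinear.
Context d (T : measurableType d) (R : realType).
Variables (mu : {measure set T -> \bar R}) (D : set T).
Hypothesis mD : measurable D.
Implicit Types (K G t : R) (s e f p u v : T -> R).

(* The integral of the Frobenius product of two symmetric matrix fields, given
   by their entries 11, 22 and 12. *)
Definition work s0 s1 s2 e0 e1 e2 : R :=
  ip mu D s0 e0 + ip mu D s1 e1 + 2 * ip mu D s2 e2.

(** The polarized elastic energy: the work of Hooke's stress of [e] on [f]. The factor [4 * G] is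
    the [2 * G] of the shear stress, counted for both off-diagonal entries. *)
Definition elastic K G e0 e1 e2 f0 f1 f2 : R :=
  (K + G) * (ip mu D e0 f0 + ip mu D e1 f1) +
  (K - G) * (ip mu D e0 f1 + ip mu D e1 f0) + 4 * G * ip mu D e2 f2.

Lemma work_elastic K G s0 s1 s2 e0 e1 e2 f0 f1 f2 :
  L2 mu D e0 -> L2 mu D e1 -> L2 mu D e2 ->
  L2 mu D f0 -> L2 mu D f1 -> L2 mu D f2 ->
  (forall x, s0 x = (K + G) * e0 x + (K - G) * e1 x) ->
  (forall x, s1 x = (K + G) * e1 x + (K - G) * e0 x) ->
  (forall x, s2 x = 2 * G * e2 x) ->
  work s0 s1 s2 f0 f1 f2 = elastic K G e0 e1 e2 f0 f1 f2.
Proof.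
move=> E0 E1 E2 F0 F1 F2 h0 h1 h2; rewrite /work /elastic.
have -> : ip mu D s0 f0 = (K + G) * ip mu D e0 f0 + (K - G) * ip mu D e1 f0.
  rewrite -(ipZl mD (K - G) E1 F0) -(ip_linl mD (K + G) E0 (L2Z mD (K - G) E1) F0).
  exact: eq_ip.
have -> : ip mu D s1 f1 = (K + G) * ip mu D e1 f1 + (K - G) * ip mu D e0 f1.
  rewrite -(ipZl mD (K - G) E0 F1) -(ip_linl mD (K + G) E1 (L2Z mD (K - G) E0) F1).
  exact: eq_ip.
have -> : ip mu D s2 f2 = 2 * G * ip mu D e2 f2.
  by rewrite -(ipZl mD (2 * G) E2 F2); exact: eq_ip.
by ring.
Qed.

Lemma ip_perturb t p p' v v' u u' : L2 mu D p -> L2 mu D p' ->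
  L2 mu D v -> L2 mu D v' -> L2 mu D u -> L2 mu D u' ->
  {ae mu, forall x, D x -> p x = t * v x + u x} ->
  {ae mu, forall x, D x -> p' x = t * v' x + u' x} ->
  ip mu D p p' = t ^+ 2 * ip mu D v v' +
    t * (ip mu D v u' + ip mu D u v') + ip mu D u u'.
Proof.
move=> P P' V V' U U' h h'.
rewrite (ae_eq_ip mD P (L2_lin mD t V U) P' (L2_lin mD t V' U') h h').
rewrite (ip_linl mD t V U (L2_lin mD t V' U')).
rewrite (ip_linr mD t V' U' V) (ip_linr mD t V' U' U).
by ring.
Qed.

Lemma elastic_perturb K G t p0 p1 p2 v0 v1 v2 u0 u1 u2 :
  L2 mu D p0 -> L2 mu D p1 -> L2 mu D p2 ->
  L2 mu D v0 -> L2 mu D v1 -> L2 mu D v2 ->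
  L2 mu D u0 -> L2 mu D u1 -> L2 mu D u2 ->
  {ae mu, forall x, D x -> p0 x = t * v0 x + u0 x} ->
  {ae mu, forall x, D x -> p1 x = t * v1 x + u1 x} ->
  {ae mu, forall x, D x -> p2 x = t * v2 x + u2 x} ->
  elastic K G p0 p1 p2 p0 p1 p2 =
    elastic K G u0 u1 u2 u0 u1 u2 + 2 * t * elastic K G u0 u1 u2 v0 v1 v2 +
    t ^+ 2 * elastic K G v0 v1 v2 v0 v1 v2.
Proof.
move=> P0 P1 P2 V0 V1 V2 U0 U1 U2 h0 h1 h2; rewrite /elastic.
rewrite (ip_perturb P0 P0 V0 V0 U0 U0 h0 h0) (ip_perturb P1 P1 V1 V1 U1 U1 h1 h1).
rewrite (ip_perturb P0 P1 V0 V1 U0 U1 h0 h1) (ip_perturb P1 P0 V1 V0 U1 U0 h1 h0).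
rewrite (ip_perturb P2 P2 V2 V2 U2 U2 h2 h2).
rewrite (ipC mu D v0 u0) (ipC mu D v1 u1) (ipC mu D v0 u1) (ipC mu D v1 u0) (ipC mu D v2 u2).
by ring.
Qed.

End bilinear.

Section elasticity.
Context {R : realType}.
Local Notation plane := (R * R)%type.
Local Notation mu2 := ((@lebesgue_measure R) \x (@lebesgue_measure R))%E.
Implicit Types (K G t : R) (xi : 'M[R]_2) (u v : 'I_2 -> plane -> R) (i j : 'I_2).

Variables (Omega : set plane) (c l : plane).
Hypothesis oO : open Omega.
Hypothesis bO : bounded_set Omega.
Hypothesis l1 : 0 < l.1.
Hypothesis l2 : 0 < l.2.
Hypothesis Ocell : Omega `<=` cell c l.

Let mO : measurable Omega := open_measurable_plane oO.

Local Notation ipO := (ip mu2 Omega).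
Local Notation L2O := (L2 mu2 Omega).

Lemma ord2P i : i = 0 \/ i = 1.
Proof. by case: i => -[|[|//]] ?; [left|right]; apply/val_inj. Qed.

Definition eps u i j (x : plane) : R := strain Omega u x i j.
Definition sig K G u i j (x : plane) : R := stress Omega K G u x i j.

Lemma epsE u i j x : eps u i j x =
  2^-1 * weak_partial Omega j (u i) x + 2^-1 * weak_partial Omega i (u j) x.
Proof. by rewrite /eps /strain mxE [LHS]mulrC mulrDr. Qed.

Lemma eps_sym u i j x : eps u i j x = eps u j i x.
Proof. rewrite (epsE u i j) (epsE u j i); exact: addrC. Qed.

Lemma ord01 : (0 == 1 :> 'I_2) = false. Proof. by []. Qed.
Lemma ord10 : (1 == 0 :> 'I_2) = false. Proof. by []. Qed.

Lemma hooke00 K G (e : 'M[R]_2) : hooke K G e 0 0 = (K + G) * e 0 0 + (K - G) * e 1 1.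
Proof. by rewrite /hooke mxE eqxx; congr (_ + _ * e _ _); exact/val_inj. Qed.

Lemma hooke11 K G (e : 'M[R]_2) : hooke K G e 1 1 = (K + G) * e 1 1 + (K - G) * e 0 0.
Proof. by rewrite /hooke mxE eqxx; congr (_ + _ * e _ _); exact/val_inj. Qed.

Lemma hooke01 K G (e : 'M[R]_2) : hooke K G e 0 1 = 2 * G * e 0 1.
Proof. by rewrite /hooke mxE ord01. Qed.

Lemma hooke10 K G (e : 'M[R]_2) : hooke K G e 1 0 = 2 * G * e 1 0.
Proof. by rewrite /hooke mxE ord10. Qed.

Lemma sig00 K G u x : sig K G u 0 0 x = (K + G) * eps u 0 0 x + (K - G) * eps u 1 1 x.
Proof. exact: hooke00. Qed.

Lemma sig11 K G u x : sig K G u 1 1 x = (K + G) * eps u 1 1 x + (K - G) * eps u 0 0 x.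
Proof. exact: hooke11. Qed.

Lemma sig01 K G u x : sig K G u 0 1 x = 2 * G * eps u 0 1 x.
Proof. exact: hooke01. Qed.

Lemma sig10 K G u x : sig K G u 1 0 x = 2 * G * eps u 0 1 x.
Proof. by rewrite (eps_sym u 0 1); exact: hooke10. Qed.

Lemma eps_L2 u i j : (forall i, H1 Omega (u i)) -> L2O (eps u i j).
Proof.
move=> Hu.
have h := @L2D _ _ R mu2 Omega mO _ _
  (@L2Z _ _ R mu2 Omega mO 2^-1 _ (weak_partial_L2 j (Hu i)))
  (@L2Z _ _ R mu2 Omega mO 2^-1 _ (weak_partial_L2 i (Hu j))).
by apply: eq_L2 h => x _; rewrite epsE.
Qed.

Lemma sig_L2 K G u i j : (forall i, H1 Omega (u i)) -> L2O (sig K G u i j).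
Proof.
move=> Hu.
have h a b i' j' := @L2D _ _ R mu2 Omega mO _ _
  (@L2Z _ _ R mu2 Omega mO a _ (eps_L2 i i Hu))
  (@L2Z _ _ R mu2 Omega mO b _ (eps_L2 i' j' Hu)).
have h' a i' j' := @L2Z _ _ R mu2 Omega mO a _ (eps_L2 i' j' Hu).
have [-> | ->] := ord2P i; have [-> | ->] := ord2P j.
- apply: eq_L2 (@L2D _ _ R mu2 Omega mO _ _ (h' (K + G) 0 0) (h' (K - G) 1 1)) => x _.
  by rewrite sig00.
- by apply: eq_L2 (h' (2 * G) 0 1) => x _; rewrite sig01.
- by apply: eq_L2 (h' (2 * G) 0 1) => x _; rewrite sig10.
- apply: eq_L2 (@L2D _ _ R mu2 Omega mO _ _ (h' (K + G) 1 1) (h' (K - G) 0 0)) => x _.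
  by rewrite sig11.
Qed.

Definition perturb t v u : 'I_2 -> plane -> R := fun i z => t * v i z + u i z.

Lemma eps_perturb_ae t v u i j : (forall i, H1 Omega (v i)) -> (forall i, H1 Omega (u i)) ->
  {ae mu2, forall x, Omega x -> eps (perturb t v u) i j x = t * eps v i j x + eps u i j x}.
Proof.
move=> Hv Hu.
have h1 := weak_partial_lin_ae oO bO j t (Hv i) (Hu i).
have h2 := weak_partial_lin_ae oO bO i t (Hv j) (Hu j).
apply: filterS2 h1 h2 => x e2 e1 Ox; move: (e2 Ox) (e1 Ox) => {}e2 {}e1.
rewrite (epsE (perturb t v u)) (epsE v) (epsE u).
rewrite [X in _ * X + _]e2 [X in _ + _ * X]e1.
move: (weak_partial _ _ _ _) (weak_partial _ _ _ _) => p q.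
move: (weak_partial _ _ _ _) (weak_partial _ _ _ _) => p' q'.
by ring.
Qed.

Lemma energyE K G u : (forall i, H1 Omega (u i)) ->
  energy Omega K G u =
  work mu2 Omega (sig K G u 0 0) (sig K G u 1 1) (sig K G u 0 1)
    (eps u 0 0) (eps u 1 1) (eps u 0 1).
Proof.
move=> Hu; have E i j := eps_L2 i j Hu; have S i j := sig_L2 K G i j Hu.
pose f := fun x => sig K G u 0 0 x * eps u 0 0 x + sig K G u 1 1 x * eps u 1 1 x.
pose g := fun x => sig K G u 0 1 x * eps u 0 1 x.
have i0 := @L2_integrableM _ _ R mu2 Omega mO _ _ (S 0 0) (E 0 0).
have i1 := @L2_integrableM _ _ R mu2 Omega mO _ _ (S 1 1) (E 1 1).
have i2 := @L2_integrableM _ _ R mu2 Omega mO _ _ (S 0 1) (E 0 1).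
have if_ : mu2.-integrable Omega (EFin \o f) :=
  @integrableD _ _ R mu2 Omega mO _ _ i0 i1.
have i2' : mu2.-integrable Omega (EFin \o (fun x => 2 * g x)) :=
  @integrableZl _ _ R mu2 Omega mO 2 _ i2.
have -> : energy Omega K G u = \int[mu2]_(x in Omega) (f x + 2 * g x).
  apply: eq_Rintegral => x _; rewrite /frobenius !big_ord_recl !big_ord0 /= !addr0.
  have -> : lift ord0 ord0 = (1 : 'I_2) by exact/val_inj.
  rewrite -!/(eps u _ _ x) -!/(sig K G u _ _ x) /f /g.
  by rewrite sig10 (eps_sym u 1 0) sig01; ring.
rewrite (@RintegralD _ _ R mu2 Omega _ _ mO if_ i2').
by rewrite (@RintegralD _ _ R mu2 Omega _ _ mO i0 i1) (@RintegralZl _ _ R mu2 Omega _ _ mO i2).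
Qed.

Lemma work_sig K G u v : (forall i, H1 Omega (u i)) -> (forall i, H1 Omega (v i)) ->
  work mu2 Omega (sig K G u 0 0) (sig K G u 1 1) (sig K G u 0 1)
    (eps v 0 0) (eps v 1 1) (eps v 0 1) =
  elastic mu2 Omega K G (eps u 0 0) (eps u 1 1) (eps u 0 1)
    (eps v 0 0) (eps v 1 1) (eps v 0 1).
Proof.
move=> Hu Hv; have E i j := eps_L2 i j Hu; have F i j := eps_L2 i j Hv.
exact: (@work_elastic _ _ R mu2 Omega mO K G _ _ _ _ _ _ _ _ _
  (E 0 0) (E 1 1) (E 0 1) (F 0 0) (F 1 1) (F 0 1)
  (sig00 K G u) (sig11 K G u) (sig01 K G u)).
Qed.

Lemma energy_perturb K G t v u :
  (forall i, H1 Omega (v i)) -> (forall i, H1 Omega (u i)) ->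
  energy Omega K G (perturb t v u) =
  energy Omega K G u +
  2 * t * work mu2 Omega (sig K G u 0 0) (sig K G u 1 1) (sig K G u 0 1)
    (eps v 0 0) (eps v 1 1) (eps v 0 1) +
  t ^+ 2 * energy Omega K G v.
Proof.
move=> Hv Hu.
have Hp k : H1 Omega (perturb t v u k) by exact: H1_lin.
have V i j := eps_L2 i j Hv; have U i j := eps_L2 i j Hu; have P i j := eps_L2 i j Hp.
have Ep := etrans (energyE K G Hp) (work_sig K G Hp Hp).
have Eu := etrans (energyE K G Hu) (work_sig K G Hu Hu).
have Ev := etrans (energyE K G Hv) (work_sig K G Hv Hv).
rewrite [LHS]Ep [X in _ = X + _ + _]Eu [X in _ = _ + _ + _ * X]Ev.
rewrite [X in _ = _ + _ * X + _](work_sig K G Hu Hv).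
have h i j := eps_perturb_ae t i j Hv Hu.
exact: (@elastic_perturb _ _ R mu2 Omega mO K G t _ _ _ _ _ _ _ _ _
  (P 0 0) (P 1 1) (P 0 1) (V 0 0) (V 1 1) (V 0 1) (U 0 0) (U 1 1) (U 0 1)
  (h 0 0) (h 1 1) (h 0 1)).
Qed.

Lemma quadratic_ge0_lin0 (a b : R) : (forall t, 0 <= 2 * t * b + t ^+ 2 * a) -> b = 0.
Proof.
move=> h; apply/eqP; apply: contraT => b0.
pose m := `|a| + 1; have m0 : 0 < m by rewrite ltr_wpDl.
(* At this value of [t] the quadratic equals [(b / m) ^+ 2 * (a - 2 * m)], negative for nonzero
   [b]. *)
have := h (- b / m); have am : a - 2 * m < 0.
  by rewrite /m; have := ler_norm a; have := normr_ge0 a; lra.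
have -> : 2 * (- b / m) * b + (- b / m) ^+ 2 * a = (b / m) ^+ 2 * (a - 2 * m).
  by field; rewrite gt_eqF.
rewrite pmulr_rge0 ?exprn_even_gt0 ?mulf_neq0 ?invr_eq0 ?(gt_eqF m0) //=.
by rewrite leNgt am.
Qed.

(** Adding a periodic field preserves admissibility for [xi], so [u + t v] competes for every real
    [t] and the linear term of the energy in [t] vanishes. *)
Lemma Euler_Lagrange K G xi u v : energy_minimizer Omega c l K G xi u ->
  (forall i, H1per c l Omega (v i)) ->
  work mu2 Omega (sig K G u 0 0) (sig K G u 1 1) (sig K G u 0 1)
    (eps v 0 0) (eps v 1 1) (eps v 0 1) = 0.
Proof.
move=> [adm min] Pv.
have Hv i : H1 Omega (v i) by have [] := Pv i.
have Hu i : H1 Omega (u i) by have [] := adm i.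
apply: (@quadratic_ge0_lin0 (energy Omega K G v)) => t.
have : kinematically_admissible Omega c l xi (perturb t v u).
  move=> i; split; first exact: H1_lin.
  have := H1per_lin oO bO t (Pv i) (adm i).2.
  by congr H1per; apply/funext => z; rewrite /perturb /= addrA.
by move=> /min; rewrite energy_perturb // -addrA lerDl.
Qed.

Lemma smooth1_id : smooth1 (fun x : R => x).
Proof.
exists (fun n x => if n is n'.+1 then (if n' is 0%N then 1 else 0) else x); split=> //.
by move=> [|[|n]] x; [exact: is_derive_id|exact: is_derive_cst|exact: is_derive_cst].
Qed.

Lemma linear_fieldE xi i : linear_field xi i =
  fun x => xi i 0 * coord 0 x + xi i 1 * coord 1 x.
Proof.
apply/funext => x; rewrite /linear_field !big_ord_recl big_ord0 addr0.
by have -> : lift ord0 ord0 = (1 : 'I_2) by exact/val_inj.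
Qed.

Lemma smooth_linear_field xi i : smooth (linear_field xi i).
Proof.
rewrite linear_fieldE; apply: smooth_lin; first exact: (smooth_coord 0 smooth1_id).
by apply: smoothM; [exact: smooth_cst|exact: (smooth_coord 1 smooth1_id)].
Qed.

Lemma derive_linear_field xi i j x : 'D_(dir R j) (linear_field xi i) x = xi i j.
Proof.
have d k := is_derive_coord (j := k) j (is_derive_id (coord k x) (1 : R)).
have := is_deriveD (is_deriveZ (xi i 0) (d 0)) (is_deriveZ (xi i 1) (d 1)).
rewrite linear_fieldE => -[_ ->]; rewrite /GRing.scale /=.
by case: (ord2P j) => ->; rewrite ?ord01 ?ord10 ?eqxx ?mulr1 ?mulr0 ?addr0 ?add0r.
Qed.

Lemma eps_admissible_ae xi u i j : xi^T = xi -> kinematically_admissible Omega c l xi u ->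
  {ae mu2, forall x, Omega x ->
    eps u i j x = eps (fun i => u i \- linear_field xi i) i j x + xi i j}.
Proof.
move=> sxi adm; pose w k := u k \- linear_field xi k.
have Hw k : H1 Omega (w k) by have [_ []] := adm k.
have Hl k : H1 Omega (linear_field xi k) by apply: H1_smooth => //; exact: smooth_linear_field.
have -> : u = perturb 1 w (linear_field xi).
  by apply/funext => k; apply/funext => z; rewrite /perturb /w /= mul1r subrK.
have -> : (fun i => perturb 1 w (linear_field xi) i \- linear_field xi i) = w.
  by apply/funext => k; apply/funext => z; rewrite /perturb /= mul1r addrK.
have h := eps_perturb_ae 1 i j Hw Hl.
have h1 := weak_partial_smooth_ae oO bO j (smooth_linear_field xi i).
have h2 := weak_partial_smooth_ae oO bO i (smooth_linear_field xi j).
apply: filterS3 h h1 h2 => x e e1 e2 Ox; move: (e Ox) (e1 Ox) (e2 Ox) => {}e {}e1 {}e2.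
rewrite e mul1r (epsE (linear_field xi)) [X in _ + (_ * X + _)]e1 [X in _ + (_ + _ * X)]e2.
rewrite !derive_linear_field; congr (_ + _).
have -> : xi j i = xi i j by rewrite -[in LHS]sxi mxE.
by field.
Qed.

(** The periodic part of [u'] is a variation, on which the stress does no work; only the affine part
    with strain [xi'] remains. The field [u'] may come from other moduli. *)
Lemma work_minimizer K G xi xi' u u' : xi'^T = xi' ->
  energy_minimizer Omega c l K G xi u -> kinematically_admissible Omega c l xi' u' ->
  work mu2 Omega (sig K G u 0 0) (sig K G u 1 1) (sig K G u 0 1)
    (eps u' 0 0) (eps u' 1 1) (eps u' 0 1) =
  xi' 0 0 * ipO (sig K G u 0 0) (fun=> 1) + xi' 1 1 * ipO (sig K G u 1 1) (fun=> 1) +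
  2 * xi' 0 1 * ipO (sig K G u 0 1) (fun=> 1).
Proof.
move=> sxi mu_ adm; pose w i := u' i \- linear_field xi' i.
have Hw i : H1 Omega (w i) by have [_ []] := adm i.
have Hu' i : H1 Omega (u' i) by have [] := adm i.
have Hu i : H1 Omega (u i) by have [/(_ i)[]] := mu_.
have := @Euler_Lagrange K G xi u w mu_ (fun k => (adm k).2); rewrite /work => EL.
have L1 := @L2_cst _ _ R mu2 Omega mO 1 (Omega_finite oO bO).
have split_ i j : ipO (sig K G u i j) (eps u' i j) =
    ipO (sig K G u i j) (eps w i j) + xi' i j * ipO (sig K G u i j) (fun=> 1).
  have S := sig_L2 K G i j Hu; have W := eps_L2 i j Hw; have U := eps_L2 i j Hu'.
  have C := @L2Z _ _ R mu2 Omega mO (xi' i j) _ L1.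
  rewrite -(@ipZr _ _ R mu2 Omega mO _ _ _ L1 S) -(@ipDr _ _ R mu2 Omega mO _ _ _ W C S).
  apply: (@ae_eq_ip _ _ R mu2 Omega mO _ _ _ _ S S U (@L2D _ _ R mu2 Omega mO _ _ W C)).
    exact: aeW.
  by apply: filterS (eps_admissible_ae i j sxi adm) => x h Ox; rewrite h // mulr1.
rewrite [X in X + _ + _ = _]split_ [X in _ + X + _ = _]split_ [X in _ + _ * X = _]split_; move: EL.
move: (ipO _ (eps w 0 0)) (ipO _ (eps w 1 1)) (ipO _ (eps w 0 1)) => a b d EL.
move: (ipO _ _) (ipO _ _) (ipO _ _) => p q r.
by rewrite -[RHS]add0r -EL; ring.
Qed.

(** * Equilibrium of the stress and its extension by zero *)

Lemma eps_smooth_ae v i j : (forall k, smooth (v k)) ->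
  {ae mu2, forall x, Omega x -> eps v i j x =
    2^-1 * 'D_(dir R j) (v i) x + 2^-1 * 'D_(dir R i) (v j) x}.
Proof.
move=> sv.
have h1 := weak_partial_smooth_ae oO bO j (sv i).
have h2 := weak_partial_smooth_ae oO bO i (sv j).
apply: filterS2 h1 h2 => x e1 e2 Ox; move: (e1 Ox) (e2 Ox) => {}e1 {}e2.
by rewrite (epsE v) [X in _ * X + _]e1 [X in _ + _ * X]e2.
Qed.

(* [q], [r] and [p] are the entries 11, 22 and 12. *)
Definition div_free (q r p : plane -> R) : Prop :=
  [/\ L2O q, L2O r, L2O p &
   forall m : (nat * nat) * (bool * bool),
     ipO q ('D_(dir R 0) (trig2 c l m)) + ipO p ('D_(dir R 1) (trig2 c l m)) = 0 /\
     ipO p ('D_(dir R 0) (trig2 c l m)) + ipO r ('D_(dir R 1) (trig2 c l m)) = 0].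

Lemma div_freeD q r p q' r' p' : div_free q r p -> div_free q' r' p' ->
  div_free (fun x => q x + q' x) (fun x => r x + r' x) (fun x => p x + p' x).
Proof.
move=> [Lq Lr Lp h] [Lq' Lr' Lp' h'].
split; try exact: (@L2D _ _ R mu2 Omega mO).
move=> m; have [e1 e2] := h m; have [e1' e2'] := h' m.
have D k : L2O ('D_(dir R k) (trig2 c l m)).
  exact: (smooth_L2 oO bO (smooth_derive k (smooth_trig2 c l m))).
rewrite (@ipDl _ _ R mu2 Omega mO _ _ _ Lq Lq' (D 0)).
rewrite (@ipDl _ _ R mu2 Omega mO _ _ _ Lp Lp' (D 1)).
rewrite (@ipDl _ _ R mu2 Omega mO _ _ _ Lp Lp' (D 0)).
rewrite (@ipDl _ _ R mu2 Omega mO _ _ _ Lr Lr' (D 1)).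
by split; rewrite addrACA ?e1 ?e1' ?e2 ?e2' addr0.
Qed.

(** The two equations come from the variations with a single nonzero component, equal to a
    trigonometric mode. The factor 2 on the shear term in [work] cancels the half in the strain. *)
Lemma stress_div_free K G xi u : energy_minimizer Omega c l K G xi u ->
  div_free (sig K G u 0 0) (sig K G u 1 1) (sig K G u 0 1).
Proof.
move=> mu_; have Hu k : H1 Omega (u k) by have [/(_ k)[]] := mu_.
have S i j := sig_L2 K G i j Hu.
split; try exact: S.
move=> m; have sm := smooth_trig2 c l m.
have D k : L2O ('D_(dir R k) (trig2 c l m)) by exact: (smooth_L2 oO bO (smooth_derive k sm)).
have D' k := @L2Z _ _ R mu2 Omega mO 2^-1 _ (D k).
have Z := @L2_0 _ _ R mu2 Omega.
have D0 i x : 'D_(dir R i) (fun=> 0 : R) x = 0 by rewrite derive_cst.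
have per phi : smooth phi -> plane_periodic l phi -> H1per c l Omega phi.
  by move=> *; exact: H1per_smooth.
have sg k : smooth (fun _ : plane => 0 : R) by exact: smooth_cst.
have pt := per _ sm (trig2_periodic c l1 l2 m).
have p0 : H1per c l Omega (fun=> 0) by apply: per => //; exact: smooth_cst.
have refl_ i j : {ae mu2, forall x, Omega x -> sig K G u i j x = sig K G u i j x} by exact: aeW.
split.
- pose v (k : 'I_2) : plane -> R := if k == 0 then trig2 c l m else fun=> 0.
  have sv k : smooth (v k) by rewrite /v; case: ifP => _ //; exact: smooth_cst.
  have Pv k : H1per c l Omega (v k) by rewrite /v; case: ifP.
  have Hv k : H1 Omega (v k) by have [] := Pv k.
  have E i j := eps_L2 i j Hv.
  have EL := @Euler_Lagrange K G xi u v mu_ Pv; rewrite /work in EL.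
  have h00 : {ae mu2, forall x, Omega x -> eps v 0 0 x = 'D_(dir R 0) (trig2 c l m) x}.
    apply: filterS (eps_smooth_ae 0 0 sv) => x e Ox; rewrite (e Ox) /v eqxx.
    by move: ('D__ _ _) => y; field.
  have h11 : {ae mu2, forall x, Omega x -> eps v 1 1 x = 0}.
    apply: filterS (eps_smooth_ae 1 1 sv) => x e Ox; rewrite (e Ox) /v ord10.
    by rewrite D0 mulr0 addr0.
  have h01 : {ae mu2, forall x, Omega x -> eps v 0 1 x = 2^-1 * 'D_(dir R 1) (trig2 c l m) x}.
    apply: filterS (eps_smooth_ae 0 1 sv) => x e Ox; rewrite (e Ox) /v ord10 eqxx.
    by rewrite D0 mulr0 addr0.
  rewrite [X in X + _ + _ = _](@ae_eq_ip _ _ R mu2 Omega mO _ _ _ _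
    (S 0 0) (S 0 0) (E 0 0) (D 0) (refl_ 0 0) h00) in EL.
  rewrite [X in _ + X + _ = _](@ae_eq_ip _ _ R mu2 Omega mO _ _ _ _
    (S 1 1) (S 1 1) (E 1 1) Z (refl_ 1 1) h11) in EL.
  rewrite [X in _ + _ * X = _](@ae_eq_ip _ _ R mu2 Omega mO _ _ _ _
    (S 0 1) (S 0 1) (E 0 1) (D' 1) (refl_ 0 1) h01) in EL.
  rewrite (@ip0r _ _ R mu2 Omega mO) (@ipZr _ _ R mu2 Omega mO _ _ _ (D 1) (S 0 1)) addr0
    mulrA divff // mul1r in EL.
  exact: EL.
- pose v (k : 'I_2) : plane -> R := if k == 0 then fun=> 0 else trig2 c l m.
  have sv k : smooth (v k) by rewrite /v; case: ifP => _ //; exact: smooth_cst.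
  have Pv k : H1per c l Omega (v k) by rewrite /v; case: ifP.
  have Hv k : H1 Omega (v k) by have [] := Pv k.
  have E i j := eps_L2 i j Hv.
  have EL := @Euler_Lagrange K G xi u v mu_ Pv; rewrite /work in EL.
  have h00 : {ae mu2, forall x, Omega x -> eps v 0 0 x = 0}.
    apply: filterS (eps_smooth_ae 0 0 sv) => x e Ox; rewrite (e Ox) /v eqxx.
    by rewrite D0 mulr0 addr0.
  have h11 : {ae mu2, forall x, Omega x -> eps v 1 1 x = 'D_(dir R 1) (trig2 c l m) x}.
    apply: filterS (eps_smooth_ae 1 1 sv) => x e Ox; rewrite (e Ox) /v ord10.
    by move: ('D__ _ _) => y; field.
  have h01 : {ae mu2, forall x, Omega x -> eps v 0 1 x = 2^-1 * 'D_(dir R 0) (trig2 c l m) x}.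
    apply: filterS (eps_smooth_ae 0 1 sv) => x e Ox; rewrite (e Ox) /v ord10 eqxx.
    by rewrite D0 mulr0 add0r.
  rewrite [X in X + _ + _ = _](@ae_eq_ip _ _ R mu2 Omega mO _ _ _ _
    (S 0 0) (S 0 0) (E 0 0) Z (refl_ 0 0) h00) in EL.
  rewrite [X in _ + X + _ = _](@ae_eq_ip _ _ R mu2 Omega mO _ _ _ _
    (S 1 1) (S 1 1) (E 1 1) (D 1) (refl_ 1 1) h11) in EL.
  rewrite [X in _ + _ * X = _](@ae_eq_ip _ _ R mu2 Omega mO _ _ _ _
    (S 0 1) (S 0 1) (E 0 1) (D' 0) (refl_ 0 1) h01) in EL.
  rewrite (@ip0r _ _ R mu2 Omega mO) (@ipZr _ _ R mu2 Omega mO _ _ _ (D 0) (S 0 1)) add0r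
    mulrA divff // mul1r in EL.
  by rewrite addrC.
Qed.

Lemma ip_restrict (f g : plane -> R) :
  ip mu2 (cell c l) (f \_ Omega) g = ipO f g.
Proof.
rewrite /ip Rintegral_mkcond [RHS]Rintegral_mkcond; congr fine; congr integral.
apply/funext => x; rewrite !patchE; case: ifPn => [/set_mem xC|xC].
  by case: ifP => _; rewrite ?mul0r.
case: ifPn => // /set_mem /Ocell xC'; move: xC; rewrite notin_setE.
by move=> /(_ xC').
Qed.

Lemma L2_restrict (f : plane -> R) : L2O f -> L2 mu2 (cell c l) (f \_ Omega).
Proof.
case=> mf if_; split.
  have [+ _] := measurable_restrict f mO (measurable_cell c l); apply.
  by apply: measurable_funS mf => // x [].
apply: le_lt_trans if_; rewrite le_eqVlt; apply/orP; left; apply/eqP.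
rewrite integral_mkcond [RHS]integral_mkcond; congr integral.
apply/funext => x; rewrite !patchE; case: ifPn => [/set_mem xC|xC].
  by case: ifP => _ //; rewrite expr0n.
case: ifPn => // /set_mem /Ocell xC'; move: xC; rewrite notin_setE.
by move=> /(_ xC').
Qed.

Lemma div_free_det q r p : div_free q r p ->
  ipO q r - ipO p p = (l.1 * l.2)^-1 *
    (ipO q (fun=> 1) * ipO r (fun=> 1) - ipO p (fun=> 1) ^+ 2).
Proof.
move=> [Lq Lr Lp h].
have := @null_Lagrangian _ c l l1 l2 _ _ _ (L2_restrict Lq) (L2_restrict Lp) (L2_restrict Lr).
have R2 (f g : plane -> R) : ip mu2 (cell c l) (f \_ Omega) (g \_ Omega) = ipO f g.
  by rewrite ip_restrict; apply: eq_ip => // x Ox; rewrite patchE mem_set.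
by rewrite !R2 !ip_restrict; apply => m; rewrite !ip_restrict; have [] := h m.
Qed.

(** * Energy in terms of the stress *)

Definition trace_form (s0 s1 t0 t1 : plane -> R) : R :=
  4^-1 * (ipO s0 t0 + ipO s1 t1 + ipO s0 t1 + ipO s1 t0).

(** The polarization of the integral of the determinant, as [trace_form] is that of a quarter of the
    squared trace. *)
Definition det_form (s0 s1 s2 t0 t1 t2 : plane -> R) : R :=
  2^-1 * (ipO s0 t1 + ipO s1 t0) - ipO s2 t2.

(** The quantity [M] of the overview. *)
Definition stress_energy K G u : R := (l.1 * l.2)^-1 *
  trace_form (sig K G u 0 0) (sig K G u 1 1) (sig K G u 0 0) (sig K G u 1 1).

(** The inverse of Hooke's law has the same form, with moduli [(4 * K)^-1] and [(4 * G)^-1], so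
    [work_elastic] applies with the roles of stress and strain exchanged. *)
Lemma work_compliance K G u (s0 s1 s2 : plane -> R) : K != 0 -> G != 0 ->
  (forall i, H1 Omega (u i)) -> L2O s0 -> L2O s1 -> L2O s2 ->
  work mu2 Omega s0 s1 s2 (eps u 0 0) (eps u 1 1) (eps u 0 1) =
  (K^-1 + G^-1) * trace_form (sig K G u 0 0) (sig K G u 1 1) s0 s1 -
  G^-1 * det_form (sig K G u 0 0) (sig K G u 1 1) (sig K G u 0 1) s0 s1 s2.
Proof.
move=> K0 G0 Hu L0 L1' L2'; have S i j := sig_L2 K G i j Hu.
have e0 x : eps u 0 0 x = ((4 * K)^-1 + (4 * G)^-1) * sig K G u 0 0 x +
    ((4 * K)^-1 - (4 * G)^-1) * sig K G u 1 1 x.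
  rewrite sig00 sig11; move: (eps u 0 0 x) (eps u 1 1 x) => a b.
  by field; rewrite K0 G0.
have e1 x : eps u 1 1 x = ((4 * K)^-1 + (4 * G)^-1) * sig K G u 1 1 x +
    ((4 * K)^-1 - (4 * G)^-1) * sig K G u 0 0 x.
  rewrite sig00 sig11; move: (eps u 0 0 x) (eps u 1 1 x) => a b.
  by field; rewrite K0 G0.
have e2 x : eps u 0 1 x = 2 * (4 * G)^-1 * sig K G u 0 1 x.
  rewrite sig01; move: (eps u 0 1 x) => a.
  by field.
have := @work_elastic _ _ R mu2 Omega mO (4 * K)^-1 (4 * G)^-1 _ _ _ _ _ _ _ _ _
  (S 0 0) (S 1 1) (S 0 1) L0 L1' L2' e0 e1 e2.
rewrite /work (@ipC _ _ R mu2 Omega (eps u 0 0) s0) (@ipC _ _ R mu2 Omega (eps u 1 1) s1).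
rewrite (@ipC _ _ R mu2 Omega (eps u 0 1) s2) => ->; rewrite /elastic /trace_form /det_form.
move: (ipO _ s0) (ipO _ s0) (ipO _ s1) (ipO _ s1) (ipO _ s2) => a b d e f.
by field; rewrite K0 G0.
Qed.

(** [div_free_det] is applied to [s], [t] and [s + t]. The averages being equal, the determinant of
    the average quadruples for the sum, and subtracting leaves twice the mixed term. *)
Lemma det_form_div_free (s0 s1 s2 t0 t1 t2 : plane -> R) :
  div_free s0 s1 s2 -> div_free t0 t1 t2 ->
  ipO s0 (fun=> 1) = ipO t0 (fun=> 1) -> ipO s1 (fun=> 1) = ipO t1 (fun=> 1) ->
  ipO s2 (fun=> 1) = ipO t2 (fun=> 1) ->
  det_form s0 s1 s2 t0 t1 t2 = (l.1 * l.2)^-1 *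
    (ipO s0 (fun=> 1) * ipO s1 (fun=> 1) - ipO s2 (fun=> 1) ^+ 2).
Proof.
move=> ds dt m0 m1 m2; have dst := div_freeD ds dt.
have := div_free_det dst; have := div_free_det ds; have := div_free_det dt.
have [S0 S1 S2 _] := ds; have [T0 T1 T2 _] := dt.
have ST0 := @L2D _ _ R mu2 Omega mO _ _ S0 T0; have ST1 := @L2D _ _ R mu2 Omega mO _ _ S1 T1.
have ST2 := @L2D _ _ R mu2 Omega mO _ _ S2 T2.
have L1 := @L2_cst _ _ R mu2 Omega mO 1 (Omega_finite oO bO).
rewrite (@ipDl _ _ R mu2 Omega mO _ _ _ S0 T0 ST1) (@ipDl _ _ R mu2 Omega mO _ _ _ S2 T2 ST2).
rewrite (@ipDr _ _ R mu2 Omega mO _ _ _ S1 T1 S0) (@ipDr _ _ R mu2 Omega mO _ _ _ S1 T1 T0).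
rewrite (@ipDr _ _ R mu2 Omega mO _ _ _ S2 T2 S2) (@ipDr _ _ R mu2 Omega mO _ _ _ S2 T2 T2).
rewrite (@ipDl _ _ R mu2 Omega mO _ _ _ S0 T0 L1) (@ipDl _ _ R mu2 Omega mO _ _ _ S1 T1 L1).
rewrite (@ipDl _ _ R mu2 Omega mO _ _ _ S2 T2 L1).
rewrite -m0 -m1 -m2 /det_form (@ipC _ _ R mu2 Omega t0 s1) (@ipC _ _ R mu2 Omega t2 s2).
move: (ipO s0 (fun=> 1)) (ipO s1 (fun=> 1)) (ipO s2 (fun=> 1)) => a b d.
move: (ipO s0 s1) (ipO t0 t1) (ipO s0 t1) (ipO s1 t0) => p q r s.
move: (ipO s2 s2) (ipO t2 t2) (ipO s2 t2) (_^-1) => p' q' r' y.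
lra.
Qed.

Lemma average_stressE K G u i j : (l.1 * l.2) * average_stress Omega l K G u i j =
  ipO (sig K G u i j) (fun=> 1).
Proof.
rewrite /average_stress mxE mulrA divff ?mul1r; last by rewrite mulf_neq0 ?gt_eqF.
exact: ip_cst1.
Qed.

Lemma trace_formC (s0 s1 t0 t1 : plane -> R) :
  trace_form s0 s1 t0 t1 = trace_form t0 t1 s0 s1.
Proof.
rewrite /trace_form (@ipC _ _ R mu2 Omega s0 t0) (@ipC _ _ R mu2 Omega s1 t1).
by rewrite (@ipC _ _ R mu2 Omega s0 t1) (@ipC _ _ R mu2 Omega s1 t0) addrAC.
Qed.

(** The scalar part of [compliance]. Here [y] is the area of the cell, [(p, q, r)] the common
    average stress, [x] and [z] the average strains, [I] and [J] the integrated stresses; in [M] and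
    [D] the index 0 refers to [K, G] and 1 to [K1, G1]. Comparing [w10] with [w11] gives
    [M10 = M11], because their left sides and determinant terms agree. *)
Lemma compliance_alg (K G K1 G1 y p q r x0 x1 x2 z0 z1 z2 : R)
    (I0 I1 I2 J0 J1 J2 M01 M10 M11 D01 D10 D11 : R) :
  0 < K -> 0 < G -> 0 < K1 -> 0 < G1 -> 0 < y ->
  y * p = I0 -> y * q = I1 -> y * r = I2 -> y * p = J0 -> y * q = J1 -> y * r = J2 ->
  x0 * J0 + x1 * J1 + 2 * x2 * J2 = (K^-1 + G^-1) * M01 - G^-1 * D01 ->
  z0 * I0 + z1 * I1 + 2 * z2 * I2 = (K1^-1 + G1^-1) * M10 - G1^-1 * D10 ->
  z0 * J0 + z1 * J1 + 2 * z2 * J2 = (K1^-1 + G1^-1) * M11 - G1^-1 * D11 ->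
  D01 = y^-1 * (I0 * I1 - I2 ^+ 2) -> D10 = y^-1 * (J0 * J1 - J2 ^+ 2) ->
  D11 = y^-1 * (J0 * J1 - J2 ^+ 2) -> M10 = M01 ->
  x0 * p + x1 * q + 2 * x2 * r =
  (K^-1 + G^-1) * (y^-1 * M11) - G^-1 * (p * q - r ^+ 2).
Proof.
move=> K0 G0 K10 G10 y0 <- <- <- <- <- <- w01 w10 w11 d01 d10 d11 sym.
have kg1 : K1^-1 + G1^-1 != 0 by rewrite gt_eqF // addr_gt0 ?invr_gt0.
have E1 : M01 = M11.
  apply: (mulfI kg1); move: w10 w11; rewrite d10 d11 sym => -> /eqP.
  by rewrite -subr_eq0 opprB addrA subrK subr_eq0 => /eqP.
have nz := @lt0r_neq0 R.
apply: (mulfI (nz _ y0)).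
transitivity (x0 * (y * p) + x1 * (y * q) + 2 * x2 * (y * r)); first by ring.
by rewrite w01 d01 E1; field; rewrite !nz.
Qed.

(** The decisive identity: at a given average stress, [K] and [G] enter the right side only through
    its coefficients, the trace term being computed with the other material. *)
Lemma compliance K G K1 G1 xi xi1 u u1 (tau := average_stress Omega l K G u)
    (tau1 := average_stress Omega l K1 G1 u1) :
  0 < K -> 0 < G -> 0 < K1 -> 0 < G1 -> xi^T = xi -> xi1^T = xi1 ->
  energy_minimizer Omega c l K G xi u -> energy_minimizer Omega c l K1 G1 xi1 u1 ->
  tau 0 0 = tau1 0 0 -> tau 1 1 = tau1 1 1 -> tau 0 1 = tau1 0 1 ->
  xi 0 0 * tau 0 0 + xi 1 1 * tau 1 1 + 2 * xi 0 1 * tau 0 1 =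
  (K^-1 + G^-1) * stress_energy K1 G1 u1 - G^-1 * (tau 0 0 * tau 1 1 - tau 0 1 ^+ 2).
Proof.
move=> K0 G0 K10 G10 sxi sxi1 mu_ mu1_ t00 t11 t01.
have Hu k : H1 Omega (u k) by have [/(_ k)[]] := mu_.
have Hu1 k : H1 Omega (u1 k) by have [/(_ k)[]] := mu1_.
have S i j := sig_L2 K G i j Hu; have S1 i j := sig_L2 K1 G1 i j Hu1.
have nz := @lt0r_neq0 R.
have w01 := etrans (esym (work_minimizer sxi mu1_ mu_.1))
  (work_compliance (nz _ K0) (nz _ G0) Hu (S1 0 0) (S1 1 1) (S1 0 1)).
have w10 := etrans (esym (work_minimizer sxi1 mu_ mu1_.1))
  (work_compliance (nz _ K10) (nz _ G10) Hu1 (S 0 0) (S 1 1) (S 0 1)).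
have w11 := etrans (esym (work_minimizer sxi1 mu1_ mu1_.1))
  (work_compliance (nz _ K10) (nz _ G10) Hu1 (S1 0 0) (S1 1 1) (S1 0 1)).
have d := stress_div_free mu_; have d1 := stress_div_free mu1_.
have y0 : 0 < l.1 * l.2 by rewrite mulr_gt0.
have a00 := average_stressE K G u 0 0; have a11 := average_stressE K G u 1 1.
have a01 := average_stressE K G u 0 1.
have b00 := etrans (congr1 (fun x => l.1 * l.2 * x) t00) (average_stressE K1 G1 u1 0 0).
have b11 := etrans (congr1 (fun x => l.1 * l.2 * x) t11) (average_stressE K1 G1 u1 1 1).
have b01 := etrans (congr1 (fun x => l.1 * l.2 * x) t01) (average_stressE K1 G1 u1 0 1).
have m00 := etrans (esym a00) b00; have m11 := etrans (esym a11) b11.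
have m01 := etrans (esym a01) b01.
have D01 := det_form_div_free d d1 m00 m11 m01.
have D10 := det_form_div_free d1 d (esym m00) (esym m11) (esym m01).
have D11 := det_form_div_free d1 d1 erefl erefl erefl.
have sym := trace_formC (sig K1 G1 u1 0 0) (sig K1 G1 u1 1 1) (sig K G u 0 0) (sig K G u 1 1).
exact: (compliance_alg K0 G0 K10 G10 y0 a00 a11 a01 b00 b11 b01 w01 w10 w11 D01 D10 D11 sym).
Qed.

Lemma stress_energy_trace K G u : (forall i, H1 Omega (u i)) ->
  stress_energy K G u = (l.1 * l.2)^-1 * (4^-1 *
    ipO (fun x => sig K G u 0 0 x + sig K G u 1 1 x)
        (fun x => sig K G u 0 0 x + sig K G u 1 1 x)).
Proof.
move=> Hu; have S i j := sig_L2 K G i j Hu.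
have SS := @L2D _ _ R mu2 Omega mO _ _ (S 0 0) (S 1 1).
rewrite (@ipDl _ _ R mu2 Omega mO _ _ _ (S 0 0) (S 1 1) SS).
rewrite (@ipDr _ _ R mu2 Omega mO _ _ _ (S 0 0) (S 1 1) (S 0 0)).
rewrite (@ipDr _ _ R mu2 Omega mO _ _ _ (S 0 0) (S 1 1) (S 1 1)).
rewrite /stress_energy /trace_form; congr (_ * (_ * _)).
have sum4 (a b d e : R) : a + b + d + e = a + d + (e + b) by ring.
exact: sum4.
Qed.

Lemma stress_energy_ge0 K G u : (forall i, H1 Omega (u i)) -> 0 <= stress_energy K G u.
Proof.
move=> Hu; rewrite stress_energy_trace //; apply: mulr_ge0.
  by rewrite invr_ge0 mulr_ge0 // ltW.
by apply: mulr_ge0; [rewrite invr_ge0|exact: ip_ge0].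
Qed.

Lemma square_expansion_le (a b y : R) : b <= y ->
  0 <= a - 2 * (2 * y) - (2 * (2 * y) - 2 * (2 * b)) -> 4 * y <= a.
Proof. by move=> *; lra. Qed.

(** The square of the trace minus its cell average 2 is integrated over [Omega] and expanded; the
    area of [Omega] is at most that of the cell. *)
Lemma stress_energy_ge1 K G u (tau := average_stress Omega l K G u) :
  (forall i, H1 Omega (u i)) -> tau 0 0 = 1 -> tau 1 1 = 1 -> 1 <= stress_energy K G u.
Proof.
move=> Hu t0 t1; rewrite stress_energy_trace //.
have S i j := sig_L2 K G i j Hu.
have SS := @L2D _ _ R mu2 Omega mO _ _ (S 0 0) (S 1 1).
have L1 := @L2_cst _ _ R mu2 Omega mO 1 (Omega_finite oO bO).
have L2' := @L2_cst _ _ R mu2 Omega mO 2 (Omega_finite oO bO).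
set g := fun x => _ + _ in SS *.
have Y0 : 0 < l.1 * l.2 by rewrite mulr_gt0.
have g1 : ipO g (fun=> 1) = 2 * (l.1 * l.2).
  rewrite (@ipDl _ _ R mu2 Omega mO _ _ _ (S 0 0) (S 1 1) L1).
  by rewrite -!average_stressE -/tau t0 t1; ring.
have c2 (f : plane -> R) : L2O f -> ipO f (fun=> 2) = 2 * ipO f (fun=> 1).
  move=> Lf; rewrite -(@ipZr _ _ R mu2 Omega mO 2 _ _ L1 Lf).
  by apply: eq_ip => // x _; rewrite mulr1.
have := ip_ge0 mu2 Omega (fun x => g x - 2).
rewrite (@ipBl _ _ R mu2 Omega mO _ _ _ SS L2' (@L2B _ _ R mu2 Omega mO _ _ SS L2')).
rewrite (@ipBr _ _ R mu2 Omega mO _ _ _ SS L2' SS) (@ipBr _ _ R mu2 Omega mO _ _ _ SS L2' L2').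
rewrite (@ipC _ _ R mu2 Omega (fun=> 2) g) (c2 g SS) g1 (c2 _ L2').
rewrite (@ipC _ _ R mu2 Omega (fun=> 2) (fun=> 1)) (c2 _ L1).
have area : ipO (fun=> 1) (fun=> 1) <= l.1 * l.2.
  have cO : (mu2 Omega <= mu2 (cell c l))%E.
    by apply: le_measure => //; rewrite inE //; exact: measurable_cell.
  have cE : mu2 (cell c l) = (l.1 * l.2)%:E.
    rewrite product_measure1E; [|exact: measurable_itv|exact: measurable_itv].
    rewrite /= !lebesgue_measure_itv /= !lte_fin !ltrDl l1 l2 -EFinM.
    by congr EFin; ring.
  rewrite /ip (_ : \int[mu2]_(x in Omega) (1 * 1) = 1 * fine (mu2 Omega)); last first.
    by rewrite -[RHS](@Rintegral_cst _ _ R mu2 Omega mO 1); apply: eq_Rintegral => x _;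
      rewrite mulr1.
  rewrite mul1r -lee_fin fineK -?cE //.
  rewrite ge0_fin_numE //; exact: (Omega_finite oO bO).
move=> h; rewrite ler_pdivlMl // mulr1 ler_pdivlMl //.
exact: (square_expansion_le area h).
Qed.

End elasticity.

(** * Effective moduli *)

Section effective_moduli.
Variable R : realType.
Implicit Types (a b s r c l : R) (K G : R).

Lemma itvoo_subset a b a' b' : a < b -> `]a, b[ `<=` `]a', b'[ -> a' <= a /\ b <= b'.
Proof.
move=> ab sub; split; rewrite leNgt; apply/negP => lt.
- have : a < Num.min a' b by rewrite lt_min lt ab.
  move=> /midf_lt[lo]; rewrite lt_min => /andP[hi1 hi2].
  have /sub : ((a + Num.min a' b) / 2) \in `]a, b[ by rewrite in_itv /= lo hi2.
  by rewrite /= in_itv /= => /andP[/(lt_trans hi1)]; rewrite ltxx.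
- have : Num.max a b' < b by rewrite gt_max lt ab.
  move=> /midf_lt[]; rewrite gt_max => /andP[lo1 lo2] hi.
  have /sub : ((Num.max a b' + b) / 2) \in `]a, b[ by rewrite in_itv /= lo1 hi.
  by rewrite /= in_itv /= => /andP[_ /(lt_trans lo2)]; rewrite ltxx.
Qed.

(** The two segments span the full width and height of the first rectangle and lie in [Omega], hence
    in the second rectangle. Applied both ways, this makes the cell a function of [Omega]. *)
Lemma periodicity_cell_subset (c l c' l' : R * R) (Omega : set (R * R)) :
  periodicity_cell c l Omega -> periodicity_cell c' l' Omega ->
  [/\ c'.1 <= c.1, c.1 + l.1 <= c'.1 + l'.1,
      c'.2 <= c.2 & c.2 + l.2 <= c'.2 + l'.2].
Proof.
move=> [[l1 l2] _ _ [alpha [sub1 _]] [beta [sub2 _]]] [_ [_ cell'] _ _ _].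
have /itvoo_subset[] : `]c.1, c.1 + l.1[ `<=` `]c'.1, c'.1 + l'.1[.
- by move=> x xI; have [] := cell' _ (sub1 (x, alpha) (conj xI erefl)).
- by rewrite ltrDl.
have /itvoo_subset[] : `]c.2, c.2 + l.2[ `<=` `]c'.2, c'.2 + l'.2[.
- by move=> x xI; have [] := cell' _ (sub2 (beta, x) (conj erefl xI)).
- by rewrite ltrDl.
by [].
Qed.

Lemma periodicity_cell_unique (c l c' l' : R * R) (Omega : set (R * R)) :
  periodicity_cell c l Omega -> periodicity_cell c' l' Omega -> c' = c /\ l' = l.
Proof.
move=> P P'; have [h1 h2 h3 h4] := periodicity_cell_subset P P'.
have [k1 k2 k3 k4] := periodicity_cell_subset P' P.
case: c l c' l' {P P'} h1 h2 h3 h4 k1 k2 k3 k4 => [c1 c2] [m1 m2] [d1 d2] [n1 n2] /=.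
by move=> *; split; congr pair; lra.
Qed.

Definition sym_mx s0 s1 s2 : 'M[R]_2 :=
  \matrix_(i, j) if i == j then (if i == 0 then s0 else s1) else s2.

Lemma sym_mxT s0 s1 s2 : (sym_mx s0 s1 s2)^T = sym_mx s0 s1 s2.
Proof. by apply/matrixP => i j; rewrite !mxE eq_sym; case: eqP => // ->. Qed.

Lemma sym_mxE s0 s1 s2 : (sym_mx s0 s1 s2 0 0 = s0) *
  (sym_mx s0 s1 s2 1 1 = s1) * (sym_mx s0 s1 s2 0 1 = s2).
Proof. by do 2?split; rewrite !mxE. Qed.

(** The strain [xi] is the preimage of the stress under the effective tensor: [Ks] acts on the
    trace, [Gs] on the difference of the diagonal entries, [Hs] on [2 * xi 0 1]. *)
Lemma prescribed_stress (Omega : set (R * R)) (c l : R * R) K G (Ks Gs Hs s0 s1 s2 : R)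
    (xi := sym_mx ((s0 + s1) / (4 * Ks) + (s0 - s1) / (4 * Gs))
                  ((s0 + s1) / (4 * Ks) - (s0 - s1) / (4 * Gs)) (s2 / (2 * Hs))) :
  effective_moduli Omega c l K G Ks Gs Hs ->
  exists2 u, energy_minimizer Omega c l K G xi u &
    [/\ average_stress Omega l K G u 0 0 = s0,
        average_stress Omega l K G u 1 1 = s1 &
        average_stress Omega l K G u 0 1 = s2].
Proof.
move=> [Ks0 Gs0 Hs0 /(_ xi (sym_mxT _ _ _))[tau [u [min tauE]] [t0 t1 t2]]].
exists u; first exact: min.
rewrite -tauE t0 t1 t2 /xi !sym_mxE; move: (lt0r_neq0 Ks0) (lt0r_neq0 Gs0) (lt0r_neq0 Hs0).
clear; move=> Ks0 Gs0 Hs0.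
by split; field; rewrite ?Ks0 ?Gs0 ?Hs0.
Qed.

(** The left side is the quadratic form of the inverse effective tensor, that is, the average stress
    paired with the strain that [prescribed_stress] attaches to it. *)
Lemma effective_compliance (Omega : set (R * R)) (c l : R * R) K G (Ks Gs Hs : R)
    K1 G1 xi1 u1 s0 s1 s2 :
  periodicity_cell c l Omega -> 0 < K -> 0 < G ->
  effective_moduli Omega c l K G Ks Gs Hs -> 0 < K1 -> 0 < G1 ->
  xi1^T = xi1 -> energy_minimizer Omega c l K1 G1 xi1 u1 ->
  average_stress Omega l K1 G1 u1 0 0 = s0 ->
  average_stress Omega l K1 G1 u1 1 1 = s1 ->
  average_stress Omega l K1 G1 u1 0 1 = s2 ->
  (s0 + s1) ^+ 2 / (4 * Ks) + (s0 - s1) ^+ 2 / (4 * Gs) + s2 ^+ 2 / Hs =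
  (K^-1 + G^-1) * stress_energy Omega l K1 G1 u1 - G^-1 * (s0 * s1 - s2 ^+ 2).
Proof.
move=> [[l1 l2] [[bO _ oO _] Ocell] _ _ _] K0 G0 mod K10 G10 sxi1 min1 t0 t1 t2.
have [u min [u0 u1' u2]] := prescribed_stress s0 s1 s2 mod.
have := compliance oO bO l1 l2 Ocell K0 G0 K10 G10 (sym_mxT _ _ _) sxi1 min min1
  (etrans u0 (esym t0)) (etrans u1' (esym t1)) (etrans u2 (esym t2)).
cbv zeta; rewrite u0 u1' u2 => <-; rewrite !sym_mxE.
case: mod => /lt0r_neq0 + /lt0r_neq0 + /lt0r_neq0 + _.
by clear; move=> Ks0 Gs0 Hs0; field; rewrite ?Ks0 ?Gs0 ?Hs0.
Qed.

(** The sums are left unevaluated so that the three instances of [effective_compliance] match as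
    they are. The shift of [m0] by 1 comes from the determinant 1 of the identity stress; the other
    two stresses have determinant -1. *)
Lemma inverse_moduli (p q m0 m1 m2 Ks Gs Hs : R) :
  (1 + 1) ^+ 2 / (4 * Ks) + (1 - 1) ^+ 2 / (4 * Gs) + 0 ^+ 2 / Hs =
    (p + q) * m0 - q * (1 * 1 - 0 ^+ 2) ->
  (1 + -1) ^+ 2 / (4 * Ks) + (1 - -1) ^+ 2 / (4 * Gs) + 0 ^+ 2 / Hs =
    (p + q) * m1 - q * (1 * -1 - 0 ^+ 2) ->
  (0 + 0) ^+ 2 / (4 * Ks) + (0 - 0) ^+ 2 / (4 * Gs) + 1 ^+ 2 / Hs =
    (p + q) * m2 - q * (0 * 0 - 1 ^+ 2) ->
  [/\ Ks^-1 = p + (m0 - 1) * (p + q), Gs^-1 = q + m1 * (p + q) &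
      Hs^-1 = q + m2 * (p + q)].
Proof. by rewrite !invfM => e0 e1 e2; split; lra. Qed.

End effective_moduli.

Theorem theorem1 (R : realType) (Omega : set (R * R))
    (Omega_adm : admissible_cell Omega) :
  exists A1 A2 A3 : R,
    [/\ 0 <= A1, 0 <= A2, 0 <= A3 &
     forall (c l : R * R) (K G Ks Gs G45 : R),
       periodicity_cell c l Omega -> 0 < K -> 0 < G ->
       effective_moduli Omega c l K G Ks Gs G45 ->
       [/\ Ks^-1 = K^-1 + A1 * (K^-1 + G^-1),
           Gs^-1 = G^-1 + A2 * (K^-1 + G^-1) &
           G45^-1 = G^-1 + A3 * (K^-1 + G^-1)]].
Proof.
(* The reference material is [K = G = 1]; any fixed pair of moduli would give the same constants. *)
case: Omega_adm => c0 [l0 [cell0 /(_ 1 1 ltr01 ltr01)[Ks0 [Gs0 [Hs0 mod0]]]]].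
have [[l1 l2] [[bO _ oO _] Ocell] _ _ _] := cell0.
have [u0 min0 [p0 p1 p2]] := prescribed_stress 1 1 0 mod0.
have [v0 min1 [q0 q1 q2]] := prescribed_stress 1 (-1) 0 mod0.
have [w0 min2 [r0 r1 r2]] := prescribed_stress 0 0 1 mod0.
pose M := stress_energy Omega l0 1 1.
have H c l xi K G u : energy_minimizer Omega c l K G xi u -> forall i, H1 Omega (u i).
  by move=> [/[swap] _ + i] => /(_ i)[].
exists (M u0 - 1), (M v0), (M w0); split.
- by rewrite subr_ge0; exact: (stress_energy_ge1 oO bO l1 l2 Ocell (H _ _ _ _ _ _ min0) p0 p1).
- exact: (stress_energy_ge0 oO l1 l2 _ _ (H _ _ _ _ _ _ min1)).
- exact: (stress_energy_ge0 oO l1 l2 _ _ (H _ _ _ _ _ _ min2)).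
move=> c l K G Ks Gs G45 cell' K0 G0 mod.
(* The constants were built from the cell [c0, l0]; any other cell for [Omega] coincides with it. *)
have [ec el] := periodicity_cell_unique cell0 cell'; subst c l.
exact: (inverse_moduli
  (effective_compliance cell0 K0 G0 mod ltr01 ltr01 (sym_mxT _ _ _) min0 p0 p1 p2)
  (effective_compliance cell0 K0 G0 mod ltr01 ltr01 (sym_mxT _ _ _) min1 q0 q1 q2)
  (effective_compliance cell0 K0 G0 mod ltr01 ltr01 (sym_mxT _ _ _) min2 r0 r1 r2)).
Qed.
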